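(* For each perfect idyll $F$, the category $F\text{-}\mathbf{Mat}_\bullet$ of pointed $F$-matroids, with $\mathfrak{M}$ the class of matroid restrictions (up to isomorphism) and $\mathfrak{E}$ the class of matroid contractions (up to isomorphism), is a combinatorial proto-exact category with duality and with exact direct sum.
   Context: **Idylls.** A pointed monoid is a commutative multiplicative monoid $B=B'\sqcup\{0\}$ with $B'$ a submonoid and $0$ absorbing. Its ambient semiring is $B^+=\mathbb N[B]/\langle 0\rangle$ (finite formal sums of elements of $B$, with $0\in B$ identified with the empty sum). A band is a pointed monoid $B$ with a null set $N_B$, a proper ideal of $B^+$ with $0\in N_B$, such that for every $a\in B$ there is a unique $b\in B$, denoted $-a$, with $a+b\in N_B$. An idyll is a band $F$ with $F^\times=F\setminus\{0\}$. **$F$-matroids.** For a tuple $\mathbf x$, $|\mathbf x|$ is its set of entries and $\mathbf x_{\hat k}$ is $\mathbf x$ with the $k$th entry deleted. A Grassmann–Plücker function of rank $r$ on a finite set $E$ is a map $\mu:E^r\to F$ that is not identically zero ($E^0$ is a one-point set), is alternating ($\mu(\mathbf x^\sigma)=\mathrm{sign}(\sigma)\mu(\mathbf x)$ for $\sigma\in S_r$, and $\mu(\mathbf x)=0$ if $\mathbf x$ has a repeated entry), and satisfies $\sum_{k=0}^r(-1)^k\mu(\mathbf x_{\hat k})\mu(x_k,\mathbf y)\in N_F$ for all $\mathbf x=(x_0,\dots,x_r)\in E^{r+1}$, $\mathbf y\in E^{r-1}$. An $F$-matroid of rank $r$ on $E$ is a class $M=[\mu]$ of such functions up to scaling by $F^\times$.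 Its underlying matroid $\underline M$ is the classical matroid whose bases are the sets $\{e_1,\dots,e_r\}$ with $\mu(e_1,\dots,e_r)\ne0$. A pointed $F$-matroid is an $F$-matroid on a pointed finite set $E_M=\tilde E_M\sqcup\{*_M\}$ with $\mu(\mathbf x)=0$ whenever some $x_i=*_M$. **Duals, vectors, perfect idylls.** For $M=[\mu]$ of rank $r$ on a totally ordered set $E$ with $n$ elements, $M^*=[\mu^*]$, where $\mu^*:E^{n-r}\to F$ is $0$ on tuples with repeated entries and otherwise $\mu^*(\mathbf x)=\mathrm{sign}(\mathbf x,\mathbf x')\mu(\mathbf x')$, with $|\mathbf x'|=E\setminus|\mathbf x|$ and $\mathrm{sign}$ the sign of the permutation of $E$ given by $(\mathbf x,\mathbf x')$. For pointed $M$, $M^*$ is obtained by deleting $*_M$, dualizing, and adding a distinguished loop. For $X,Y\in F^E$ write $X\perp Y$ if $\sum_eX_eY_e\in N_F$; $A^\perp$ is the set of vectors orthogonal to all of $A\subseteq F^E$. Circuits of $M$ are the vectors $aX_{\mathbf y}$, $a\in F^\times$, where $\mathbf y=(y_0,\dots,y_r)$ has distinct entries and some $\mu(\mathbf y_{\hat i})\neq0$, with $X_{\mathbf y}(y_k)=(-1)^k\mu(\mathbf y_{\hat k})$ and $X_{\mathbf y}(x)=0$ for $x\notin|\mathbf y|$. Let $\mathcal C_M$ be the set of circuits, $\mathcal C_M^*=\mathcal C_{M^*}$, $\mathcal V_M=(\mathcal C_M^* )^\perp$ (vectors), $\mathcal V_M^*=\mathcal C_M^\perp$ (covectors). $F$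 is perfect if $\mathcal V_M\perp\mathcal V_M^*$ for all $F$-matroids $M$. For pointed $M$, $\mathcal V_M\subseteq F^{\tilde E_M}$ denotes the vectors of the $F$-matroid obtained by deleting $*_M$. **Category.** A submonomial matrix is a matrix over $F$ with at most one nonzero entry in each row and column. If its rows are indexed by $\tilde T$ and columns by $\tilde S$, the underlying map $\underline A:S\to T$ of pointed sets sends $i\neq *_S$ to $j$ if $A_{j,i}\ne0$, and everything else to $*_T$. A morphism $f:M\to N$ is a submonomial matrix with rows indexed by $\tilde E_N$, columns by $\tilde E_M$, such that $f\cdot\mathcal V_M\subseteq\mathcal V_N$. Composition is matrix multiplication. The matroid with ground set $\{*\}$ is the zero object. **Restriction and contraction.** Let $A\subseteq E_M$ have rank $r'$ in $\underline M$. $M/A=[\mu/A]$ on $E_M\setminus A$ with $(\mu/A)(\mathbf x)=\mu(\mathbf x,\mathbf a)$, $\mathbf a\in A^{r'}$ an ordered basis of $\underline M|A$; $M|A=[\mu|A]$ on $A$ with $(\mu|A)(\mathbf x)=\mu(\mathbf x,\mathbf c)$, $\mathbf c$ an ordered basis of $\underline M/A$. For pointed matroids the distinguished loop is always kept (added to $A$ when restricting, not removed when contracting). There are morphisms $r_A:M|A\to M$ and $c_A:M\to M/A$ with entries $\delta_{ij}$. $\mathfrak M$ consists of the morphisms $r_A\circ\alpha:M\cong N|A\to N$, and $\mathfrak E$ of the morphisms $\beta\circ c_B:M\to M/B\cong N$, with $\alpha,\beta$ isomorphisms. **Proto-exact.** A proto-exact category is a category with zero object and two classes $\mathfrak M$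 (written $\rightarrowtail$), $\mathfrak E$ (written $\twoheadrightarrow$) of morphisms such that: (PE1) every $0\to X$ is in $\mathfrak M$, every $X\to0$ is in $\mathfrak E$; (PE2) both classes are closed under composition and contain all isomorphisms; (PE3) a commutative square with horizontal maps $M\rightarrowtail N$, $M'\rightarrowtail N'$ and vertical maps $M\twoheadrightarrow M'$, $N\twoheadrightarrow N'$ is Cartesian iff it is co-Cartesian; (PE4) every diagram $M'\rightarrowtail N'\twoheadleftarrow N$, and (PE5) every diagram $M'\twoheadleftarrow M\rightarrowtail N$, can be completed to a biCartesian square of this shape. A short exact sequence $A\rightarrowtail B\twoheadrightarrow C$ is such a biCartesian square with $M=A$, $N=B$, $M'=0$, $N'=C$. **Exact direct sum.** A symmetric monoidal product $\oplus$ with: (DS1) unit $0$; (DS2) $\oplus:\mathcal C\times\mathcal C\to\mathcal C$ is exact; (DS3) with the induced inclusions $\iota$ and projections $\pi$, the maps $\mathrm{Hom}(U\oplus V,W)\to\mathrm{Hom}(U,W)\times\mathrm{Hom}(V,W)$, $f\mapsto(f\iota_U,f\iota_V)$, and $\mathrm{Hom}(W,U\oplus V)\to\mathrm{Hom}(W,U)\times\mathrm{Hom}(W,V)$, $f\mapsto(\pi_Uf,\pi_Vf)$, are injective; (DS4) for each short exact sequence $U\xrightarrow{\iota}X\xrightarrow{\pi}V$: for every section $s$ of $\pi$ there is a unique isomorphism $\varphi:U\oplus V\to X$ with $\varphi\iota_U=\iota$, $\varphi\iota_V=s$; for every retraction $r$ of $\iota$ there is a unique isomorphism $\psi:U\oplus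 V\to X$ with $r\psi=\pi_U$, $\pi\psi=\pi_V$. The category is combinatorial if for every admissible mono $g:X\rightarrowtail U_1\oplus U_2$ there are admissible subobjects $\iota_k:X_k\rightarrowtail U_k$ ($k=1,2$) and an isomorphism $f:X\to X_1\oplus X_2$ with $(\iota_1\oplus\iota_2)\circ f=g$. **Duality.** A functor $P:\mathcal C\to\mathcal C^{\mathrm{op}}$ and natural isomorphism $\Theta:\mathrm{id}\to P\circ P^{\mathrm{op}}$ with $P(\Theta_U)\circ\Theta_{P(U)}=\mathrm{id}_{P(U)}$, such that (D1) $P(0)\cong0$; (D2) $f\in\mathfrak M$ iff $P(f)\in\mathfrak E$; (D3) a square $U\rightarrowtail X\twoheadrightarrow V$, $U\twoheadrightarrow W\rightarrowtail V$ is biCartesian iff its image under $P$ is. In $F\text{-}\mathbf{Mat}_\bullet$ the direct sum $M\oplus N=[\mu\oplus\nu]$ lives on $\tilde E_M\sqcup\tilde E_N\sqcup\{*\}$, with $(\mu\oplus\nu)(\mathbf x)=\mu(\mathbf x_M)\nu(\mathbf x_N)$ if the subtuples $\mathbf x_M,\mathbf x_N$ of entries in $E_M,E_N$ have $\#|\mathbf x_M|=\mathrm{rk}M$ and $\#|\mathbf x_N|=\mathrm{rk}N$, and $0$ otherwise; the duality is $M\mapsto M^*$, $f\mapsto f^t$ (transpose).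
   Formalization: In the direct sum, μ(x_M)ν(x_N) is multiplied by the sign of the shuffle taking x to (x_M, x_N); without this sign the displayed formula is not alternating when −1≠1 in F (e.g. two rank-one matroids). *)

(* Defs.v *)
From mathcomp Require Import all_boot fingroup perm.
From mathcomp Require Import boolp classical_sets.

Set Implicit Arguments.
Unset Strict Implicit.
Unset Printing Implicit Defensive.

Record category := Category {
  ob :> Type;
  hom : ob -> ob -> Type;
  idc : forall X, hom X X;
  comp : forall X Y Z, hom Y Z -> hom X Y -> hom X Z;
  compA : forall W X Y Z (h : hom Y Z) (g : hom X Y) (f : hom W X),
    comp h (comp g f) = comp (comp h g) f;
  comp1c : forall X Y (f : hom X Y), comp (idc Y) f = f;
  compc1 : forall X Y (f : hom X Y), comp f (idc X) = f }.

Arguments hom {c} X Y.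
Arguments idc {c} X.
Arguments comp {c X Y Z} g f.

Notation "g \oc f" := (comp g f) (at level 40, left associativity).

Section OppositeAndProduct.
Variables C D : category.

Definition op_cat : category :=
  @Category C (fun X Y => @hom C Y X) (fun X => idc X)
    (fun X Y Z g f => f \oc g)
    (fun W X Y Z h g f => esym (compA f g h))
    (fun X Y f => compc1 f) (fun X Y f => comp1c f).

Definition prod_cat : category.
Proof.
refine (@Category (C * D)%type
  (fun X Y => (hom X.1 Y.1 * hom X.2 Y.2)%type)
  (fun X => (idc X.1, idc X.2))
  (fun X Y Z g f => (g.1 \oc f.1, g.2 \oc f.2)) _ _ _).
- by move=> W X Y Z h g f; rewrite !compA.
- by move=> X Y [f1 f2]; rewrite !comp1c.
- by move=> X Y [f1 f2]; rewrite !compc1.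
Defined.

End OppositeAndProduct.

Record functor_data (C D : category) := FunctorData {
  fob :> C -> D;
  fhom : forall X Y, hom X Y -> hom (fob X) (fob Y) }.

Arguments fhom {C D} f {X Y} _.

Definition functorial (C D : category) (T : functor_data C D) : Prop :=
  (forall X : C, fhom T (idc X) = idc (T X)) /\
  (forall (X Y Z : C) (g : hom Y Z) (f : hom X Y),
      fhom T (g \oc f) = fhom T g \oc fhom T f).

Section Squares.
Variable C : category.

Definition inverse_pair (X Y : C) (f : hom X Y) (g : hom Y X) : Prop :=
  g \oc f = idc X /\ f \oc g = idc Y.

Definition is_iso (X Y : C) (f : hom X Y) : Prop :=
  exists g : hom Y X, inverse_pair f g.

(*       i
     M ---> N
   q |      | p
     v      v
     M' --> N'
         j            *)
Definition cartesian (M N M' N' : C)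
    (i : hom M N) (q : hom M M') (p : hom N N') (j : hom M' N') : Prop :=
  p \oc i = j \oc q /\
  forall (W : C) (h : hom W N) (k : hom W M'), p \oc h = j \oc k ->
    exists! u : hom W M, i \oc u = h /\ q \oc u = k.

Definition cocartesian (M N M' N' : C)
    (i : hom M N) (q : hom M M') (p : hom N N') (j : hom M' N') : Prop :=
  p \oc i = j \oc q /\
  forall (W : C) (h : hom N W) (k : hom M' W), h \oc i = k \oc q ->
    exists! u : hom N' W, u \oc p = h /\ u \oc j = k.

Definition bicartesian (M N M' N' : C)
    (i : hom M N) (q : hom M M') (p : hom N N') (j : hom M' N') : Prop :=
  cartesian i q p j /\ cocartesian i q p j.

End Squares.

Record pe_data := PEData {
  pe_cat :> category;
  pe_zero : pe_cat;
  from0 : forall X : pe_cat, hom pe_zero X;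
  to0 : forall X : pe_cat, hom X pe_zero;
  adm_mono : forall X Y : pe_cat, hom X Y -> Prop;
  adm_epi : forall X Y : pe_cat, hom X Y -> Prop }.

Arguments from0 {p} X.
Arguments to0 {p} X.
Arguments adm_mono {p X Y} _.
Arguments adm_epi {p X Y} _.

Definition prod_pe (C D : pe_data) : pe_data :=
  @PEData (prod_cat C D) (pe_zero C, pe_zero D)
    (fun X => (from0 X.1, from0 X.2)) (fun X => (to0 X.1, to0 X.2))
    (fun X Y f => adm_mono f.1 /\ adm_mono f.2)
    (fun X Y f => adm_epi f.1 /\ adm_epi f.2).

Section ProtoExact.
Variable C : pe_data.

Definition zero_object : Prop :=
  forall X : C, (forall f : hom (pe_zero C) X, f = from0 X) /\
                (forall f : hom X (pe_zero C), f = to0 X).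

Definition pe_square (M N M' N' : C)
    (i : hom M N) (q : hom M M') (p : hom N N') (j : hom M' N') : Prop :=
  [/\ adm_mono i, adm_epi q, adm_epi p & adm_mono j].

Definition PE1 : Prop :=
  forall X : C, adm_mono (from0 X) /\ adm_epi (to0 X).

Definition PE2 : Prop :=
  (forall (X Y Z : C) (g : hom Y Z) (f : hom X Y),
     (adm_mono g -> adm_mono f -> adm_mono (g \oc f)) /\
     (adm_epi g -> adm_epi f -> adm_epi (g \oc f))) /\
  (forall (X Y : C) (f : hom X Y), is_iso f -> adm_mono f /\ adm_epi f).

Definition PE3 : Prop :=
  forall (M N M' N' : C)
    (i : hom M N) (q : hom M M') (p : hom N N') (j : hom M' N'),
    pe_square i q p j -> p \oc i = j \oc q ->
    (cartesian i q p j <-> cocartesian i q p j).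

Definition PE4 : Prop :=
  forall (N M' N' : C) (p : hom N N') (j : hom M' N'),
    adm_epi p -> adm_mono j ->
    exists (M : C) (i : hom M N) (q : hom M M'),
      pe_square i q p j /\ bicartesian i q p j.

Definition PE5 : Prop :=
  forall (M N M' : C) (i : hom M N) (q : hom M M'),
    adm_mono i -> adm_epi q ->
    exists (N' : C) (p : hom N N') (j : hom M' N'),
      pe_square i q p j /\ bicartesian i q p j.

Definition proto_exact : Prop :=
  zero_object /\ [/\ PE1, PE2, PE3, PE4 & PE5].

Definition short_exact (U X V : C) (i : hom U X) (p : hom X V) : Prop :=
  pe_square i (to0 U) p (from0 V) /\ bicartesian i (to0 U) p (from0 V).

End ProtoExact.

(* Exactness is understood as preservation of all admissible biCartesian      *)
(* squares, of which short exact sequences are the special case M' = 0.      *)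
Definition exact_functor (C D : pe_data) (T : functor_data C D) : Prop :=
  [/\ functorial T,
      exists f : hom (T (pe_zero C)) (pe_zero D), is_iso f,
      forall (X Y : C) (f : hom X Y), adm_mono f -> adm_mono (fhom T f),
      forall (X Y : C) (f : hom X Y), adm_epi f -> adm_epi (fhom T f)
    & forall (M N M' N' : C)
        (i : hom M N) (q : hom M M') (p : hom N N') (j : hom M' N'),
        pe_square i q p j -> bicartesian i q p j ->
        bicartesian (fhom T i) (fhom T q) (fhom T p) (fhom T j)].

(* Data of a symmetric monoidal product whose unit is the zero object (DS1). *)
Record ds_data (C : pe_data) := DSData {
  ds_fun : functor_data (prod_cat C C) C;
  ds_assoc : forall U V W : C,
    hom (ds_fun (ds_fun (U, V), W)) (ds_fun (U, ds_fun (V, W)));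
  ds_lunit : forall U : C, hom (ds_fun (pe_zero C, U)) U;
  ds_lunitV : forall U : C, hom U (ds_fun (pe_zero C, U));
  ds_runit : forall U : C, hom (ds_fun (U, pe_zero C)) U;
  ds_runitV : forall U : C, hom U (ds_fun (U, pe_zero C));
  ds_braid : forall U V : C, hom (ds_fun (U, V)) (ds_fun (V, U)) }.

Section DirectSum.
Variables (C : pe_data) (S : ds_data C).

Definition ds (U V : C) : C := ds_fun S (U, V).

Definition dsm (U U' V V' : C) (f : hom U U') (g : hom V V') :
    hom (ds U V) (ds U' V') :=
  @fhom _ _ (ds_fun S) (U, V) (U', V') (f, g).

Local Notation "U (+) V" := (ds U V) (at level 50, left associativity).
Local Notation "f [+] g" := (dsm f g) (at level 35).
Local Notation as_ U V W := (ds_assoc S U V W).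

Definition symmetric_monoidal : Prop :=
  [/\ functorial (ds_fun S),
    [/\ forall U V W, is_iso (as_ U V W),
      forall U, inverse_pair (ds_lunit S U) (ds_lunitV S U),
      forall U, inverse_pair (ds_runit S U) (ds_runitV S U)
    & forall U V, ds_braid S V U \oc ds_braid S U V = idc (U (+) V)],
    [/\ forall U U' V V' W W' (f : hom U U') (g : hom V V') (h : hom W W'),
        as_ U' V' W' \oc ((f [+] g) [+] h) = (f [+] (g [+] h)) \oc as_ U V W,
      forall U U' (f : hom U U'),
        ds_lunit S U' \oc (idc (pe_zero C) [+] f) = f \oc ds_lunit S U,
      forall U U' (f : hom U U'),
        ds_runit S U' \oc (f [+] idc (pe_zero C)) = f \oc ds_runit S U
    & forall U U' V V' (f : hom U U') (g : hom V V'),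
        ds_braid S U' V' \oc (f [+] g) = (g [+] f) \oc ds_braid S U V]
  & [/\ forall U V W X,
        as_ U V (W (+) X) \oc as_ (U (+) V) W X =
        (idc U [+] as_ V W X) \oc as_ U (V (+) W) X \oc (as_ U V W [+] idc X),
      forall U V,
        (idc U [+] ds_lunit S V) \oc as_ U (pe_zero C) V =
        ds_runit S U [+] idc V
    & forall U V W,
        as_ V W U \oc ds_braid S U (V (+) W) \oc as_ U V W =
        (idc V [+] ds_braid S U W) \oc as_ V U W
          \oc (ds_braid S U V [+] idc W)]].

Definition ds_in1 (U V : C) : hom U (U (+) V) :=
  (idc U [+] from0 V) \oc ds_runitV S U.
Definition ds_in2 (U V : C) : hom V (U (+) V) :=
  (from0 U [+] idc V) \oc ds_lunitV S V.
Definition ds_pr1 (U V : C) : hom (U (+) V) U :=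
  ds_runit S U \oc (idc U [+] to0 V).
Definition ds_pr2 (U V : C) : hom (U (+) V) V :=
  ds_lunit S V \oc (to0 U [+] idc V).

Definition DS2 : Prop := @exact_functor (prod_pe C C) C (ds_fun S).

Definition DS3 : Prop :=
  (forall (U V W : C) (f g : hom (U (+) V) W),
     f \oc ds_in1 U V = g \oc ds_in1 U V ->
     f \oc ds_in2 U V = g \oc ds_in2 U V -> f = g) /\
  (forall (U V W : C) (f g : hom W (U (+) V)),
     ds_pr1 U V \oc f = ds_pr1 U V \oc g ->
     ds_pr2 U V \oc f = ds_pr2 U V \oc g -> f = g).

Definition DS4 : Prop :=
  forall (U X V : C) (i : hom U X) (p : hom X V), short_exact i p ->
    (forall s : hom V X, p \oc s = idc V ->
       exists! phi : hom (U (+) V) X,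
         [/\ is_iso phi, phi \oc ds_in1 U V = i & phi \oc ds_in2 U V = s]) /\
    (forall r : hom X U, r \oc i = idc U ->
       exists! psi : hom (U (+) V) X,
         [/\ is_iso psi, r \oc psi = ds_pr1 U V & p \oc psi = ds_pr2 U V]).

Definition exact_direct_sum : Prop :=
  [/\ symmetric_monoidal, DS2, DS3 & DS4].

Definition combinatorial : Prop :=
  forall (X U1 U2 : C) (g : hom X (U1 (+) U2)), adm_mono g ->
    exists (X1 X2 : C) (i1 : hom X1 U1) (i2 : hom X2 U2)
           (f : hom X (X1 (+) X2)),
      [/\ adm_mono i1, adm_mono i2, is_iso f & (i1 [+] i2) \oc f = g].

End DirectSum.

Record dual_data (C : category) := DualData {
  du_fun : functor_data C (op_cat C);
  du_theta : forall U : C, @hom C U (du_fun (du_fun U)) }.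

Section Duality.
Variables (C : pe_data) (P : dual_data C).

Definition du (U : C) : C := du_fun P U.

Definition dum (U V : C) (f : hom U V) : hom (du V) (du U) :=
  fhom (du_fun P) f.

Definition theta (U : C) : hom U (du (du U)) := du_theta P U.

Definition D1 : Prop := exists f : hom (du (pe_zero C)) (pe_zero C), is_iso f.

Definition D2 : Prop :=
  forall (U V : C) (f : hom U V), adm_mono f <-> adm_epi (dum f).

Definition D3 : Prop :=
  forall (U X W V : C)
    (i : hom U X) (q : hom U W) (p : hom X V) (j : hom W V),
    pe_square i q p j ->
    (bicartesian i q p j <-> bicartesian (dum p) (dum j) (dum i) (dum q)).

Definition duality : Prop :=
  [/\ functorial (du_fun P),
      (forall U, is_iso (theta U)) /\
      (forall U V (f : hom U V), theta V \oc f = dum (dum f) \oc theta U),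
      forall U, dum (theta U) \oc theta (du U) = idc (du U)
    & [/\ D1, D2 & D3]].

End Duality.

(* A finite formal sum is a finite sequence of its terms; two sequences      *)
(* represent the same element of the ambient semiring B^+ = N[B]/<0> iff     *)
(* they agree up to permutation and up to terms equal to 0. A subset of B^+  *)
(* is thus a predicate on [seq B] subject to [nullS_perm] and [nullS_zero].  *)
Record band := Band {
  bsort :> eqType;
  bzero : bsort;
  bone : bsort;
  bmul : bsort -> bsort -> bsort;
  bopp : bsort -> bsort;
  nullS : seq bsort -> Prop;
  bmulA : associative bmul;
  bmulC : commutative bmul;
  bmul1 : left_id bone bmul;
  bmul0 : left_zero bzero bmul;
  bone_neq0 : bone != bzero;
  bmul_neq0 : forall a b, a != bzero -> b != bzero -> bmul a b != bzero;
  nullS_perm : forall s t, perm_eq s t -> nullS s -> nullS t;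
  nullS_zero : forall s, nullS (bzero :: s) <-> nullS s;
  nullS_nil : nullS [::];
  nullS_cat : forall s t, nullS s -> nullS t -> nullS (s ++ t);
  nullS_mul : forall s t, nullS t -> nullS [seq bmul a b | a <- s, b <- t];
  nullS_proper : exists s, ~ nullS s;
  bopp_null : forall a, nullS [:: a; bopp a];
  bopp_unique : forall a b, nullS [:: a; b] -> b = bopp a }.

Record idyll := Idyll {
  iband :> band;
  idyll_inv : forall a : iband, a != bzero iband ->
    exists b : iband, bmul a b = bone iband }.

Declare Scope idyll_scope.
Delimit Scope idyll_scope with idyll.
Local Open Scope idyll_scope.
Notation "0" := (bzero _) : idyll_scope.
Notation "1" := (bone _) : idyll_scope.
Notation "x * y" := (bmul x y) : idyll_scope.

Definition sgn (F : band) (odd_sign : bool) : F := if odd_sign then bopp 1 else 1.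
Arguments sgn {F} odd_sign.

(* The sum of a family with at most one non-zero term, as an element of F.   *)
Definition sum1 (F : band) (I : finType) (a : I -> F) : F :=
  if [pick i | a i != 0] is Some i then a i else 0.

Definition del (E : Type) (k : nat) (s : seq E) : seq E :=
  take k s ++ drop k.+1 s.

Section Matroids.
Variable F : idyll.

Local Open Scope classical_set_scope.
Local Open Scope idyll_scope.

(* A map E^r -> F is encoded as a map [seq E -> F] that vanishes on all      *)
(* sequences of length other than r. For r = 0 there is no y in E^(r-1) and  *)
(* the Plucker relations are void.                                           *)
Record grassmann_plucker (E : finType) (r : nat) (mu : seq E -> F) : Prop :=
  GrassmannPlucker {
    gp_supp : forall s, size s != r -> mu s = 0;
    gp_neq0 : exists s, mu s != 0;
    gp_alt : forall (sigma : 'S_r) (x : r.-tuple E),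
      mu [tuple tnth x (sigma i) | i < r] = sgn (odd_perm sigma) * mu x;
    gp_rep : forall s, ~~ uniq s -> mu s = 0;
    gp_rel : forall (x : r.+1.-tuple E) (y : seq E), (size y).+1 = r ->
      nullS [seq sgn (odd k) * (mu (del k x) * mu (tnth x k :: y))
            | k : 'I_r.+1] }.

Definition scaling_class (E : finType) (mu : seq E -> F) : set (seq E -> F) :=
  [set nu | exists2 a : F, a != 0 & nu = fun s => a * mu s].

(* An F-matroid on E is a scaling class, seen as a set of functions; the     *)
(* constructions below are defined on arbitrary sets of functions.           *)
Definition is_matroid (E : finType) (M : set (seq E -> F)) : Prop :=
  exists (r : nat) (mu : seq E -> F),
    grassmann_plucker r mu /\ M = scaling_class mu.

Section Unpointed.
Variable E : finType.
Implicit Types (M : set (seq E -> F)) (X Y : E -> F).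

(* The sign of the permutation of E, ordered by [enum E], whose one-line     *)
(* notation is s.                                                            *)
Definition perm_sign (s : seq E) : F :=
  if [pick sigma : {perm E} | [seq sigma e | e <- enum E] == s] is Some sigma
  then sgn (odd_perm sigma) else 0.

(* Any other ordering of the complement of x gives the same value.           *)
Definition dual_fun (mu : seq E -> F) (x : seq E) : F :=
  let x' := [seq e <- enum E | e \notin x] in
  if uniq x then perm_sign (x ++ x') * mu x' else 0.

Definition dual M : set (seq E -> F) := [set dual_fun mu | mu in M].

Definition perp X Y : Prop := nullS [seq X e * Y e | e <- enum E].

Definition perp_set (A : set (E -> F)) : set (E -> F) :=
  [set X | forall Y, A Y -> perp X Y].

Definition circuit_vec (mu : seq E -> F) (y : seq E) : E -> F :=
  fun e => if e \in y then sgn (odd (index e y)) * mu (del (index e y) y)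
           else 0.

(* mu (del i y) != 0 forces y to have length r + 1, r the rank of mu.        *)
Definition circuits M : set (E -> F) :=
  [set X | exists (mu : seq E -> F) (y : seq E) (a : F),
     [/\ M mu, uniq y, exists2 i, i < size y & mu (del i y) != 0,
         a != 0 & X = fun e => a * circuit_vec mu y e]].

Definition cocircuits M := circuits (dual M).
Definition vectors M := perp_set (cocircuits M).
Definition covectors M := perp_set (circuits M).

(* Bases of the underlying matroid; classical matroids are given by their    *)
(* sets of bases.                                                            *)
Definition bases M : set {set E} :=
  [set B : {set E} | exists (mu : seq E -> F) (s : seq E),
     [/\ M mu, mu s != 0 & B = [set e in s]%SET]].

Definition independent (BB : set {set E}) (I : {set E}) : Prop :=
  exists2 B, BB B & I \subset B.

Definition bases_restr (BB : set {set E}) (A : {set E}) : set {set E} :=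
  [set J : {set E} | [/\ independent BB J, J \subset A
            & forall I : {set E}, independent BB I -> I \subset A ->
                J \subset I -> I = J]].

Definition bases_contr (BB : set {set E}) (A : {set E}) : set {set E} :=
  [set I : {set E} | I \subset (~: A)%SET /\
           exists2 J, bases_restr BB A J & BB (I :|: J)%SET].

End Unpointed.

Definition perfect : Prop :=
  forall (E : finType) (M : set (seq E -> F)), is_matroid M ->
    forall X Y : E -> F, vectors M X -> covectors M Y -> perp X Y.

(* M|A and M/(E\A), for A the image of an injection h : E' -> E, transported *)
(* to E' along h. All choices of the ordered basis give the same class.      *)
Section Minors.
Variables (E' E : finType) (h : E' -> E) (M : set (seq E -> F)).
Let A : {set E} := [set h e | e : E']%SET.

Definition restr_along : set (seq E' -> F) :=
  [set nu | exists (mu : seq E -> F) (c : seq E),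
     [/\ M mu, uniq c, bases_contr (bases M) A [set e in c]%SET
       & nu = fun x => mu (map h x ++ c)]].

Definition contr_along : set (seq E' -> F) :=
  [set nu | exists (mu : seq E -> F) (a : seq E),
     [/\ M mu, uniq a, bases_restr (bases M) (~: A)%SET [set e in a]%SET
       & nu = fun x => mu (map h x ++ a)]].

End Minors.

(* Pointed F-matroids: the pointed set E_M is [option T], with *_M = None.   *)

Definition is_pmatroid (T : finType) (M : set (seq (option T) -> F)) : Prop :=
  is_matroid M /\ forall mu, M mu -> forall s, None \in s -> mu s = 0.

Record pmatroid := PMatroid {
  ground : finType;
  pclass :> set (seq (option ground) -> F);
  pclassP : is_pmatroid pclass }.

Section PointedConstructions.
Variables S T : finType.
Implicit Type M : set (seq (option T) -> F).

Definition delete_point M : set (seq T -> F) := restr_along Some M.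

Definition add_loop (N : set (seq T -> F)) : set (seq (option T) -> F) :=
  [set (fun x => if None \in x then 0 else nu (pmap id x)) | nu in N].

Definition pvectors M : set (T -> F) := vectors (delete_point M).

Definition pdual M : set (seq (option T) -> F) :=
  add_loop (dual (delete_point M)).

Definition prestr M (A : {set T}) : set (seq (option {x | x \in A}) -> F) :=
  restr_along (omap val) M.

Definition pcontr M (A : {set T}) : set (seq (option {x | x \notin A}) -> F) :=
  contr_along (omap val) M.

(* The parity of the number of pairs i < j with x_i in T and x_j in S is the *)
(* sign of the permutation that takes x to (x_S, x_T); this sign is needed   *)
(* for [dsum_fun mu nu] to be alternating.                                   *)
Fixpoint unshuffle_odd (x : seq (option (S + T))) : bool :=
  match x with
  | [::] => false
  | Some (inr _) :: x' =>
      odd (count (fun o => if o is Some (inl _) then true else false) x')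
      (+) unshuffle_odd x'
  | _ :: x' => unshuffle_odd x'
  end.

Definition lpart (x : seq (option (S + T))) : seq (option S) :=
  pmap (fun o => if o is Some (inl e) then Some (Some e) else None) x.
Definition rpart (x : seq (option (S + T))) : seq (option T) :=
  pmap (fun o => if o is Some (inr e) then Some (Some e) else None) x.

Definition dsum_fun (mu : seq (option S) -> F) (nu : seq (option T) -> F)
    (x : seq (option (S + T))) : F :=
  if None \in x then 0
  else sgn (unshuffle_odd x) * (mu (lpart x) * nu (rpart x)).

Definition dsum (M : set (seq (option S) -> F)) (N : set (seq (option T) -> F)) :
    set (seq (option (S + T)) -> F) :=
  [set lam | exists (mu : seq (option S) -> F) (nu : seq (option T) -> F),
     [/\ M mu, N nu & lam = dsum_fun mu nu]].

End PointedConstructions.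

Arguments prestr {T} M A.
Arguments pcontr {T} M A.

(* Submonomial matrices: f j i is the entry in row j and column i.           *)

Definition submonomial (S T : finType) (f : T -> S -> F) : Prop :=
  (forall j i i', f j i != 0 -> f j i' != 0 -> i = i') /\
  (forall i j j', f j i != 0 -> f j' i != 0 -> j = j').

Definition mx_act (S T : finType) (f : T -> S -> F) (X : S -> F) : T -> F :=
  fun j => sum1 (fun i => f j i * X i).

Definition mx_mul (S T U : finType) (g : U -> T -> F) (f : T -> S -> F) :
    U -> S -> F :=
  fun k i => sum1 (fun j => g k j * f j i).

Definition mx_tr (S T : finType) (f : T -> S -> F) : S -> T -> F :=
  fun i j => f j i.

Definition mx_fun (S T : finType) (h : S -> T) : T -> S -> F :=
  fun j i => if j == h i then 1 else 0.

Definition mx_block (S S' T T' : finType) (f : S' -> S -> F) (g : T' -> T -> F) :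
    S' + T' -> S + T -> F :=
  fun j i => match j, i with
             | inl j', inl i' => f j' i'
             | inr j', inr i' => g j' i'
             | _, _ => 0
             end.

Definition is_hom (S T : finType) (V : set (S -> F)) (W : set (T -> F))
    (f : T -> S -> F) : Prop :=
  submonomial f /\ forall X, V X -> W (mx_act f X).

Record phom (M N : pmatroid) := PHom {
  hom_mx :> ground N -> ground M -> F;
  hom_mxP : is_hom (pvectors M) (pvectors N) hom_mx }.

Lemma bmulr0 (a : F) : a * 0 = 0.
Proof. by rewrite bmulC bmul0. Qed.

Lemma bmulr1 (a : F) : a * 1 = a.
Proof. by rewrite bmulC bmul1. Qed.

Lemma bmul_neq0E (a b : F) : (a * b != 0) = (a != 0) && (b != 0).
Proof.
have [->|a0] := eqVneq a 0; first by rewrite bmul0 eqxx.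
have [->|b0] := eqVneq b 0; first by rewrite bmulr0 eqxx.
by rewrite bmul_neq0.
Qed.

Lemma sum1_neq0 (I : finType) (a : I -> F) :
  sum1 a != 0 -> exists2 i, a i != 0 & sum1 a = a i.
Proof. by rewrite /sum1; case: pickP => [i ai _|_]; [exists i | rewrite eqxx]. Qed.

Lemma sum1_unique (I : finType) (a : I -> F) (i : I) :
  (forall j, a j != 0 -> j = i) -> sum1 a = a i.
Proof.
rewrite /sum1 => ai; case: pickP => [j /ai-> //|/(_ i)/=].
by move/negbT; rewrite negbK => /eqP->.
Qed.

Lemma sum1_0 (I : finType) (a : I -> F) : (forall i, a i = 0) -> sum1 a = 0.
Proof. by rewrite /sum1 => a0; case: pickP => // i; rewrite a0 eqxx. Qed.

Lemma eq_sum1 (I : finType) (a b : I -> F) : a =1 b -> sum1 a = sum1 b.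
Proof. by move=> /funext->. Qed.

Lemma sum1_mull (I : finType) (c : F) (a : I -> F) :
  c * sum1 a = sum1 (fun i => c * a i).
Proof.
have [->|c0] := eqVneq c 0.
  by rewrite bmul0 sum1_0// => i; rewrite bmul0.
rewrite /sum1 (eq_pick (Q := fun i => a i != 0)); last first.
  by move=> i /=; rewrite bmul_neq0E c0.
by case: pickP => // _; rewrite bmulr0.
Qed.

Lemma sum1_mulr (I : finType) (c : F) (a : I -> F) :
  sum1 a * c = sum1 (fun i => a i * c).
Proof. by rewrite bmulC sum1_mull; apply: eq_sum1 => i; rewrite bmulC. Qed.

Lemma sum1_pair (I J : finType) (a : I -> J -> F) :
  (forall i j i' j', a i j != 0 -> a i' j' != 0 -> i = i' /\ j = j') ->
  sum1 (fun i => sum1 (fun j => a i j)) = sum1 (fun j => sum1 (fun i => a i j)).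
Proof.
move=> aU; have [[p ap]|a0] := pselect (exists p : I * J, a p.1 p.2 != 0).
  case: p ap => i j /= aij.
  rewrite (@sum1_unique _ _ i) => [|i' /sum1_neq0[j' aij' _]]; last first.
    by have [] := aU _ _ _ _ aij' aij.
  rewrite (@sum1_unique _ _ j) => [|j' aij']; last first.
    by have [] := aU _ _ _ _ aij' aij.
  rewrite (@sum1_unique _ _ j) => [|j' /sum1_neq0[i' aij' _]]; last first.
    by have [] := aU _ _ _ _ aij' aij.
  rewrite (@sum1_unique _ _ i) // => i' aij'.
  by have [] := aU _ _ _ _ aij' aij.
have a00 i j : a i j = 0.
  by apply/eqP/negP => /negP aij; apply: a0; exists (i, j).
by rewrite !sum1_0 // => i; rewrite sum1_0.
Qed.

Lemma mx_act_mul (S T U : finType) (g : U -> T -> F) (f : T -> S -> F) X :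
  submonomial g -> submonomial f ->
  mx_act (mx_mul g f) X = mx_act g (mx_act f X).
Proof.
move=> [gr _] [fr _]; apply/funext => k; rewrite /mx_act /mx_mul.
under eq_sum1 => i do rewrite sum1_mulr.
rewrite sum1_pair => [|i j i' j'].
  apply: eq_sum1 => j; rewrite sum1_mull; apply: eq_sum1 => i.
  by rewrite bmulA.
rewrite !bmul_neq0E => /andP[/andP[gj fj] _] /andP[/andP[gj' fj'] _].
have jj' := gr _ _ _ gj gj'; subst j'; split=> //; exact: fr fj fj'.
Qed.

Lemma submonomial_mul (S T U : finType) (g : U -> T -> F) (f : T -> S -> F) :
  submonomial g -> submonomial f -> submonomial (mx_mul g f).
Proof.
move=> [gr gc] [fr fc]; split.
  move=> k i i' /sum1_neq0[j + _] /sum1_neq0[j' + _].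
  rewrite !bmul_neq0E => /andP[gj fj] /andP[gj' fj'].
  have jj' := gr _ _ _ gj gj'; subst j'; exact: fr fj fj'.
move=> i k k' /sum1_neq0[j + _] /sum1_neq0[j' + _].
rewrite !bmul_neq0E => /andP[gj fj] /andP[gj' fj'].
have jj' := fc _ _ _ fj fj'; subst j'; exact: gc gj gj'.
Qed.

Lemma mx_mulA (S T U W : finType)
    (h : W -> U -> F) (g : U -> T -> F) (f : T -> S -> F) :
  submonomial h -> submonomial g -> submonomial f ->
  mx_mul h (mx_mul g f) = mx_mul (mx_mul h g) f.
Proof.
move=> hs gs fs; apply/funext => l; apply/funext => i.
have /(congr1 (fun X => X l)) := mx_act_mul (fun j => f j i) hs gs.
by rewrite /mx_act /mx_mul => ->.
Qed.

Lemma submonomial_id (T : finType) : submonomial (mx_fun (@id T)).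
Proof.
have nz (j i : T) : mx_fun id j i != 0 -> j = i.
  by rewrite /mx_fun; have [->//|_] := eqVneq j i; rewrite eqxx.
by split=> [j i i'|i j j'] /nz + /nz => [<- <-|-> ->].
Qed.

Lemma mx_act1 (T : finType) (X : T -> F) : mx_act (mx_fun id) X = X.
Proof.
apply/funext => j; rewrite /mx_act /mx_fun (@sum1_unique _ _ j).
  by rewrite eqxx bmul1.
by move=> i; have [->//|_] := eqVneq j i; rewrite bmul0 eqxx.
Qed.

Lemma mx_mul1m (S T : finType) (f : T -> S -> F) : mx_mul (mx_fun id) f = f.
Proof.
apply/funext => k; apply/funext => i.
by have /(congr1 (fun X => X k)) := mx_act1 (fun j => f j i).
Qed.

Lemma mx_mulm1 (S T : finType) (f : T -> S -> F) : mx_mul f (mx_fun id) = f.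
Proof.
apply/funext => k; apply/funext => i; rewrite /mx_mul /mx_fun.
rewrite (@sum1_unique _ _ i); first by rewrite eqxx bmulr1.
by move=> j; have [->//|_] := eqVneq j i; rewrite bmulr0 eqxx.
Qed.

Lemma phom_ext (M N : pmatroid) (f g : phom M N) :
  hom_mx f = hom_mx g -> f = g.
Proof.
case: f g => [f fP] [g gP] /= fg; subst g.
by rewrite (Prop_irrelevance fP gP).
Qed.

Definition phom_id (M : pmatroid) : phom M M.
Proof.
exists (mx_fun id); split; first exact: submonomial_id.
by move=> X; rewrite mx_act1.
Defined.

Definition phom_comp (M N L : pmatroid) (g : phom N L) (f : phom M N) :
  phom M L.
Proof.
exists (mx_mul g f); case: (hom_mxP g) (hom_mxP f) => gs gV [fs fV].
split; first exact: submonomial_mul.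
by move=> X /fV/gV; rewrite mx_act_mul.
Defined.

Definition FMat_cat : category.
Proof.
refine (@Category pmatroid phom phom_id phom_comp _ _ _).
- move=> W X Y Z h g f; apply: phom_ext; apply: mx_mulA.
  + by case: (hom_mxP h).
  + by case: (hom_mxP g).
  + by case: (hom_mxP f).
- by move=> X Y f; apply: phom_ext; apply: mx_mul1m.
- by move=> X Y f; apply: phom_ext; apply: mx_mulm1.
Defined.

Definition zero_class : set (seq (option void) -> F) :=
  scaling_class (fun s => if s is [::] then 1 else 0).

Lemma zero_classP : is_pmatroid zero_class.
Proof.
split; last by move=> _ [a _ ->] [|x s]//; rewrite bmulr0.
exists 0%N, (fun s => if s is [::] then 1 else 0); split=> //; split.
- by case.
- by exists [::]; exact: bone_neq0.
- move=> sigma x; rewrite (tuple0 x) (tuple0 [tuple _ | _ < _]) /=.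
  have -> : sigma = 1%g by apply/permP; case.
  by rewrite odd_perm1 bmul1.
- by case.
- by [].
Qed.

Definition pmatroid0 : pmatroid := PMatroid zero_classP.

Lemma vectors0 (E : finType) (M : set (seq E -> F)) (X : E -> F) :
  (forall e, X e = 0) -> vectors M X.
Proof.
move=> X0 Y _; rewrite /perp; elim: (enum E) => [|e s IHs] /=.
  exact: nullS_nil.
by rewrite X0 bmul0; apply/nullS_zero.
Qed.

Definition phom_from0 (M : pmatroid) : phom pmatroid0 M.
Proof.
exists (fun _ _ => 0); split; first by split=> ? ? ?; rewrite eqxx.
by move=> X _; apply: vectors0 => j; apply: sum1_0 => i; rewrite bmul0.
Defined.

Definition phom_to0 (M : pmatroid) : phom M pmatroid0.
Proof.
exists (fun _ _ => 0); split; first by split=> ? ? ?; rewrite eqxx.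
by move=> X _; apply: vectors0; case.
Defined.

Definition sum_assoc (S T U : Type) (x : (S + T) + U) : S + (T + U) :=
  match x with
  | inl (inl e) => inl e
  | inl (inr e) => inr (inl e)
  | inr e => inr (inr e)
  end.

Definition sum_swap (S T : Type) (x : S + T) : T + S :=
  match x with inl e => inr e | inr e => inl e end.

Definition sum_lunit (T : Type) (x : void + T) : T :=
  match x with inl v => match v with end | inr e => e end.

Definition sum_runit (T : Type) (x : T + void) : T :=
  match x with inl e => e | inr v => match v with end end.

(* Well-definedness of minors, direct sums and duals, and of the matrices    *)
(* that serve as morphisms between them; the structure on F-Mat below is     *)
(* explicit, up to a proof of this proposition.                              *)
Record FMat_wf : Prop := FMatWf {
  restr_pmatroid : forall (M : pmatroid) (A : {set ground M}),
    is_pmatroid (prestr M A);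
  contr_pmatroid : forall (M : pmatroid) (A : {set ground M}),
    is_pmatroid (pcontr M A);
  dsum_pmatroid : forall M N : pmatroid, is_pmatroid (dsum M N);
  dual_pmatroid : forall M : pmatroid, is_pmatroid (pdual M);
  restr_hom : forall (M : pmatroid) (A : {set ground M}),
    is_hom (pvectors (prestr M A)) (pvectors M) (mx_fun val);
  contr_hom : forall (M : pmatroid) (A : {set ground M}),
    is_hom (pvectors M) (pvectors (pcontr M A)) (mx_tr (mx_fun val));
  dsum_hom : forall (M M' N N' : pmatroid) (f : phom M M') (g : phom N N'),
    is_hom (pvectors (dsum M N)) (pvectors (dsum M' N')) (mx_block f g);
  assoc_hom : forall M N L : pmatroid,
    is_hom (pvectors (dsum (dsum M N) L)) (pvectors (dsum M (dsum N L)))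
           (mx_fun (@sum_assoc (ground M) (ground N) (ground L)));
  lunit_hom : forall M : pmatroid,
    is_hom (pvectors (dsum pmatroid0 M)) (pvectors M)
           (mx_fun (@sum_lunit (ground M)));
  lunitV_hom : forall M : pmatroid,
    is_hom (pvectors M) (pvectors (dsum pmatroid0 M)) (mx_fun inr);
  runit_hom : forall M : pmatroid,
    is_hom (pvectors (dsum M pmatroid0)) (pvectors M)
           (mx_fun (@sum_runit (ground M)));
  runitV_hom : forall M : pmatroid,
    is_hom (pvectors M) (pvectors (dsum M pmatroid0)) (mx_fun inl);
  braid_hom : forall M N : pmatroid,
    is_hom (pvectors (dsum M N)) (pvectors (dsum N M))
           (mx_fun (@sum_swap (ground M) (ground N)));
  dual_hom : forall (M N : pmatroid) (f : phom M N),
    is_hom (pvectors (pdual N)) (pvectors (pdual M)) (mx_tr f);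
  bidual_hom : forall M : pmatroid,
    is_hom (pvectors M) (pvectors (pdual (pdual M))) (mx_fun id) }.

Section FMat.
Variable w : FMat_wf.

Definition restr_ob (M : pmatroid) (A : {set ground M}) : pmatroid :=
  PMatroid (restr_pmatroid w A).
Definition contr_ob (M : pmatroid) (A : {set ground M}) : pmatroid :=
  PMatroid (contr_pmatroid w A).

Definition restr_mor (M : pmatroid) (A : {set ground M}) :
    @hom FMat_cat (restr_ob A) M :=
  @PHom (restr_ob A) M _ (restr_hom w A).
Definition contr_mor (M : pmatroid) (A : {set ground M}) :
    @hom FMat_cat M (contr_ob A) :=
  @PHom M (contr_ob A) _ (contr_hom w A).

Definition FMat_mono (M N : FMat_cat) (f : hom M N) : Prop :=
  exists (A : {set ground N}) (alpha : @hom FMat_cat M (restr_ob A)),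
    is_iso alpha /\ f = restr_mor A \oc alpha.

Definition FMat_epi (M N : FMat_cat) (f : hom M N) : Prop :=
  exists (B : {set ground M}) (beta : @hom FMat_cat (contr_ob B) N),
    is_iso beta /\ f = beta \oc contr_mor B.

Definition FMat : pe_data :=
  @PEData FMat_cat pmatroid0 phom_from0 phom_to0 FMat_mono FMat_epi.

Definition dsum_ob (M N : pmatroid) : pmatroid :=
  PMatroid (dsum_pmatroid w M N).

Definition FMat_dsum_fun : functor_data (prod_cat FMat FMat) FMat :=
  @FunctorData (prod_cat FMat FMat) FMat (fun X => dsum_ob X.1 X.2)
    (fun X Y f => @PHom (dsum_ob X.1 X.2) (dsum_ob Y.1 Y.2) _
                        (dsum_hom w f.1 f.2)).

Definition FMat_dsum : ds_data FMat :=
  @DSData FMat FMat_dsum_fun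
    (fun M N L => @PHom (dsum_ob (dsum_ob M N) L) (dsum_ob M (dsum_ob N L)) _
                        (assoc_hom w M N L))
    (fun M => @PHom (dsum_ob pmatroid0 M) M _ (lunit_hom w M))
    (fun M => @PHom M (dsum_ob pmatroid0 M) _ (lunitV_hom w M))
    (fun M => @PHom (dsum_ob M pmatroid0) M _ (runit_hom w M))
    (fun M => @PHom M (dsum_ob M pmatroid0) _ (runitV_hom w M))
    (fun M N => @PHom (dsum_ob M N) (dsum_ob N M) _ (braid_hom w M N)).

Definition dual_ob (M : pmatroid) : pmatroid := PMatroid (dual_pmatroid w M).

Definition FMat_dual_fun : functor_data FMat (op_cat FMat) :=
  @FunctorData FMat (op_cat FMat) dual_ob
    (fun M N f => @PHom (dual_ob N) (dual_ob M) _ (dual_hom w f)).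

Definition FMat_dual : dual_data FMat :=
  @DualData FMat FMat_dual_fun
    (fun M => @PHom M (dual_ob (dual_ob M)) _ (bidual_hom w M)).

End FMat.

End Matroids.

(* Main.v *)
From mathcomp Require Import all_boot fingroup perm.
From mathcomp Require Import boolp classical_sets.
Require Import Defs.

Set Implicit Arguments.
Unset Strict Implicit.
Unset Printing Implicit Defensive.

Local Open Scope classical_set_scope.
Local Open Scope idyll_scope.

(** Over a perfect idyll a matroid M is governed by two sets, its vectors and
    its covectors, each of which is the orthogonal of the other ([pvec_orth],
    [pcov_orth]): the vectors contain the circuits, whose orthogonal is the set
    of covectors, the covectors contain the cocircuits, and perfection is the
    remaining orthogonality. A submonomial matrix and its transpose are adjoint
    ([perp_adjoint]), so f maps vectors of M to vectors of N iff its transpose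
    maps covectors of N to covectors of M. Transposition is thus a duality, and
    most statements come in two versions exchanged by it.

    Grassmann-Pluecker functions enter through a few facts. In the form of the
    relations used here, circuits are orthogonal to the vectors
    e |-> mu (e :: z), which are the cocircuits ([gpP], [vectorsP],
    [covectorsP]); taking complements turns the relations of mu into those of
    its dual ([gp_dual]), and the relations of a direct sum split into relations
    of the summands ([gp_usum]). The ordered basis chosen in the definition of a
    minor can be exchanged one entry at a time by relations with two non-zero
    terms, so it does not affect the class ([proportional]). Finally circuits of
    M|A extend by zero to circuits of M, and cocircuits of M/A to cocircuits of
    M; with perfection, a vector belongs to M|A iff its extension by zero
    belongs to M, and likewise for covectors and M/A ([pvec_restr],
    [pcov_contr]).

    Hence a morphism is an admissible monomorphism iff it has no zero column and
    reflects vectors, and an admissible epimorphism iff its transpose has no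
    zero column and reflects covectors ([monoP], [epiP]). For a commutative
    square of admissible morphisms i, q, p, j to be Cartesian, it is necessary
    and sufficient that every element killed by p is in the image of i, and the
    same condition characterizes co-Cartesian squares ([bicartesianP]). It is
    self-dual and checked componentwise on direct sums. Squares are completed
    because contraction and restriction commute ([contr_restr_square],
    [restr_contr_square]).

    In a short exact sequence U >-> X ->> V, a section s of the projection gives
    the matrix with blocks i and s, which is a morphism by orthogonality. That
    its inverse is a morphism cannot be obtained by subtracting null sums, which
    is not allowed in an idyll; it follows from a rank argument. The section
    makes the circuits of X/U vectors of X, so the complement of U has the same
    rank in X as in X/U, and then cocircuits of X|U extend by zero to cocircuits
    of X ([pvec_split]). A retraction exhibits the projection onto U as an
    operation that preserves vectors, and the case of a section, applied to the
    complement, shows that the complementary projection does as well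
    ([proj_stableC]). *)

(** * Signs and null families in an idyll *)

Section Arithmetic.
Variable F : idyll.
Implicit Types (a b c : F) (s t : seq F).

Lemma bmulCA a b c : a * (b * c) = b * (a * c).
Proof. by rewrite !bmulA (bmulC a). Qed.

Lemma bmulACA a b c d : (a * b) * (c * d) = (a * c) * (b * d).
Proof. by rewrite -!bmulA (bmulCA b). Qed.

Lemma bopp0 : bopp 0 = 0 :> F.
Proof. by apply/esym/bopp_unique/nullS_zero/nullS_zero/nullS_nil. Qed.

(** 0 is the additive inverse of 0, so no other element is. *)
Lemma null_singleton a : nullS [:: a] -> a = 0.
Proof. by move=> /nullS_zero/bopp_unique->; rewrite bopp0. Qed.

Lemma nullS_scale c s : nullS s -> nullS [seq c * a | a <- s].
Proof. by move=> /(nullS_mul [:: c]); rewrite /= cats0. Qed.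

Lemma bopp_mul a : bopp a = bopp 1 * a.
Proof.
apply/esym/bopp_unique.
by have := nullS_scale a (bopp_null (1 : F)); rewrite /= bmulr1 (bmulC a).
Qed.

Lemma boppK a : bopp (bopp a) = a.
Proof.
apply/esym/bopp_unique; apply: (nullS_perm _ (bopp_null a)).
by rewrite (perm_catC [:: a] [:: _]).
Qed.

Lemma sgnD x y : sgn (x (+) y) = sgn x * sgn y :> F.
Proof.
case: x y => [] []; rewrite /= ?bmul1 ?bmulr1 //.
by rewrite -bopp_mul boppK.
Qed.

Lemma sgnK x a : sgn x * (sgn x * a) = a.
Proof. by rewrite bmulA -sgnD addbb bmul1. Qed.

Lemma sgn_neq0 x : sgn x != 0 :> F.
Proof.
apply/eqP => x0; have := sgnK x (1 : F); rewrite x0 bmul0.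
by move/eqP; rewrite eq_sym (negPf (bone_neq0 F)).
Qed.

Lemma sgn_mul_neq0 x a : (sgn x * a != 0) = (a != 0).
Proof. by rewrite bmul_neq0E sgn_neq0. Qed.

Lemma bmulI c a b : c != 0 -> c * a = c * b -> a = b.
Proof.
move=> /idyll_inv[d cd] /(congr1 (fun x => d * x)).
by rewrite !bmulA (bmulC d) cd !bmul1.
Qed.

Lemma null_pair a b : nullS [:: a; b] -> a = sgn true * b.
Proof. by move=> /bopp_unique->; rewrite /= -bopp_mul boppK. Qed.

Lemma nullS_permE s t : perm_eq s t -> nullS s <-> nullS t.
Proof.
by move=> st; split; [apply: nullS_perm st | apply: nullS_perm; rewrite perm_sym].
Qed.

Lemma nullS_nz s : nullS s <-> nullS [seq a <- s | a != 0].
Proof.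
have cons2 (a : F) s1 s2 : (nullS s1 <-> nullS s2) ->
    a = 0 -> (nullS (a :: s1) <-> nullS s2).
  by move=> s12 ->; split=> [/nullS_zero/s12|/s12 H]; last exact/nullS_zero.
have gen t : nullS (t ++ s) <-> nullS (t ++ [seq a <- s | a != 0]).
  elim: s t => [|a s IH] t //=; case: ifPn => [_|/negPn/eqP->].
    by rewrite -!cat_rcons.
  rewrite -IH -(@nullS_zero F (t ++ s)); apply: nullS_permE.
  by rewrite -cat1s perm_catCA.
exact: (gen [::]).
Qed.

End Arithmetic.

Lemma inl_inj (S T : Type) : injective (@inl S T).
Proof. by move=> ? ? []. Qed.

Lemma inr_inj (S T : Type) : injective (@inr S T).
Proof. by move=> ? ? []. Qed.

Section Null.
Variable F : idyll.

(** Finite families stand for their sum in the ambient semiring, so that only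
    the multiset of their non-zero terms matters; see [null_reindex]. *)
Definition null (I : finType) (a : I -> F) : Prop :=
  nullS [seq a i | i <- enum I].

(** The two families have the same non-zero terms, because h restricts to a
    bijection between their supports. *)
Lemma null_reindex (I J : finType) (h : I -> J) (a : I -> F) (b : J -> F) :
  (forall i, a i != 0 -> b (h i) = a i) ->
  (forall i i', a i != 0 -> a i' != 0 -> h i = h i' -> i = i') ->
  (forall j, b j != 0 -> exists2 i, a i != 0 & h i = j) ->
  null a <-> null b.
Proof.
move=> ab hI bP; rewrite /null nullS_nz (nullS_nz (map b _)) (filter_map a) (filter_map b).
set I0 := filter _ _; set J0 := filter _ _.
have I0E i : (i \in I0) = (a i != 0).
  by rewrite mem_filter mem_enum andbT.
have -> : map a I0 = map b (map h I0).
  by rewrite -map_comp; apply/eq_in_map => i; rewrite I0E => /ab.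
apply/nullS_permE/perm_map/uniq_perm.
- rewrite map_inj_in_uniq; first exact/filter_uniq/enum_uniq; move=> i i'.
  by rewrite !I0E; apply: hI.
- exact/filter_uniq/enum_uniq.
move=> j; rewrite mem_filter mem_enum andbT; apply/mapP/idP => [[i + ->]|].
  by rewrite I0E /= => ai; rewrite ab.
by move=> /bP[i ai <-]; exists i; rewrite ?I0E.
Qed.

Lemma eq_null (I : finType) (a b : I -> F) : a =1 b -> null a <-> null b.
Proof. by move=> /funext->. Qed.

Lemma null0 (I : finType) (a : I -> F) : (forall i, a i = 0) -> null a.
Proof.
move=> a0; apply/nullS_nz; rewrite (_ : filter _ _ = [::]); first exact: nullS_nil.
apply/eqP; rewrite -(negbK (_ == _)) -has_filter; apply/hasPn => _ /mapP[i _ ->].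
by rewrite a0 eqxx.
Qed.

Lemma null_scale (I : finType) (c : F) (a : I -> F) :
  null a -> null (fun i => c * a i).
Proof. by move=> /(nullS_scale c); rewrite -map_comp. Qed.

Lemma null_scaleE (I : finType) (c : F) (a : I -> F) : c != 0 ->
  null (fun i => c * a i) <-> null a.
Proof.
move=> c0; split; last exact: null_scale.
have [d cd] := idyll_inv c0 => /(null_scale d); apply: iffLR.
by apply: eq_null => i; rewrite bmulA (bmulC d) cd bmul1.
Qed.

Lemma null_inj (I J : finType) (h : I -> J) (b : J -> F) : injective h ->
  (forall j, b j != 0 -> exists i, h i = j) ->
  null b <-> null (fun i => b (h i)).
Proof.
move=> hI bP; apply: iff_sym; apply: (@null_reindex _ _ h) => //.
  by move=> i i' _ _ /hI.
by move=> j bj; have [i ij] := bP j bj; exists i; rewrite ?ij.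
Qed.

Lemma null_unique (I : finType) (a : I -> F) (i : I) :
  null a -> (forall j, a j != 0 -> j = i) -> a i = 0.
Proof.
move=> na ai; apply/eqP/negPn/negP => ai0.
have H : null a <-> null (fun _ : unit => a i).
  apply: (@null_reindex _ _ (fun=> tt)) => [j /ai->//|j j' /ai-> /ai->//|[] _].
  by exists i.
move/H: na; rewrite /null enumT unlock => /null_singleton/eqP.
by rewrite (negPf ai0).
Qed.

Lemma null_two (I : finType) (a : I -> F) (i j : I) : i != j ->
  (forall k, a k != 0 -> k = i \/ k = j) -> null a <-> nullS [:: a i; a j].
Proof.
move=> ij aij.
have -> : nullS [:: a i; a j] = null (fun b : bool => if b then a i else a j).
  by rewrite /null enumT unlock.
have aE : (fun b : bool => if b then a i else a j) =
    (fun b : bool => a (if b then i else j)) by apply/funext; case.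
rewrite aE; apply: null_inj.
  by case=> [] [] // /eqP; rewrite ?(negPf ij) // eq_sym (negPf ij).
by move=> k /aij[]->; [exists true|exists false].
Qed.

Lemma null_sum (I J : finType) (a : I + J -> F) :
  null (fun i => a (inl i)) -> null (fun j => a (inr j)) -> null a.
Proof.
move=> nI nJ; have := nullS_cat nI nJ.
rewrite (map_comp a inl) (map_comp a inr) -map_cat.
apply/nullS_perm/perm_map/uniq_perm.
- rewrite cat_uniq (map_inj_uniq (@inl_inj I J)) (map_inj_uniq (@inr_inj I J)).
  rewrite !enum_uniq andbT; apply/hasPn => _ /mapP[k _ ->].
  by apply/mapP => -[].
- exact: enum_uniq.
by case=> i; rewrite mem_cat mem_enum ?map_f ?orbT ?mem_enum.
Qed.

End Null.

(** * Alternating functions on sequences *)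

Section Alternating.
Variables (F : idyll) (E : finType).
Implicit Types (mu : seq E -> F) (s t p q x y z : seq E).

(** Adjacent transpositions generate the symmetric group. Unlike permutations
    of a tuple, they act on sequences of any length and are compatible with
    concatenation. *)
Definition skew mu : Prop := forall p a b q,
  mu (p ++ a :: b :: q) = sgn true * mu (p ++ b :: a :: q).

Record alternating mu : Prop := Alternating {
  alt_skew : skew mu;
  alt_uniq : forall s, mu s != 0 -> uniq s }.

Lemma alt_repeat mu s : alternating mu -> ~~ uniq s -> mu s = 0.
Proof. by move=> [_ mu_uniq]; apply: contraNeq => /mu_uniq. Qed.

Lemma skew_prefix mu p : skew mu -> skew (fun s => mu (p ++ s)).
Proof. by move=> mu_skew p' a b q; rewrite catA mu_skew -catA. Qed.

Lemma skew_move mu p a t q : skew mu ->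
  mu (p ++ a :: t ++ q) = sgn (odd (size t)) * mu (p ++ t ++ a :: q).
Proof.
move=> mu_skew; elim: t p => [|b t IH] p /=; first by rewrite bmul1.
by rewrite mu_skew -cat_rcons IH cat_rcons bmulA -sgnD.
Qed.

(** The sign depends on the two orderings only. Applying this both to mu and
    to [perm_sign] identifies it with a sign of permutation, without
    decomposing the permutation into transpositions. *)
Lemma perm_skew s t : perm_eq s t ->
  exists b, forall mu, skew mu -> mu s = sgn b * mu t.
Proof.
elim: s t => [|a s IH] t.
  by rewrite perm_sym => /perm_nilP->; exists false => mu _; rewrite bmul1.
move=> st; have a_t: a \in t by rewrite -(perm_mem st) mem_head.
case/splitPr: a_t st => t1 t2 st.
have/IH[b bP]: perm_eq s (t1 ++ t2).
  by rewrite -(perm_cons a); apply: perm_trans st _; rewrite -(cat1s a t2) perm_catCA.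
exists (b (+) odd (size t1)) => mu mu_skew.
have /= -> := bP _ (@skew_prefix mu [:: a] mu_skew).
by rewrite (@skew_move mu [::]) //= sgnD bmulA.
Qed.

Lemma skew_neq0 mu s t : skew mu -> perm_eq s t -> (mu s != 0) = (mu t != 0).
Proof. by move=> mu_skew /perm_skew[b /(_ _ mu_skew)->]; rewrite sgn_mul_neq0. Qed.

Lemma perm_sign_map (sigma : {perm E}) :
  perm_sign F [seq sigma e | e <- enum E] = sgn (odd_perm sigma).
Proof.
rewrite /perm_sign; case: pickP => [tau /eqP|/(_ sigma)]; last by rewrite eqxx.
move=> tauE; congr (sgn (odd_perm _)); apply/permP => e.
by move/eq_in_map: tauE; apply; rewrite mem_enum.
Qed.

Lemma perm_sign_neq0 s : (perm_sign F s != 0) = perm_eq s (enum E).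
Proof.
apply/idP/idP => [|senum].
  rewrite /perm_sign; case: pickP => [sigma /eqP<- _|]; last by rewrite eqxx.
  apply: uniq_perm; rewrite ?(map_inj_uniq perm_inj) ?enum_uniq // => e.
  rewrite mem_enum; apply/mapP; exists ((sigma^-1)%g e); rewrite ?mem_enum //.
  by rewrite permKV.
have s_uniq : uniq s by rewrite (perm_uniq senum) enum_uniq.
have s_size : size s = #|E| by rewrite (perm_size senum) cardT.
have f_inj : injective (fun e => nth e s (enum_rank e)).
  move=> e e' /eqP; rewrite (set_nth_default e') ?s_size // nth_uniq ?s_size //.
  by move/eqP/ord_inj/enum_rank_inj.
suff -> : s = [seq (perm f_inj) e | e <- enum E].
  by rewrite perm_sign_map sgn_neq0.
case: s => [|e0 s] in s_uniq s_size senum f_inj *.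
  by rewrite (size0nil (s := enum E)) // -cardE -s_size.
apply: (@eq_from_nth _ e0); first by rewrite size_map s_size cardT.
move=> i i_lt; have i_E : i < #|E| by rewrite -s_size.
rewrite (nth_map e0) -?cardT // permE (set_nth_default e0); last first.
  by rewrite s_size.
by congr nth; rewrite -[in RHS](enum_val_nth e0 (Ordinal i_E)) enum_valK.
Qed.

(** Swapping the consecutive entries a and b of a listing of E composes the
    permutation that it lists with the transposition of the values a and b. *)
Lemma perm_sign_alternating : alternating (@perm_sign F E).
Proof.
split=> [p a b q|s]; last first.
  by rewrite perm_sign_neq0 => /perm_uniq->; apply: enum_uniq.
have [enumE|] := boolP (perm_eq (p ++ a :: b :: q) (enum E)); last first.
  move=> nE; have nE' : ~~ perm_eq (p ++ b :: a :: q) (enum E).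
    apply: contra nE; apply: perm_trans; rewrite perm_cat2l.
    exact/permEl/(perm_catCA [:: a] [:: b] q).
  move: nE nE'; rewrite -!perm_sign_neq0 => /negPn/eqP-> /negPn/eqP->.
  by rewrite bmulr0.
have := enumE; rewrite -perm_sign_neq0 {1}/perm_sign.
case: pickP => [sigma /eqP sigmaE _|]; last by rewrite eqxx.
have /[!cat_uniq] /= : uniq (p ++ a :: b :: q).
  by rewrite (perm_uniq enumE) enum_uniq.
rewrite inE !negb_or -!andbA => /and5P[_ ap bp _ /and4P[ab aq bq _]].
have swapE : p ++ b :: a :: q = [seq (sigma * tperm a b)%g e | e <- enum E].
  under eq_map => e do rewrite permM.
  rewrite (map_comp (tperm a b) sigma) sigmaE map_cat /= tpermL tpermR.
  congr (_ ++ [:: _, _ & _]); apply/esym/map_id_in => e ein; rewrite tpermD //.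
  - by apply: contraNneq ap => ->.
  - by apply: contraNneq bp => ->.
  - by apply: contraNneq aq => ->.
  - by apply: contraNneq bq => ->.
rewrite swapE -sigmaE !perm_sign_map odd_permM odd_tperm ab addbT.
by case: (odd_perm _); rewrite -bopp_mul //= boppK.
Qed.

End Alternating.

(** * Grassmann-Pluecker functions *)

Lemma map_eq_cat (S T : Type) (f : S -> T) (s : seq S) (u v : seq T) :
  map f s = u ++ v -> exists s1 s2, [/\ s = s1 ++ s2, map f s1 = u & map f s2 = v].
Proof.
elim: u s => [|b u IH] [|a s] //=; try by exists [::], [::].
  by move=> sv; exists [::], (a :: s).
by case=> <- /IH[s1 [s2 [-> <- <-]]]; exists (a :: s1), s2.
Qed.

Lemma not_uniqP (E : eqType) (x : seq E) : ~~ uniq x ->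
  exists p a t q, x = p ++ a :: t ++ a :: q.
Proof.
elim: x => [//|b x IH] /=; rewrite negb_and negbK.
case/orP=> [|/IH[p [a [t [q ->]]]]]; last by exists (b :: p), a, t, q.
by case/splitPr=> t q; exists [::], b, t, q.
Qed.

Lemma dup_uniq (E : eqType) (a : E) p t q : uniq (p ++ a :: t ++ a :: q) = false.
Proof. by rewrite cat_uniq /= mem_cat mem_head orbT !andbF. Qed.

Lemma del_cat (E : Type) k (s t : seq E) :
  del k (s ++ t) = if k < size s then del k s ++ t else s ++ del (k - size s) t.
Proof.
rewrite /del take_cat drop_cat; have [ks|sk] := ltnP.
  rewrite -catA; congr (_ ++ _); case: ltnP => // sk.
  have -> : k.+1 = size s by apply/eqP; rewrite eqn_leq ks sk.
  by rewrite drop_size subnn drop0.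
by rewrite ltnNge leqW // -catA subSn.
Qed.

Lemma delS (E : Type) k (a : E) s : del k.+1 (a :: s) = a :: del k s.
Proof. by []. Qed.

Lemma del0 (E : Type) (a : E) s : del 0 (a :: s) = s.
Proof. exact: drop0. Qed.

Lemma nth_cat_size (E : Type) (a b : E) p q : nth b (p ++ a :: q) (size p) = a.
Proof. by rewrite nth_cat ltnn subnn. Qed.

Section GrassmannPlucker.
Variables (F : idyll) (E : finType).
Implicit Types (mu : seq E -> F) (s t p q x y z : seq E).

Lemma circuit_vec_split mu p e q : e \notin p ->
  circuit_vec mu (p ++ e :: q) e = sgn (odd (size p)) * mu (p ++ q).
Proof.
move=> ep; rewrite /circuit_vec mem_cat mem_head orbT index_cat (negPf ep) /=.
rewrite eqxx addn0 /del take_size_cat //.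
by rewrite -cat_rcons drop_size_cat // size_rcons.
Qed.

Lemma circuit_vec_out mu x e : e \notin x -> circuit_vec mu x e = 0.
Proof. by rewrite /circuit_vec => /negPf->. Qed.

Lemma circuit_vec_supp mu x e : circuit_vec mu x e != 0 -> e \in x.
Proof. by apply: contraNT => /circuit_vec_out->. Qed.

(** The Pluecker relations indexed by the elements of E instead of the
    positions in x: circuits are orthogonal to the vectors e |-> mu (e :: y).
    The lengths of x and y are constrained by the support of mu, and
    relations for x with repeated entries hold for every alternating function
    ([skew_gp_rel]). *)
Record gp (r : nat) mu : Prop := GP {
  gp_size : forall s, mu s != 0 -> size s = r;
  gp_nz : exists s, mu s != 0;
  gp_alternating : alternating mu;
  gp_null : forall x y, uniq x -> null (fun e => circuit_vec mu x e * mu (e :: y)) }.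

Lemma gp_skew r mu : gp r mu -> skew mu.
Proof. by move=> /gp_alternating/alt_skew. Qed.

Lemma gp_uniq r mu s : gp r mu -> mu s != 0 -> uniq s.
Proof. by move=> /gp_alternating/alt_uniq; apply. Qed.

Lemma gp_repeat r mu s : gp r mu -> ~~ uniq s -> mu s = 0.
Proof. by move=> /gp_alternating; apply: alt_repeat. Qed.

Lemma gp_mem r mu e s : gp r mu -> e \in s -> mu (e :: s) = 0.
Proof. by move=> mu_gp es; apply: gp_repeat mu_gp _; rewrite /= es. Qed.

Lemma gp_size0 r mu s : gp r mu -> size s <> r -> mu s = 0.
Proof. by move=> mu_gp /eqP; apply: contraNeq => /(gp_size mu_gp)->. Qed.

(** The transposition of two adjacent positions swaps two consecutive entries
    of the list of all positions. *)
Lemma gp_alt_skew r mu : (forall s, size s != r -> mu s = 0) ->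
  (forall (sigma : 'S_r) (x : r.-tuple E),
     mu [tuple tnth x (sigma i) | i < r] = sgn (odd_perm sigma) * mu x) ->
  (forall s, ~~ uniq s -> mu s = 0) -> alternating mu.
Proof.
move=> mu_size mu_alt mu_rep; split=> [p a b q|s]; last first.
  by apply: contraNT => /mu_rep->.
have [x_size|x_size] := eqVneq (size (p ++ b :: a :: q)) r; last first.
  rewrite !mu_size ?bmulr0 //; apply: contraNneq x_size => <-.
  by rewrite !size_cat.
pose x : r.-tuple E := Tuple (introT eqP x_size).
have xE : map (tnth x) (enum 'I_r) = p ++ b :: a :: q.
  by have := map_tnth_enum x => ->.
have [e1 [e2 [enumE e1E e2E]]] := map_eq_cat xE.
case: e2 => [|i [|j e2]] // in enumE e2E *; case: e2E => jE iE e2E.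
have := mu_alt (tperm i j) x; rewrite odd_tperm.
have := enum_uniq 'I_r; rewrite enumE cat_uniq /= !inE !negb_or -!andbA.
move=> /and5P[_ ie1 je1 e12 /and4P[ij ie2 je2 _]]; rewrite ij => altE.
rewrite -altE /= enumE !map_cat /= tpermL tpermR iE jE -e1E -e2E.
congr (mu (_ ++ [:: _, _ & _])); apply/eq_in_map => k ke; rewrite tpermD //;
  [move: ie1|move: je1|move: ie2|move: je2]; apply: contraNneq => -> //.
Qed.

(** Composed with x, mu becomes a skew function on sequences of positions;
    the sign by which it changes along sigma is the one of [perm_sign]. *)
Lemma skew_gp_alt r mu (sigma : 'S_r) (x : r.-tuple E) : skew mu ->
  mu [tuple tnth x (sigma i) | i < r] = sgn (odd_perm sigma) * mu x.
Proof.
move=> mu_skew; pose nu (s : seq 'I_r) := mu (map (tnth x) s).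
have nu_skew : skew nu by move=> p a b q; rewrite /nu !map_cat mu_skew.
have sigma_enum : perm_eq [seq sigma i | i <- enum 'I_r] (enum 'I_r).
  by rewrite -(perm_sign_neq0 F) perm_sign_map sgn_neq0.
have [b bP] := perm_skew F sigma_enum.
have -> : sgn (odd_perm sigma) = sgn b :> F.
  have := bP _ (alt_skew (perm_sign_alternating F _)); rewrite perm_sign_map.
  rewrite -[in RHS](map_id (enum _)).
  have -> : perm_sign F [seq i | i <- enum 'I_r] = sgn (odd_perm (1%g : 'S_r)).
    by rewrite -perm_sign_map; congr perm_sign; apply: eq_map => i; rewrite perm1.
  by rewrite odd_perm1 bmulr1.
have := bP _ nu_skew; rewrite /nu map_tnth_enum => <-.
by rewrite -map_comp.
Qed.

Lemma gp_rel_tuple mu r (x : r.+1.-tuple E) y : uniq x ->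
  null (fun k : 'I_r.+1 => sgn (odd k) * (mu (del k x) * mu (tnth x k :: y))) <->
  null (fun e => circuit_vec mu x e * mu (e :: y)).
Proof.
move=> x_uniq; have x_inj : injective (tnth x) by apply/tuple_uniqP.
apply: iff_trans (iff_sym _).
  2: apply: (null_inj x_inj) => e; rewrite bmul_neq0E => /andP[+ _].
  2: by move/circuit_vec_supp/tnthP=> [k ->]; exists k.
apply: eq_null => k; rewrite bmulA; congr (_ * _).
rewrite /circuit_vec mem_tnth (tnth_nth (tnth x k)) index_uniq ?size_tuple //.
Qed.

Lemma circuit_vec_neq0 mu x e : uniq x -> circuit_vec mu x e != 0 ->
  exists p q, x = p ++ e :: q /\ mu (p ++ q) != 0.
Proof.
move=> x_uniq nz; have ex := circuit_vec_supp nz.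
case/splitPr: ex x_uniq nz => p q.
rewrite cat_uniq /= negb_or => /and4P[_ /andP[ep _] _ _].
by rewrite circuit_vec_split // sgn_mul_neq0; exists p, q.
Qed.

(** All terms vanish except those at two equal entries of x, and these are
    opposite, as the two deletions differ by moving one of the equal entries
    to the place of the other. *)
Lemma skew_gp_rel r mu (x : r.+1.-tuple E) y : alternating mu -> ~~ uniq x ->
  null (fun k : 'I_r.+1 => sgn (odd k) * (mu (del k x) * mu (tnth x k :: y))).
Proof.
move=> mu_alt x_rep; have mu_skew := alt_skew mu_alt.
have [p [a [t [q xE]]]] := not_uniqP x_rep.
have x_size : size p + (size t).+1 + (size q).+1 = r.+1.
  by rewrite -(size_tuple x) xE size_cat /= size_cat -addnA addSn.
have ilt : size p < r.+1 by rewrite -x_size -addnA addSn addnS ltnS leq_addr.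
have jlt : size p + (size t).+1 < r.+1 by rewrite -x_size -[X in X < _]addn0 ltn_add2l.
pose i := Ordinal ilt; pose j := Ordinal jlt.
apply/(@null_two F _ _ i j) => [|k|].
- by rewrite -val_eqE /= neq_ltn addnS ltnS leq_addr.
- rewrite sgn_mul_neq0 bmul_neq0E => /andP[+ _].
  case: (k =P i) => [->|/eqP ki]; first by left.
  case: (k =P j) => [->|/eqP kj]; first by right.
  move=> /(alt_uniq mu_alt); rewrite xE !del_cat.
  case: ltnP => [kp|pk].
    by rewrite dup_uniq.
  (* Deleting a position other than i and j leaves both copies of a. *)
  case kE : (k - size p) => [|m].
    by rewrite -val_eqE /= eqn_leq pk andbT -subn_eq0 kE in ki.
  rewrite delS del_cat; case: ltnP => [mt|tm].
    by rewrite dup_uniq.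
  case mE : (m - size t) => [|m'].
    case/eqP: kj; apply: val_inj; rewrite /= -(subnKC pk) kE; congr (_ + _.+1).
    by apply/eqP; rewrite eqn_leq tm andbT -subn_eq0 mE.
  by rewrite delS -cat_cons dup_uniq.
have xiE : tnth x i = a by rewrite (tnth_nth a) /= xE nth_cat_size.
have xjE : tnth x j = a.
  have jE : size p + (size t).+1 = size (p ++ a :: t) by rewrite size_cat.
  by rewrite (tnth_nth a) /= xE jE -cat_cons catA nth_cat_size.
rewrite xiE xjE xE /= !del_cat ltnn subnn ltnNge leq_addr.
rewrite addKn delS del_cat ltnn subnn !del0.
have -> := skew_move p a t q mu_skew.
set b := mu _; rewrite !bmulA -sgnD addnS oddS oddD.
set c := sgn (odd (size p)) * b * _.
suff -> : sgn (~~ (odd (size p) (+) odd (size t)) (+) odd (size t)) * b * mu (a :: y) = bopp c.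
  exact: bopp_null.
by rewrite addNb -addbA addbb addbF /c -addbT sgnD -!bmulA bopp_mul bmulCA.
Qed.

Lemma gpP r mu : grassmann_plucker r mu <-> gp r mu.
Proof.
split=> [[mu_size mu_nz mu_alt mu_rep mu_rel]|mu_gp].
  have mu_altg := gp_alt_skew mu_size mu_alt mu_rep.
  have mu_supp s : mu s != 0 -> size s = r.
    by apply: contraNeq => /mu_size->.
  split=> // x y x_uniq.
  have [x_size|x_size] := eqVneq (size x) r.+1; last first.
    apply: null0 => e; apply/eqP/negPn/negP; rewrite bmul_neq0E => /andP[+ _].
    move=> /(circuit_vec_neq0 x_uniq)[p [q [xE /mu_supp pq]]].
    by case/eqP: x_size; rewrite xE size_cat addnS -size_cat pq.
  have [y_size|y_size] := eqVneq (size y).+1 r; last first.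
    apply: null0 => e; apply/eqP/negPn/negP; rewrite bmul_neq0E => /andP[_].
    by move=> /mu_supp; apply/eqP.
  by have := mu_rel (Tuple (introT eqP x_size)) y y_size => /gp_rel_tuple; apply.
split.
- by move=> s /eqP; apply: gp_size0 mu_gp.
- exact: gp_nz mu_gp.
- by move=> sigma x; apply/skew_gp_alt/gp_skew/mu_gp.
- by move=> s; apply: gp_repeat mu_gp.
move=> x y _; have [x_uniq|x_rep] := boolP (uniq x).
  by apply: iffRL (gp_rel_tuple mu y x_uniq) _; apply: gp_null mu_gp _ _ x_uniq.
exact/skew_gp_rel/x_rep/gp_alternating/mu_gp.
Qed.

End GrassmannPlucker.

(** * Duals, vectors and covectors *)

Section Dual.
Variables (F : idyll) (E : finType).
Implicit Types (mu : seq E -> F) (s t p q x y z : seq E) (X Y : E -> F).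

Definition cpl s := [seq e <- enum E | e \notin s].

Lemma mem_cpl s e : (e \in cpl s) = (e \notin s).
Proof. by rewrite mem_filter mem_enum andbT. Qed.

Lemma cpl_uniq s : uniq (cpl s).
Proof. exact/filter_uniq/enum_uniq. Qed.

Lemma perm_cpl2 s : uniq s -> perm_eq s (cpl (cpl s)).
Proof.
move=> s_uniq; apply: uniq_perm; rewrite ?cpl_uniq // => e.
by rewrite !mem_cpl negbK.
Qed.

Lemma perm_cat_cpl s : uniq s -> perm_eq (s ++ cpl s) (enum E).
Proof.
move=> s_uniq; apply: uniq_perm; rewrite ?enum_uniq //.
  rewrite cat_uniq s_uniq cpl_uniq andbT; apply/hasPn => e.
  by rewrite mem_cpl.
by move=> e; rewrite mem_cat mem_cpl orbN mem_enum.
Qed.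

Lemma size_cpl s : uniq s -> size (cpl s) = #|E| - size s.
Proof.
move=> /perm_cat_cpl/perm_size; rewrite size_cat -cardE => <-.
by rewrite addKn.
Qed.

Lemma dual_fun_uniq mu x : dual_fun mu x != 0 -> uniq x.
Proof. by rewrite /dual_fun; case: ifP => //; rewrite eqxx. Qed.

Lemma dual_funE mu x t : skew mu -> uniq x -> perm_eq t (cpl x) ->
  dual_fun mu x = perm_sign F (x ++ t) * mu t.
Proof.
move=> mu_skew x_uniq /perm_skew tx; have [b bP] := tx F.
rewrite /dual_fun x_uniq -/(cpl x) (bP _ mu_skew).
rewrite (bP _ (skew_prefix _ (alt_skew (perm_sign_alternating F E)))).
by rewrite -bmulA (bmulCA _ (sgn b)) sgnK.
Qed.

Lemma skew_swap mu p q : skew mu ->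
  mu (p ++ q) = sgn (odd (size p * size q)) * mu (q ++ p).
Proof.
elim: p mu => [|a p IH] mu mu_skew; first by rewrite cats0 bmul1.
rewrite cat_cons (IH (fun s => mu (a :: s))); last first.
  exact: (@skew_prefix _ _ _ [:: a]).
by rewrite (@skew_move _ _ _ [::]) // bmulA -sgnD mulSn oddD addbC.
Qed.

Lemma perm_signK s a : perm_eq s (enum E) ->
  perm_sign F s * (perm_sign F s * a) = a.
Proof.
rewrite -(perm_sign_neq0 F) /perm_sign; case: pickP => [sigma _ _|].
  exact: sgnK.
by rewrite eqxx.
Qed.

Lemma dual_alternating mu : alternating mu -> alternating (dual_fun mu).
Proof.
move=> mu_alt; split=> [p a b q|s]; last exact: dual_fun_uniq.
have pab : perm_eq (p ++ a :: b :: q) (p ++ b :: a :: q).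
  by rewrite perm_cat2l; exact/permEl/(perm_catCA [:: a] [:: b] q).
rewrite /dual_fun (perm_uniq pab); case: ifP => _; last by rewrite bmulr0.
rewrite (eq_filter (a2 := fun e => e \notin p ++ b :: a :: q)); last first.
  by move=> e; rewrite (perm_mem pab).
by rewrite -!catA /= (alt_skew (perm_sign_alternating F E)) bmulA.
Qed.

(** The sign comes from moving the entries of x past those of its complement,
    which turns (x, x') into (x', x). *)
Lemma dual_dual_fun mu x : alternating mu ->
  dual_fun (dual_fun mu) x = sgn (odd (size x * (#|E| - size x))) * mu x.
Proof.
move=> mu_alt; have [x_uniq|x_rep] := boolP (uniq x); last first.
  by rewrite (alt_repeat mu_alt x_rep) bmulr0 /dual_fun (negPf x_rep).
have mu_skew := alt_skew mu_alt.
rewrite (dual_funE (alt_skew (dual_alternating mu_alt)) x_uniq (perm_refl _)).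
rewrite (dual_funE mu_skew (cpl_uniq x) (perm_cpl2 x_uniq)).
rewrite (skew_swap _ _ (alt_skew (perm_sign_alternating F E))) -size_cpl //.
by rewrite -bmulA perm_signK // perm_catC perm_cat_cpl.
Qed.

Lemma circuit_vec_scale mu c x e :
  circuit_vec (fun s => c * mu s) x e = c * circuit_vec mu x e.
Proof. by rewrite /circuit_vec; case: ifP; rewrite ?bmulr0 // bmulCA. Qed.

(** Deleting e from y adds it to the complement. Moving e from its place in y
    to the head of the complement produces its position sign, which cancels
    the one in [circuit_vec], and a constant. *)
Lemma circuit_vec_dual mu y z : alternating mu -> uniq y ->
  perm_eq z (cpl y) -> exists2 c, c != 0 &
  forall e, circuit_vec (dual_fun mu) y e = c * mu (e :: z).
Proof.
move=> mu_alt y_uniq zy; have sign_skew := alt_skew (perm_sign_alternating F E).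
exists (sgn (odd (size y).-1) * perm_sign F (y ++ z)).
  rewrite sgn_mul_neq0 perm_sign_neq0 (perm_trans _ (perm_cat_cpl y_uniq)) //.
  by rewrite perm_cat2l.
move=> e; have [ey|ey] := boolP (e \in y); last first.
  rewrite circuit_vec_out // (alt_repeat mu_alt) ?bmulr0 //= negb_and negbK.
  by rewrite (perm_mem zy) mem_cpl ey.
case/splitPr: ey y_uniq zy => p q y_uniq zy.
have y_rot : perm_eq (p ++ e :: q) (e :: p ++ q).
  exact/permEl/(perm_catCA p [:: e] q).
have /= /andP[epq pq_uniq] : uniq (e :: p ++ q) by rewrite -(perm_uniq y_rot).
have ep : e \notin p by move: epq; rewrite mem_cat negb_or => /andP[].
rewrite circuit_vec_split // (@dual_funE _ _ (e :: z) (alt_skew mu_alt) pq_uniq).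
  rewrite -!catA /= skew_move // size_cat /= addnS /= oddD sgnD !bmulA.
  by congr (_ * _); rewrite -!bmulA sgnK.
apply: uniq_perm; first 2 last.
- move=> e'; rewrite inE (perm_mem zy) !mem_cpl (perm_mem y_rot) inE.
  by case: eqP => [->|].
- rewrite /= (perm_uniq zy) cpl_uniq (perm_mem zy) mem_cpl (perm_mem y_rot).
  by rewrite mem_head.
exact: cpl_uniq.
Qed.

(** By [circuit_vec_dual], used for mu and for its bidual, which is mu up to
    sign, the relation of the dual at (x, y) is the relation of mu at the
    complements of y and x. *)
Lemma gp_dual r mu : gp r mu -> gp (#|E| - r) (dual_fun mu).
Proof.
move=> mu_gp; have mu_alt := gp_alternating mu_gp.
have mu_skew := alt_skew mu_alt; split.
- move=> s s0; have s_uniq := dual_fun_uniq s0.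
  move: s0; rewrite /dual_fun s_uniq bmul_neq0E => /andP[_ /(gp_size mu_gp)].
  rewrite -/(cpl s) size_cpl // => <-; rewrite subKn //.
  by rewrite -(card_uniqP s_uniq) max_card.
- have [s s0] := gp_nz mu_gp; have s_uniq := gp_uniq mu_gp s0.
  exists (cpl s); rewrite (dual_funE mu_skew (cpl_uniq s) (perm_cpl2 s_uniq)).
  rewrite bmul_neq0E s0 perm_sign_neq0 perm_catC.
  by rewrite perm_cat_cpl.
- exact: dual_alternating.
move=> x y x_uniq; have [y_uniq|y_rep] := boolP (uniq y); last first.
  apply: null0 => e; rewrite [_ (e :: y)](alt_repeat (dual_alternating mu_alt)).
    by rewrite bmulr0.
  by rewrite /= negb_and y_rep orbT.
have [c c0 cE] := circuit_vec_dual mu_alt x_uniq (perm_refl _).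
have [d d0 dE] := circuit_vec_dual (dual_alternating mu_alt) (cpl_uniq y)
  (perm_cpl2 y_uniq).
pose b := odd (r * (#|E| - r)).
(* The sign of the bidual depends on the length, which is r wherever mu is
   not zero. *)
have ddE : dual_fun (dual_fun mu) = fun s => sgn b * mu s.
  apply/funext => s; rewrite dual_dual_fun //.
  have [->//|/eqP/(gp_size0 mu_gp)->] := eqVneq (size s) r.
  by rewrite !bmulr0.
apply/(null_scaleE _ d0).
apply: iffLR _ (null_scale (c * sgn b) (gp_null mu_gp (cpl x) (cpl_uniq y))).
apply: eq_null => e; rewrite cE [RHS]bmulCA -dE ddE circuit_vec_scale.
by rewrite -!bmulA; congr (_ * _); rewrite [RHS]bmulCA (bmulC (mu _)).
Qed.

Lemma dual_fun_scale mu c : dual_fun (fun s => c * mu s) = fun s => c * dual_fun mu s.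
Proof.
apply/funext => s; rewrite /dual_fun; case: ifP => _; last by rewrite bmulr0.
by rewrite bmulCA.
Qed.

Lemma dual_scaling_class mu :
  dual (scaling_class mu) = scaling_class (dual_fun mu).
Proof.
apply/seteqP; split=> [_ [_ [c c0 ->] <-]|_ [c c0 ->]].
  by exists c; rewrite ?dual_fun_scale.
by exists (fun s => c * mu s); [exists c|rewrite dual_fun_scale].
Qed.

Lemma scaling_class_scale mu c : c != 0 ->
  scaling_class (fun s => c * mu s) = scaling_class mu.
Proof.
move=> c0; apply/seteqP; split=> [_ [d d0 ->]|_ [d d0 ->]].
  exists (d * c); rewrite ?bmul_neq0E ?d0 //.
  by apply/funext => s; rewrite bmulA.
have [c' cc'] := idyll_inv c0; exists (d * c').
  rewrite bmul_neq0E d0; apply: contraNneq (bone_neq0 F) => c'0.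
  by rewrite -cc' c'0 bmulr0.
by apply/funext => s; rewrite bmulA -(bmulA d) (bmulC c') cc' bmulr1.
Qed.

Lemma dual_dual r mu : gp r mu ->
  dual (dual (scaling_class mu)) = scaling_class mu.
Proof.
move=> mu_gp; rewrite !dual_scaling_class.
rewrite -(scaling_class_scale mu (sgn_neq0 F (odd (r * (#|E| - r))))).
congr scaling_class; apply/funext => s; rewrite dual_dual_fun; last first.
  exact: gp_alternating mu_gp.
have [->//|/eqP/(gp_size0 mu_gp)->] := eqVneq (size s) r.
by rewrite !bmulr0.
Qed.

(** Orthogonality to the cocircuits, which by [circuit_vec_dual] are the
    scalar multiples of the vectors e |-> mu (e :: z). *)
Definition vec mu X := forall z, null (fun e => X e * mu (e :: z)).
Definition covec mu Y := forall x, uniq x -> null (fun e => Y e * circuit_vec mu x e).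

Lemma perp_null X Y : perp X Y <-> null (fun e => X e * Y e).
Proof. by []. Qed.

Lemma covectorsP r mu Y : gp r mu -> covectors (scaling_class mu) Y <-> covec mu Y.
Proof.
move=> mu_gp; split=> [Yperp x x_uniq|Yco C [_ [x [c [[d d0 ->] x_uniq _ c0 ->]]]]].
  have [[e]|/forallNP all0] := pselect (exists e, circuit_vec mu x e != 0).
    move=> e0; apply: Yperp; exists mu, x, 1; split=> //.
    - by exists 1; rewrite ?bone_neq0 //; apply/funext => s; rewrite bmul1.
    - exists (index e x); first by rewrite index_mem (circuit_vec_supp e0).
      by move: e0; rewrite /circuit_vec; case: ifP; rewrite ?eqxx ?sgn_mul_neq0.
    - exact: bone_neq0.
    by apply/funext => e'; rewrite bmul1.
  by apply: null0 => e; rewrite (eqP (negPn (introN idP (all0 e)))) bmulr0.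
apply/perp_null; apply: iffLR _ (null_scale (c * d) (Yco x x_uniq)).
apply: eq_null => e; rewrite circuit_vec_scale bmulCA; congr (_ * _).
by rewrite bmulA.
Qed.

Lemma vectorsP r mu X : gp r mu -> vectors (scaling_class mu) X <-> vec mu X.
Proof.
move=> mu_gp; have mu_alt := gp_alternating mu_gp.
rewrite /vectors /cocircuits dual_scaling_class.
apply: iff_trans (covectorsP X (gp_dual mu_gp)) _; split=> XP z => [|z_uniq].
  have [z_uniq|z_rep] := boolP (uniq z); last first.
    by apply: null0 => e; rewrite (gp_repeat mu_gp) ?bmulr0 //= negb_and z_rep orbT.
  have [c c0 cE] := circuit_vec_dual mu_alt (cpl_uniq z) (perm_cpl2 z_uniq).
  apply/(null_scaleE _ c0).
  have := XP _ (cpl_uniq z); apply: iffLR.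
  by apply: eq_null => e; rewrite cE bmulCA.
have [c c0 cE] := circuit_vec_dual mu_alt z_uniq (perm_refl _).
apply: iffLR _ (null_scale c (XP (cpl z))).
by apply: eq_null => e; rewrite cE bmulCA.
Qed.

Lemma vectors_dual r mu : gp r mu ->
  vectors (dual (scaling_class mu)) = covectors (scaling_class mu).
Proof. by move=> /dual_dual mu_dd; rewrite /vectors /cocircuits mu_dd. Qed.

Lemma covectors_dual (M : set (seq E -> F)) : covectors (dual M) = vectors M.
Proof. by []. Qed.

Lemma circuit_vec_vec r mu x : gp r mu -> uniq x -> vec mu (circuit_vec mu x).
Proof. by move=> mu_gp x_uniq z; exact: (gp_null mu_gp z x_uniq). Qed.

Lemma cocircuit_covec r mu z : gp r mu -> covec mu (fun e => mu (e :: z)).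
Proof.
move=> mu_gp x x_uniq; apply: iffLR _ (gp_null mu_gp z x_uniq).
by apply: eq_null => e; rewrite bmulC.
Qed.

End Dual.

(** * Independence and bases *)

Section UnderlyingMatroid.
Variables (F : idyll) (E : finType) (r : nat) (mu : seq E -> F).
Hypothesis mu_gp : gp r mu.
Implicit Types (s t p q x y z : seq E) (A B : pred E).

Let mu_skew : skew mu := gp_skew mu_gp.

Definition indep s : Prop := exists t, mu (s ++ t) != 0.

Lemma indep_uniq s : indep s -> uniq s.
Proof. by move=> [t /(gp_uniq mu_gp)]; rewrite cat_uniq => /andP[]. Qed.

Lemma perm_indep s t : perm_eq s t -> indep s -> indep t.
Proof.
by move=> st [u su]; exists u; rewrite -(skew_neq0 mu_skew (s := s ++ u)) ?perm_cat2r.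
Qed.

Lemma indep_sub s t : uniq t -> {subset t <= s} -> mu s != 0 -> indep t.
Proof.
move=> t_uniq ts s0; exists [seq e <- s | e \notin t].
rewrite -(skew_neq0 mu_skew (s := s)) //; apply: uniq_perm.
- exact: gp_uniq mu_gp s0.
- rewrite cat_uniq t_uniq filter_uniq ?(gp_uniq mu_gp s0) // andbT.
  by apply/hasPn => e; rewrite mem_filter => /andP[].
move=> e; rewrite mem_cat mem_filter; case: (boolP (e \in t)) => //= /ts ->.
by [].
Qed.

(** Otherwise the relation for e :: w and z would have a single non-zero
    term, the one at e. *)
Lemma exchange e z w : mu (e :: z) != 0 -> mu w != 0 ->
  exists2 b, b \in w & mu (b :: z) != 0.
Proof.
move=> ez w0; have [ew|ew] := boolP (e \in w); first by exists e.
have ew_uniq : uniq (e :: w) by rewrite /= ew (gp_uniq mu_gp w0).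
have [//|none] := pselect (exists2 b, b \in w & mu (b :: z) != 0).
have te : circuit_vec mu (e :: w) e * mu (e :: z) != 0.
  by rewrite (@circuit_vec_split _ _ mu [::]) // bmul1 bmul_neq0E w0.
case/eqP: te; apply: null_unique (gp_null mu_gp z ew_uniq) _ => b.
rewrite bmul_neq0E => /andP[/circuit_vec_supp]; rewrite inE.
by case/orP=> [/eqP //|bw bz]; case: none; exists b.
Qed.

(** The entries of v are exchanged one by one against entries of w. *)
Lemma extend s v w : mu w != 0 -> mu (s ++ v) != 0 ->
  exists2 u, {subset u <= w} & mu (s ++ u) != 0.
Proof.
move=> w0; elim: v s => [|e v IH] s sv; first by exists [::].
have rot a : perm_eq (s ++ a :: v) (a :: s ++ v).
  exact/permEl/(perm_catCA s [:: a] v).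
have ez : mu (e :: s ++ v) != 0 by rewrite -(skew_neq0 mu_skew (rot e)).
have [b bw] := exchange ez w0.
rewrite -(skew_neq0 mu_skew (rot b)) -cat_rcons => /IH[u uw su].
exists (b :: u); last by rewrite -cat_rcons.
by move=> a; rewrite inE => /orP[/eqP->|/uw].
Qed.

(** Complete s inside a basis t ++ w. There are more entries to add than w
    has, so one of them comes from t. *)
Lemma augment s t : indep s -> indep t -> size s < size t ->
  exists2 e, e \in t & indep (e :: s).
Proof.
move=> [v sv] [w tw] st; have [u u_tw su] := extend tw sv.
have /andP[_ u_uniq] : uniq s && uniq u.
  by move: (gp_uniq mu_gp su); rewrite cat_uniq => /and3P[-> _ ->].
have [/hasP[e eu et]|/hasPn none] := boolP (has (mem t) u).
  exists e => //; case/splitPr: eu su => u1 u2 su; exists (u1 ++ u2).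
  rewrite -(skew_neq0 mu_skew (s := s ++ u1 ++ e :: u2)) //= catA.
  by rewrite catA; exact/permEl/(perm_catCA (s ++ u1) [:: e] u2).
have u_w : {subset u <= w}.
  move=> e eu; have := u_tw e eu; rewrite mem_cat => /orP[et|//].
  by move: (none e eu); rewrite /= et.
have := uniq_leq_size u_uniq u_w.
have := gp_size mu_gp su; have := gp_size mu_gp tw; rewrite !size_cat => <-.
by move=> stw uw; move: st; rewrite ltnNge -(leq_add2r (size w)) -stw leq_add2l uw.
Qed.

Definition basis_in A a : Prop :=
  [/\ all A a, indep a & forall t, all A t -> indep t -> size t <= size a].

(** The ordered bases of the contraction by A; see [bases_contrP]. *)
Definition cobasis A c : Prop := exists2 j, basis_in A j & mu (j ++ c) != 0.

Lemma indep_size s : indep s -> size s <= r.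
Proof. by move=> [t /(gp_size mu_gp)<-]; rewrite size_cat leq_addr. Qed.

Lemma exists_basis_in A : exists a, basis_in A a.
Proof.
have [s s0] := gp_nz mu_gp.
(* Maximality is by induction on a bound n for the number of elements that
   can still be added. *)
suff H n t : r - size t <= n -> all A t -> indep t -> exists a, basis_in A a.
  by apply: (H r [::]) => //; [rewrite leq_subr|exists s].
elim: n t => [|n IH] t tn At ti.
  exists t; split=> // t' _ /indep_size t'r; apply: leq_trans t'r _.
  by rewrite -subn_eq0 -leqn0.
have [[t' [At' t'i tt']]|none] :=
  pselect (exists t', [/\ all A t', indep t' & size t < size t']).
  apply: (IH t') => //; rewrite -ltnS; apply: leq_trans tn.
  by rewrite ltn_sub2l // (leq_trans tt') // indep_size.
exists t; split=> // t' At' t'i; rewrite leqNgt; apply/negP => tt'.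
by apply: none; exists t'.
Qed.

Lemma basis_in_not A a e : basis_in A a -> A e -> ~ indep (e :: a).
Proof.
by move=> [Aa _ a_max] Ae /a_max; rewrite /= Ae Aa ltnn => /(_ isT).
Qed.

(** All ordered bases of A have the same span, hence the same complements. *)
Lemma basis_in_exchange A a a' u : basis_in A a -> basis_in A a' ->
  mu (a ++ u) != 0 -> mu (a' ++ u) != 0.
Proof.
move=> aA a'A au; have [_ [v a'v] a'_max] := a'A.
have [w w_au a'w] := extend au a'v.
have w_u : {subset w <= u}.
  move=> e ew; have := w_au e ew; rewrite mem_cat => /orP[ea|//].
  have Ae : A e by case: aA => /allP Aa _ _; apply: Aa.
  case: (basis_in_not a'A Ae); case/splitPr: ew a'w => w1 w2 a'w.
  exists (w1 ++ w2); rewrite -(skew_neq0 mu_skew (s := a' ++ w1 ++ e :: w2)) //.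
  by rewrite /= !catA; exact/permEl/(perm_catCA (a' ++ w1) [:: e] w2).
have /andP[_ w_uniq] : uniq a' && uniq w.
  by move: (gp_uniq mu_gp a'w); rewrite cat_uniq => /and3P[-> _ ->].
have size_aa' : size a' = size a.
  have [Aa ai a_max] := aA; have [Aa' a'i _] := a'A.
  by apply/eqP; rewrite eqn_leq a_max ?a'_max.
rewrite -(skew_neq0 mu_skew (s := a' ++ w)) // perm_cat2l uniq_perm //.
  by move: (gp_uniq mu_gp au); rewrite cat_uniq => /and3P[].
have uw_size : size u <= size w.
  have := gp_size mu_gp au; rewrite -(gp_size mu_gp a'w) !size_cat size_aa'.
  by move=> /addnI->.
by have [] := uniq_min_size w_uniq w_u uw_size.
Qed.

Lemma cobasis_size A c t s : cobasis A c -> all A t -> mu (t ++ s) != 0 ->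
  size t + size c <= r.
Proof.
move=> [j [_ _ j_max] jc] At ts; rewrite -(gp_size mu_gp jc) size_cat leq_add2r.
by apply: j_max => //; exists s.
Qed.

Lemma cobasis_out A c e : cobasis A c -> e \in c -> ~ A e.
Proof.
move=> [j jA jc] ec Ae; apply: (basis_in_not jA Ae).
case/splitPr: ec jc => c1 c2 jc; exists (c1 ++ c2).
rewrite -(skew_neq0 mu_skew (s := j ++ c1 ++ e :: c2)) //.
by rewrite /= !catA; exact/permEl/(perm_catCA (j ++ c1) [:: e] c2).
Qed.

End UnderlyingMatroid.

(** * Minors of Grassmann-Pluecker functions *)

Section Proportional.
Variables (F : idyll) (E : finType) (r : nat) (mu : seq E -> F).
Hypothesis mu_gp : gp r mu.
Implicit Types (s t p q x y z c d j : seq E) (A B : pred E).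

Let mu_skew : skew mu := gp_skew mu_gp.

Lemma perm_mid (s : seq E) e t : perm_eq (s ++ e :: t) (e :: s ++ t).
Proof. exact/permEl/(perm_catCA s [:: e] t). Qed.

(** A condition under which the relation for x ++ e :: e' :: d and x' ++ d,
    with x and x' in A, has no term besides those at e and e'. Its first case
    is met by restrictions to A, its second case by contractions. *)
Definition two_term A d e e' : Prop :=
  (forall t, all A t -> mu (t ++ d) = 0) \/ ~ indep mu (e :: e' :: d).

Lemma two_term_neq0 A d e e' x x' : two_term A d e e' ->
  all A x -> all A x' -> mu (x ++ e :: d) * mu (x' ++ e' :: d) != 0 ->
  mu (x ++ e :: d) * mu (x' ++ e' :: d) = mu (x ++ e' :: d) * mu (x' ++ e :: d).
Proof.
move=> tt Ax Ax'; rewrite bmul_neq0E => /andP[xe x'e'].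
have [->//|ee'] := eqVneq e e'.
have xe_uniq := gp_uniq mu_gp xe.
move: (xe_uniq); rewrite cat_uniq => /and3P[x_uniq].
rewrite /= negb_or => /andP[ex xd] /andP[ed d_uniq].
have e'd : e' \notin d.
  by have := gp_uniq mu_gp x'e'; rewrite cat_uniq /= => /and4P[].
have dd_uniq : uniq (e :: e' :: d) by rewrite /= inE negb_or ee' ed e'd.
(* If e' is in x, both cases of the hypothesis contradict that the product is
   non-zero. *)
have [e'x|e'x] := boolP (e' \in x).
  case: tt => [d0|[]].
    have := d0 (e' :: x'); rewrite /= (allP Ax _ e'x) Ax' => /(_ isT)/eqP.
    by rewrite -(negbK (_ == _)) -(skew_neq0 mu_skew (perm_mid _ _ _)) x'e'.
  apply: (indep_sub mu_gp dd_uniq _ xe) => a; rewrite !inE mem_cat inE.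
  by case/or3P=> [->|/eqP->|->]; rewrite ?e'x ?orbT.
have X_uniq : uniq (x ++ e :: e' :: d).
  by rewrite cat_uniq x_uniq /= inE !negb_or ex e'x xd ee' ed e'd d_uniq.
have supp b : circuit_vec mu (x ++ e :: e' :: d) b * mu (b :: x' ++ d) != 0 ->
    b = e \/ b = e'.
  rewrite bmul_neq0E => /andP[/(circuit_vec_neq0 X_uniq)[p [q [XE pq]]] bx'd].
  have : b \in x ++ e :: e' :: d by rewrite XE mem_cat mem_head orbT.
  rewrite mem_cat !inE => /or4P[bx|/eqP->|/eqP->|bd]; try by [left|right].
    case: tt => [d0|[]].
      have := d0 (b :: x'); rewrite /= (allP Ax _ bx) Ax' => /(_ isT) b0.
      by rewrite b0 eqxx in bx'd.
    apply: (indep_sub mu_gp dd_uniq _ pq) => a add.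
    have : a \in x ++ e :: e' :: d by rewrite mem_cat add orbT.
    rewrite XE !mem_cat inE => /or3P[->|/eqP ab|->]; rewrite ?orbT //.
    subst a; move: X_uniq; rewrite cat_uniq => /and3P[_ /hasPn/(_ b add)].
    by rewrite /= bx.
  by rewrite (gp_mem mu_gp) ?eqxx // mem_cat bd orbT in bx'd.
have /null_pair := iffLR (null_two ee' supp) (gp_null mu_gp (x' ++ d) X_uniq).
have e'xe : e' \notin rcons x e by rewrite mem_rcons inE negb_or eq_sym ee' e'x.
rewrite circuit_vec_split // -(cat_rcons e x (e' :: d)).
rewrite circuit_vec_split // cat_rcons size_rcons.
have mv a : mu (a :: x' ++ d) = sgn (odd (size x')) * mu (x' ++ a :: d).
  exact: (skew_move [::]).
have -> : sgn (odd (size x).+1) = sgn true * sgn (odd (size x)) :> F.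
  by rewrite -sgnD.
rewrite !mv -!bmulA sgnK => /(bmulI (sgn_neq0 F _)).
rewrite ![_ * (sgn (odd (size x')) * _)]bmulCA => /(bmulI (sgn_neq0 F _)).
by [].
Qed.

Lemma two_term_swap A d e e' x x' : two_term A d e e' ->
  all A x -> all A x' ->
  mu (x ++ e :: d) * mu (x' ++ e' :: d) = mu (x ++ e' :: d) * mu (x' ++ e :: d).
Proof.
move=> tt Ax Ax'.
have [L0|L0] := eqVneq (mu (x ++ e :: d) * mu (x' ++ e' :: d)) 0; last first.
  exact: two_term_neq0 tt Ax Ax' L0.
have [R0|R0] := eqVneq (mu (x ++ e' :: d) * mu (x' ++ e :: d)) 0.
  by rewrite L0 R0.
apply/esym; apply: two_term_neq0 Ax Ax' R0.
case: tt => [|ee'd]; [by left|right=> e'ed; apply: ee'd].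
by apply: (perm_indep mu_gp) e'ed; exact: (perm_mid [:: e'] e d).
Qed.

(** The basis c is turned into c' by exchanging its entries one at a time,
    and by [two_term_swap] each exchange multiplies mu (x ++ c) by a factor
    that does not depend on x. *)
Lemma proportional A c c' j : all A j -> mu (j ++ c) != 0 -> mu (j ++ c') != 0 ->
  (forall d e e', {subset e :: e' :: d <= c ++ c'} -> (size d).+1 = size c ->
     two_term A d e e') ->
  forall x, all A x -> mu (x ++ c') * mu (j ++ c) = mu (x ++ c) * mu (j ++ c').
Proof.
move=> Aj jc jc' tt x Ax.
(* v is the part of c still to be exchanged, p consists of entries of c'. *)
suff H v p : {subset p <= c'} -> {subset v <= c} -> mu (j ++ v ++ p) != 0 ->
    mu (x ++ c') * mu (j ++ v ++ p) = mu (x ++ v ++ p) * mu (j ++ c').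
  by have := H c [::]; rewrite cats0; apply.
elim: v p => [|e v IH] p pc' vc jvp.
  have pc'_perm : perm_eq p c'.
    have p_uniq : uniq p by move: (gp_uniq mu_gp jvp); rewrite cat_uniq => /and3P[].
    have c'_uniq : uniq c' by move: (gp_uniq mu_gp jc'); rewrite cat_uniq => /and3P[].
    apply: uniq_perm => //; have sz : size c' <= size p.
      have := gp_size mu_gp jc'; rewrite -(gp_size mu_gp jvp) !size_cat.
      by move=> /addnI->.
    by have [] := uniq_min_size p_uniq pc' sz.
  have [b bP] := perm_skew F pc'_perm.
  rewrite /= (bP _ (skew_prefix x mu_skew)) (bP _ (skew_prefix j mu_skew)).
  by rewrite bmulCA bmulA.
have ejvp : mu (e :: j ++ v ++ p) != 0.
  by rewrite -(skew_neq0 mu_skew (perm_mid j e (v ++ p))).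
have [b bjc' b0] := exchange mu_gp ejvp jc'.
have bj : b \notin j.
  by have := gp_uniq mu_gp b0; rewrite /= mem_cat negb_or => /andP[/andP[]].
have bc' : b \in c' by move: bjc'; rewrite mem_cat (negPf bj).
have rot y : perm_eq (y ++ v ++ b :: p) (y ++ b :: v ++ p).
  by rewrite perm_cat2l perm_mid.
have jvbp : mu (j ++ v ++ b :: p) != 0.
  by rewrite (skew_neq0 mu_skew (rot j)) (skew_neq0 mu_skew (perm_mid _ _ _)).
have vpb := IH (b :: p) _ _ jvbp.
have [s sP] := perm_skew F (perm_mid v b p).
rewrite (sP _ (skew_prefix x mu_skew)) (sP _ (skew_prefix j mu_skew)) /= in vpb.
have {}vpb : mu (x ++ c') * mu (j ++ b :: v ++ p) = mu (x ++ b :: v ++ p) * mu (j ++ c').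
  have := vpb; rewrite bmulCA -bmulA => K; apply: bmulI (sgn_neq0 F s) (K _ _).
    by move=> a; rewrite inE => /orP[/eqP->|/pc'].
  by move=> a av; apply: vc; rewrite inE av orbT.
have sw := two_term_swap (x := x) (x' := j) (tt (v ++ p) e b _ _) Ax Aj.
apply: (@bmulI _ (mu (j ++ b :: v ++ p))).
  by rewrite (skew_neq0 mu_skew (perm_mid _ _ _)).
rewrite bmulCA bmulA vpb /= bmulA (bmulC (mu (j ++ _)) (mu (x ++ _))) sw.
- by rewrite -!bmulA; congr (_ * _); rewrite bmulC.
- move=> a; rewrite !inE !mem_cat => /or4P[/eqP->|/eqP->|av|ap].
  + by rewrite vc ?mem_head.
  + by rewrite bc' orbT.
  + by rewrite vc ?inE ?av ?orbT.
  + by rewrite pc' ?orbT.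
have := gp_size mu_gp jvp; rewrite -(gp_size mu_gp jc) !size_cat => /addnI <-.
by [].
Qed.

End Proportional.

Section Bases.
Variables (F : idyll) (E : finType) (r : nat) (mu : seq E -> F).
Hypothesis mu_gp : gp r mu.
Implicit Types (s t a c : seq E) (A B : {set E}).
Let mu_skew : skew mu := gp_skew mu_gp.
Local Notation M := (scaling_class mu).

Lemma basesP B : bases M B <-> exists2 s, mu s != 0 & B = [set e in s]%SET.
Proof.
split=> [[_ [s [[d d0 ->] + ->]]]|[s s0 ->]].
  by rewrite bmul_neq0E d0 => s0; exists s.
exists mu, s; split=> //; exists 1; first exact: bone_neq0.
by apply/funext => x; rewrite bmul1.
Qed.

Lemma independentP t : uniq t ->
  independent (bases M) [set e in t]%SET <-> indep mu t.
Proof.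
move=> t_uniq; split=> [[B /basesP[s s0 ->] /fintype.subsetP ts]|[u tu]].
  by apply: (indep_sub mu_gp) s0 => // e et; have := ts e; rewrite !inE; apply.
exists [set e in t ++ u]%SET; first by apply/basesP; exists (t ++ u).
by apply/fintype.subsetP => e; rewrite !inE mem_cat => ->.
Qed.

Lemma set_enumE A : A = [set e in enum A]%SET.
Proof. by apply/setP => e; rewrite inE mem_enum. Qed.

Lemma card_set_seq s : uniq s -> #|[set e in s]%SET| = size s.
Proof. by move=> s_uniq; rewrite cardsE; apply/card_uniqP. Qed.

(** Maximal independent sets are of maximal size, by [augment]. *)
Lemma bases_restrP A a : uniq a ->
  bases_restr (bases M) A [set e in a]%SET <-> basis_in mu (mem A) a.
Proof.
move=> a_uniq; split=> [[/(independentP a_uniq) ai /fintype.subsetP aA a_max]|].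
  have Aa : all (mem A) a by apply/allP => e ea; apply: aA; rewrite inE.
  split=> // t At ti; rewrite leqNgt; apply/negP => at_.
  have [e et eai] := augment mu_gp ai ti at_.
  have ea_uniq := indep_uniq mu_gp eai.
  have /setP/(_ e) : [set e' in e :: a]%SET = [set e' in a]%SET; first apply: a_max.
  - exact/(independentP ea_uniq).
  - apply/fintype.subsetP => e'; rewrite !inE => /orP[/eqP->|e'a]; first exact: (allP At).
    by apply: aA; rewrite inE.
  - by apply/fintype.subsetP => e'; rewrite !inE => ->; rewrite orbT.
  rewrite !inE eqxx /= => /esym ea.
  by move: ea_uniq; rewrite /= ea.
move=> [Aa ai a_max]; split=> [||I II IA aI].
- exact/(independentP a_uniq).
- by apply/fintype.subsetP => e; rewrite inE => /(allP Aa).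
apply/eqP; rewrite eq_sym eqEcard aI card_set_seq //= cardE; apply: a_max.
  by apply/allP => e; rewrite mem_enum => /(fintype.subsetP IA).
by apply/independentP; rewrite ?enum_uniq // -set_enumE.
Qed.

Lemma bases_contrP A c : uniq c ->
  bases_contr (bases M) A [set e in c]%SET <-> cobasis mu (mem A) c.
Proof.
move=> c_uniq; split=> [[/fintype.subsetP cA [J]]|[j jA jc]].
  rewrite [J]set_enumE => /(bases_restrP _ (enum_uniq _)) JA.
  move=> /basesP[s s0 sE]; exists (enum J) => //.
  rewrite -(skew_neq0 mu_skew (s := s)) //; apply: uniq_perm.
  - exact: gp_uniq mu_gp s0.
  - rewrite cat_uniq enum_uniq c_uniq andbT; apply/hasPn => e ec.
    have := cA e; rewrite !inE => /(_ ec); apply: contra => eJ.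
    by case: JA => /allP/(_ e eJ).
  by move=> e; move/setP/(_ e): sE; rewrite !inE mem_cat orbC => <-.
have j_uniq : uniq j by case: jA => _ /(indep_uniq mu_gp).
split.
  apply/fintype.subsetP => e; rewrite !inE.
  by move=> /(cobasis_out mu_gp (ex_intro2 _ _ j jA jc))/negP.
exists [set e in j]%SET; first exact/bases_restrP.
apply/basesP; exists (j ++ c) => //; apply/setP => e.
by rewrite !inE mem_cat orbC.
Qed.

End Bases.

Section Minor.
Variables (F : idyll) (E' E : finType) (r : nat) (mu : seq E -> F) (h : E' -> E).
Hypotheses (mu_gp : gp r mu) (h_inj : injective h).
Implicit Types (c : seq E) (x y : seq E').

Definition minor_fun c : seq E' -> F := fun x => mu (map h x ++ c).

Lemma circuit_vec_minor c y e : h e \notin c ->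
  circuit_vec (minor_fun c) y e = circuit_vec mu (map h y ++ c) (h e).
Proof.
move=> ec; rewrite /circuit_vec mem_cat (negPf ec) orbF mem_map //.
case: ifP => // ey; rewrite index_cat map_f // index_map //.
rewrite del_cat size_map index_mem ey /minor_fun.
by rewrite /del map_cat map_take map_drop.
Qed.

(** The relation for x and y is the one of mu for x ++ c and y ++ c, where
    the entries of c contribute nothing since they would be repeated. *)
Lemma gp_minor c : (forall e, h e \notin c) -> (exists x, minor_fun c x != 0) ->
  gp (r - size c) (minor_fun c).
Proof.
move=> hc c0; have c_uniq : uniq c.
  by case: c0 => x /(gp_uniq mu_gp); rewrite cat_uniq => /and3P[].
split=> //.
- by move=> s /(gp_size mu_gp) <-; rewrite size_cat size_map addnK.
- split=> [p a b q|s]; first by rewrite /minor_fun !map_cat -!catA /= (gp_skew mu_gp).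
  by move=> /(gp_uniq mu_gp); rewrite cat_uniq map_inj_uniq // => /and3P[].
move=> x y x_uniq.
have xc_uniq : uniq (map h x ++ c).
  rewrite cat_uniq map_inj_uniq // x_uniq c_uniq andbT; apply/hasPn => e ec.
  by apply/mapP => -[e' _ ee']; have := hc e'; rewrite -ee' ec.
have := gp_null mu_gp (map h y ++ c) xc_uniq.
move=> /(null_inj h_inj) H; apply: iffLR _ (H _).
  by apply: eq_null => e; rewrite circuit_vec_minor.
move=> e; rewrite bmul_neq0E => /andP[/circuit_vec_supp].
rewrite mem_cat => /orP[/mapP[e' _ ->]|ec]; first by exists e'.
by rewrite (gp_mem mu_gp) ?eqxx // mem_cat ec orbT.
Qed.

Local Notation M := (scaling_class mu).
Local Notation A := [set h e | e : E']%SET.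

Lemma scaling_of_prop (f g : seq E' -> F) (u v : F) : u != 0 -> v != 0 ->
  (forall x, g x * u = f x * v) -> scaling_class f g.
Proof.
move=> u0 v0 fg; have [u' uu'] := idyll_inv u0; exists (v * u').
  rewrite bmul_neq0E v0; apply: contraNneq (bone_neq0 F) => u'0.
  by rewrite -uu' u'0 bmulr0.
apply/funext => x; rewrite bmulC bmulA -fg -bmulA uu' bmulr1.
by [].
Qed.

(** Two choices of c satisfy the first case of [two_term]: d is too short to
    complete a family in A to a basis. *)
Lemma restr_alongE : exists2 c, cobasis mu (mem A) c &
  restr_along h M = scaling_class (minor_fun c).
Proof.
have [j jA] := exists_basis_in mu_gp (mem A).
have [_ [c jc] _] := jA; exists c; first by exists j.
have Ah x : all (mem A) (map h x).
  by apply/allP => _ /mapP[e _ ->]; apply: imset_f.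
apply/seteqP; split=> [_ [_ [c' [[d d0 ->] c'_uniq cP ->]]]|_ [d d0 ->]].
  have {cP} c'A := iffLR (bases_contrP mu_gp _ c'_uniq) cP.
  have [j' j'A j'c'] := c'A.
  have jc' := basis_in_exchange mu_gp j'A jA j'c'.
  have cA : cobasis mu (mem A) c by exists j.
  have Aj : all (mem A) j by case: jA.
  apply: (@scaling_of_prop _ _ (mu (j ++ c)) (d * mu (j ++ c'))) => //.
    by rewrite bmul_neq0E d0.
  move=> x; rewrite -bmulA (proportional mu_gp (c := c) (c' := c') Aj) //.
    by rewrite bmulCA.
  move=> d' e e' _ d'c; left => t At; apply/eqP/negPn/negP => td'.
  have := cobasis_size mu_gp cA At td'; rewrite -(gp_size mu_gp td') size_cat.
  by rewrite leq_add2l -d'c ltnn.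
have c_uniq : uniq c by move: (gp_uniq mu_gp jc); rewrite cat_uniq => /and3P[].
exists (fun s => d * mu s), c; split=> //; first by exists d.
by apply/(bases_contrP mu_gp _ c_uniq); exists j.
Qed.

(** Two choices of a satisfy the second case of [two_term]: the family e ::
    e' :: d outside A is too long to be independent. *)
Lemma contr_alongE : exists2 a, basis_in mu (mem (~: A)%SET) a &
  contr_along h M = scaling_class (minor_fun a).
Proof.
have [a aA] := exists_basis_in mu_gp (mem (~: A)%SET); exists a => //.
have [Aa [u au] a_max] := aA.
have ua : mu (u ++ a) != 0.
  by rewrite (skew_neq0 (gp_skew mu_gp) (t := a ++ u)) // perm_catC.
apply/seteqP; split=> [_ [_ [a' [[d d0 ->] a'_uniq aP ->]]]|_ [d d0 ->]].
  have {aP} a'A := iffLR (bases_restrP mu_gp _ a'_uniq) aP.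
  have [Aa' _ _] := a'A.
  have ua' : mu (u ++ a') != 0.
    rewrite (skew_neq0 (gp_skew mu_gp) (t := a' ++ u)); last by rewrite perm_catC.
    exact: (basis_in_exchange mu_gp aA a'A au).
  apply: (@scaling_of_prop _ _ (mu (u ++ a)) (d * mu (u ++ a'))) => //.
    by rewrite bmul_neq0E d0.
  move=> x; rewrite -bmulA.
  rewrite (proportional mu_gp (A := predT) (c := a) (c' := a')) ?all_predT //.
    by rewrite bmulCA.
  move=> d' e e' ed'_sub d'a; right => ed'i; have : size [:: e, e' & d'] <= size a.
    apply: a_max ed'i; apply/allP => b /ed'_sub; rewrite mem_cat.
    by case/orP; [apply: (allP Aa)|apply: (allP Aa')].
  by rewrite /= d'a ltnn.
have a_uniq : uniq a by move: (gp_uniq mu_gp ua); rewrite cat_uniq => /and3P[].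
exists (fun s => d * mu s), a; split=> //; first by exists d.
by apply/(bases_restrP mu_gp _ a_uniq).
Qed.

End Minor.

(** * Distinguished loops *)

Lemma noneP (T : eqType) (s : seq (option T)) : None \notin s ->
  s = map Some (pmap id s).
Proof. by elim: s => [//|[e|] s IH] //=; rewrite inE => /IH <-. Qed.

Lemma none_map (T : eqType) (s : seq T) : None \notin map Some s.
Proof. by apply/mapP => -[]. Qed.

Lemma pmap_map_Some (T : Type) (s : seq T) : pmap id (map Some s) = s.
Proof. by elim: s => //= e s ->. Qed.

Section Loop.
Variables (F : idyll) (T : finType).
Implicit Types (mu : seq T -> F) (M : set (seq (option T) -> F)).

Definition loop_fun mu : seq (option T) -> F :=
  fun x => if None \in x then 0 else mu (pmap id x).

Lemma loop_fun_map mu x : loop_fun mu (map Some x) = mu x.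
Proof. by rewrite /loop_fun (negPf (none_map x)) pmap_map_Some. Qed.

Lemma loop_fun_neq0 mu s : loop_fun mu s != 0 -> exists2 t, s = map Some t & mu t != 0.
Proof.
rewrite /loop_fun; case: ifPn => [_|/noneP sE]; first by rewrite eqxx.
by exists (pmap id s).
Qed.

Lemma add_loopE mu : add_loop (scaling_class mu) = scaling_class (loop_fun mu).
Proof.
have E c : (fun x => if None \in x then 0 else c * mu (pmap id x)) =
           (fun x => c * loop_fun mu x).
  by apply/funext => x; rewrite /loop_fun; case: ifP; rewrite ?bmulr0.
apply/seteqP; split=> [_ [_ [c c0 ->] <-]|_ [c c0 ->]]; first by exists c => //.
by exists (fun s => c * mu s); [exists c|rewrite -E].
Qed.

Lemma Some_inj : injective (@Some T). Proof. by move=> ? ? []. Qed.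

Lemma loop_fun_skew mu : skew mu -> skew (loop_fun mu).
Proof.
move=> mu_skew p a b q; rewrite /loop_fun.
have pab : perm_eq (p ++ a :: b :: q) (p ++ b :: a :: q).
  by rewrite perm_cat2l; exact/permEl/(perm_catCA [:: a] [:: b] q).
rewrite -(perm_mem pab); case: ifPn => [|/noneP sE]; first by rewrite bmulr0.
case: a b sE {pab} => [a|] [b|]; rewrite !pmap_cat //=.
all: by move/(congr1 (fun s => None \in s)); rewrite (negPf (none_map _)) !mem_cat !inE ?orbT.
Qed.

Lemma circuit_vec_loop mu x e :
  circuit_vec (loop_fun mu) (map Some x) (Some e) = circuit_vec mu x e.
Proof.
rewrite /circuit_vec mem_map; last exact: Some_inj.
case: ifP => // _; rewrite index_map; last exact: Some_inj.
by rewrite /del -map_take -map_drop -map_cat loop_fun_map.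
Qed.

Lemma gp_loop r mu : gp r mu -> gp r (loop_fun mu).
Proof.
move=> mu_gp; split.
- by move=> _ /loop_fun_neq0[t -> /(gp_size mu_gp)]; rewrite size_map.
- by have [s s0] := gp_nz mu_gp; exists (map Some s); rewrite loop_fun_map.
- split; first exact/loop_fun_skew/gp_skew/mu_gp.
  by move=> _ /loop_fun_neq0[t -> /(gp_uniq mu_gp)]; rewrite (map_inj_uniq Some_inj).
move=> x y x_uniq.
have [xN|xN] := boolP (None \in x).
  apply: null0 => e; apply/eqP/negPn/negP; rewrite bmul_neq0E => /andP[].
  move=> /(circuit_vec_neq0 x_uniq)[p [q [xE /loop_fun_neq0[t pqE _]]]].
  have : None \notin p ++ q by rewrite pqE none_map.
  move: xN; rewrite xE !mem_cat inE; case: e {xE} => [e|] //=.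
    by move=> ->.
  by rewrite /loop_fun /= eqxx.
have [yN|yN] := boolP (None \in y).
  by apply: null0 => e; rewrite /loop_fun inE yN orbT bmulr0.
have xE := noneP xN; have yE := noneP yN.
rewrite xE yE in x_uniq *; apply/(null_inj Some_inj) => [e|].
  rewrite bmul_neq0E => /andP[_ /loop_fun_neq0[[|e' t] //= [-> _] _]].
  by exists e'.
rewrite (map_inj_uniq Some_inj) in x_uniq.
apply: iffLR _ (gp_null mu_gp (pmap id y) x_uniq); apply: eq_null => e.
by rewrite circuit_vec_loop -map_cons loop_fun_map.
Qed.

(** M has a distinguished loop and mu is a Grassmann-Pluecker function of
    what is left after deleting it. Constructions on pointed classes are
    computed on such functions. *)
Definition rep M r mu : Prop := gp r mu /\ M = add_loop (scaling_class mu).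

Lemma rep_pmatroid M r mu : rep M r mu -> is_pmatroid M.
Proof.
move=> [mu_gp ->]; rewrite add_loopE; split.
  by exists r, (loop_fun mu); split=> //; apply/gpP/gp_loop.
by move=> _ [c _ ->] s sN; rewrite /loop_fun sN bmulr0.
Qed.

Lemma pmatroid_rep M : is_pmatroid M -> exists r mu, rep M r mu.
Proof.
move=> [[r [nu [/gpP nu_gp ->]]] nuN].
have nu_loop s : None \in s -> nu s = 0.
  apply: nuN; exists 1; first exact: bone_neq0.
  by apply/funext => x; rewrite bmul1.
exists r, (minor_fun nu Some [::]); split.
  have := gp_minor nu_gp Some_inj (c := [::]); rewrite subn0; apply=> //.
  have [s s0] := gp_nz nu_gp; exists (pmap id s); rewrite /minor_fun cats0 -noneP //.
  by apply: contra s0 => /nu_loop->.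
rewrite add_loopE; congr scaling_class; apply/funext => s; rewrite /loop_fun.
case: ifPn => [/nu_loop//|/noneP sE].
by rewrite /minor_fun cats0 -sE.
Qed.

Lemma indep_loop mu s : indep (loop_fun mu) s <-> exists2 t, s = map Some t & indep mu t.
Proof.
split=> [[u /loop_fun_neq0[t /esym/map_eq_cat[t1 [t2 [tE t1E _]]] t0]]|[t -> [u tu]]].
  by exists t1 => //; exists t2; rewrite -tE.
by exists (map Some u); rewrite -map_cat loop_fun_map.
Qed.

Lemma basis_in_loop mu (A : pred (option T)) (A' : pred T) a :
  (forall e, A (Some e) = A' e) -> basis_in (loop_fun mu) A a ->
  exists2 a', a = map Some a' & basis_in mu A' a'.
Proof.
move=> AA' [Aa /indep_loop[a' aE a'i] a_max]; exists a' => //.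
have allE t : all A (map Some t) = all A' t.
  by rewrite all_map; apply: eq_all => e /=.
split=> //; first by rewrite -allE -aE.
move=> t A't ti; have := a_max (map Some t); rewrite aE !size_map; apply.
  by rewrite allE.
by apply/indep_loop; exists t.
Qed.

Lemma cobasis_loop mu (A : pred (option T)) (A' : pred T) c :
  (forall e, A (Some e) = A' e) -> cobasis (loop_fun mu) A c ->
  exists2 c', c = map Some c' & cobasis mu A' c'.
Proof.
move=> AA' [_ /(basis_in_loop AA')[j -> jA'] /loop_fun_neq0[t]].
move=> /esym/map_eq_cat[t1 [c' [tE /(inj_map Some_inj) t1E <-]]] t0.
by exists c' => //; exists j; rewrite // -t1E -tE.
Qed.

(** A basis of the contraction by everything but the loop is empty. *)
Lemma delete_point_rep M r mu : rep M r mu -> delete_point M = scaling_class mu.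
Proof.
move=> [mu_gp ->]; rewrite add_loopE /delete_point.
have [c cA ->] := restr_alongE Some (gp_loop mu_gp).
have [c' cE _] := cobasis_loop (fun=> erefl) cA.
suff -> : c = [::].
  congr scaling_class; apply/funext => x.
  by rewrite /minor_fun cats0 loop_fun_map.
case: c' cE => [//|e c'] cE; case: (cobasis_out (gp_loop mu_gp) cA (e := Some e)).
  by rewrite cE mem_head.
exact: imset_f.
Qed.

End Loop.

Section PointedMinors.
Variables (F : idyll) (T : finType).
Implicit Types (mu : seq T -> F) (M : set (seq (option T) -> F)).

Lemma minor_fun_loop (S : finType) (h : S -> T) mu c :
  minor_fun (loop_fun mu) (omap h) (map Some c) = loop_fun (minor_fun mu h c).
Proof.
apply/funext => x; rewrite /minor_fun.
have [xN|/noneP xE] := boolP (None \in x).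
  by rewrite /loop_fun xN mem_cat (map_f (omap h) xN).
rewrite [in RHS]xE loop_fun_map -(@loop_fun_map _ _ mu); congr loop_fun.
by rewrite xE map_cat -!map_comp pmap_map_Some.
Qed.

Lemma imset_omap (P : pred T) e :
  (Some e \in [set omap val i | i : option {x | P x}]%SET) = P e.
Proof.
apply/imsetP/idP => [[[[e' Pe']|] _ //=]|Pe]; first by case=> ->.
by exists (Some (exist _ e Pe)).
Qed.

Lemma prestr_rep M r mu (A : {set T}) : rep M r mu ->
  exists2 c, cobasis mu (mem A) c & rep (@prestr F T M A) (r - size c) (minor_fun mu val c).
Proof.
move=> [mu_gp ->]; rewrite add_loopE /prestr.
have [c' c'A ->] :=
  restr_alongE (omap (val : {x | x \in A} -> T)) (gp_loop mu_gp).
have [c -> cA] := cobasis_loop (imset_omap (mem A)) c'A.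
exists c => //; split; last by rewrite add_loopE minor_fun_loop.
apply: (gp_minor mu_gp val_inj) => [e|].
  by apply/negP => /(cobasis_out mu_gp cA); apply; apply: valP.
have [j [Aj _ _] jc] := cA; exists (pmap insub j).
rewrite /minor_fun (_ : map val _ = j) //; elim: j Aj {jc} => //= e j IH /andP[eA].
by move=> /IH; rewrite insubT /= => ->.
Qed.

Lemma pcontr_rep M r mu (A : {set T}) : rep M r mu ->
  exists2 a, basis_in mu (mem A) a & rep (@pcontr F T M A) (r - size a) (minor_fun mu val a).
Proof.
move=> [mu_gp ->]; rewrite add_loopE /pcontr.
have [a' a'A ->] :=
  contr_alongE (omap (val : {x | x \notin A} -> T)) (gp_loop mu_gp).
have [|a -> aA] := basis_in_loop (A' := mem A) _ a'A.
  by move=> e; rewrite /= finset.in_setC (imset_omap (fun x => x \notin A)) negbK.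
exists a => //; split; last by rewrite add_loopE minor_fun_loop.
have [/allP Aa [u au] _] := aA.
apply: (gp_minor mu_gp val_inj) => [e|].
  by apply/negP => /Aa; rewrite /= (negPf (valP e)).
have uA : all [predC A] u.
  apply/allP => e eu /=; apply/negP => eA; case: (basis_in_not aA eA).
  case/splitPr: eu au => u1 u2 au; exists (u1 ++ u2).
  rewrite -(skew_neq0 (gp_skew mu_gp) (s := a ++ u1 ++ e :: u2)) //=.
  by rewrite !catA perm_mid.
exists (pmap insub u).
rewrite /minor_fun (_ : map val _ = u).
  by rewrite (skew_neq0 (gp_skew mu_gp) (t := a ++ u)) // perm_catC.
elim: u uA {au} => //= e u IH /andP[eA].
by move=> /IH; rewrite insubT /= => ->.
Qed.

Lemma pdual_rep M r mu : rep M r mu -> rep (pdual M) (#|T| - r) (dual_fun mu).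
Proof.
move=> Mmu; have [mu_gp _] := Mmu; split; first exact: gp_dual.
by rewrite /pdual (delete_point_rep Mmu) dual_scaling_class.
Qed.

End PointedMinors.

(** * Direct sums of Grassmann-Pluecker functions *)

Section DirectSum.
Variables (F : idyll) (S T : finType).
Implicit Types (x y p q : seq (S + T)) (mu : seq S -> F) (nu : seq T -> F).

Definition lefts : seq (S + T) -> seq S :=
  pmap (fun o => if o is inl e then Some e else None).
Definition rights : seq (S + T) -> seq T :=
  pmap (fun o => if o is inr e then Some e else None).

Definition shuffle_odd x : bool := unshuffle_odd (map Some x).

Definition usum mu nu x : F :=
  sgn (shuffle_odd x) * (mu (lefts x) * nu (rights x)).

Lemma lefts_cat x y : lefts (x ++ y) = lefts x ++ lefts y.
Proof. exact: pmap_cat. Qed.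
Lemma rights_cat x y : rights (x ++ y) = rights x ++ rights y.
Proof. exact: pmap_cat. Qed.

Lemma mem_lefts x e : (e \in lefts x) = (inl e \in x).
Proof. by elim: x => [|[a|a] x IH] //=; rewrite !inE IH. Qed.
Lemma mem_rights x e : (e \in rights x) = (inr e \in x).
Proof. by elim: x => [|[a|a] x IH] //=; rewrite !inE IH. Qed.

Lemma shuffle_inl e x : shuffle_odd (inl e :: x) = shuffle_odd x.
Proof. by []. Qed.

Lemma shuffle_inr e x :
  shuffle_odd (inr e :: x) = odd (size (lefts x)) (+) shuffle_odd x.
Proof.
rewrite /shuffle_odd /=; congr (odd _ (+) _).
by elim: x => [|[a|a] x IH] //=; rewrite IH.
Qed.

Ltac xor_cases :=
  repeat match goal with
  | |- context [odd ?n] => case: (odd n)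
  | |- context [shuffle_odd ?x] => case: (shuffle_odd x)
  end; done.

Lemma shuffle_cat x y : shuffle_odd (x ++ y) =
  shuffle_odd x (+) shuffle_odd y (+) odd (size (rights x) * size (lefts y)).
Proof.
elim: x => [|[a|a] x IH] /=; first by rewrite addbF.
  by rewrite !shuffle_inl IH.
rewrite !shuffle_inr IH lefts_cat size_cat oddD mulSn oddD.
by xor_cases.
Qed.

Lemma perm_lefts_rights x : perm_eq x (map inl (lefts x) ++ map inr (rights x)).
Proof.
elim: x => [|[a|a] x IH] //=; first by rewrite perm_cons.
by rewrite perm_sym (perm_trans (perm_mid _ _ _)) // perm_cons perm_sym.
Qed.

Lemma size_lefts_rights x : size x = size (lefts x) + size (rights x).
Proof. by rewrite (perm_size (perm_lefts_rights x)) size_cat !size_map. Qed.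

Lemma uniq_lefts_rights x : uniq x = uniq (lefts x) && uniq (rights x).
Proof.
rewrite (perm_uniq (perm_lefts_rights x)) cat_uniq.
rewrite (map_inj_uniq (@inl_inj S T)) (map_inj_uniq (@inr_inj S T)).
by rewrite (_ : has _ _ = false) //; apply/hasPn => _ /mapP[e _ ->]; apply/mapP => -[].
Qed.

Lemma lefts_map s t : lefts (map inl s ++ map inr t) = s.
Proof.
rewrite lefts_cat (_ : lefts (map inr t) = [::]); last by elim: t.
by rewrite cats0; elim: s => //= e s ->.
Qed.
Lemma rights_map s t : rights (map inl s ++ map inr t) = t.
Proof.
rewrite rights_cat (_ : rights (map inl s) = [::]); last by elim: s.
by elim: t => //= e t ->.
Qed.

Lemma usum_inl mu nu e y : usum mu nu (inl e :: y) =
  (sgn (shuffle_odd y) * nu (rights y)) * mu (e :: lefts y).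
Proof. by rewrite /usum shuffle_inl -bmulA [_ * nu _]bmulC. Qed.

Lemma usum_inr mu nu e y : usum mu nu (inr e :: y) =
  (sgn (odd (size (lefts y)) (+) shuffle_odd y) * mu (lefts y)) * nu (e :: rights y).
Proof. by rewrite /usum shuffle_inr bmulA. Qed.

Lemma circuit_vec_usum_inl mu nu x e : uniq x ->
  circuit_vec (usum mu nu) x (inl e) =
  (sgn (shuffle_odd x) * nu (rights x)) * circuit_vec mu (lefts x) e.
Proof.
move=> x_uniq; have [ex|ex] := boolP (inl e \in x); last first.
  by rewrite !circuit_vec_out ?mem_lefts ?bmulr0.
case/splitPr: ex x_uniq => p q x_uniq.
have ep : inl e \notin p.
  by move: x_uniq; rewrite cat_uniq /= negb_or => /and3P[_ /andP[]].
rewrite circuit_vec_split // /usum !lefts_cat !rights_cat /=.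
rewrite circuit_vec_split ?mem_lefts // !shuffle_cat shuffle_inl.
rewrite size_lefts_rights -!bmulA [nu _ * _]bmulC !bmulA; congr (_ * _ * _).
rewrite -!sgnD oddD /= mulnS oddD.
by congr sgn; xor_cases.
Qed.

Lemma circuit_vec_usum_inr mu nu x e : uniq x ->
  circuit_vec (usum mu nu) x (inr e) =
  (sgn (odd (size (lefts x)) (+) shuffle_odd x) * mu (lefts x))
    * circuit_vec nu (rights x) e.
Proof.
move=> x_uniq; have [ex|ex] := boolP (inr e \in x); last first.
  by rewrite !circuit_vec_out ?mem_rights ?bmulr0.
case/splitPr: ex x_uniq => p q x_uniq.
have ep : inr e \notin p.
  by move: x_uniq; rewrite cat_uniq /= negb_or => /and3P[_ /andP[]].
rewrite circuit_vec_split // /usum !lefts_cat !rights_cat /=.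
rewrite circuit_vec_split ?mem_rights // !shuffle_cat shuffle_inr.
rewrite size_lefts_rights -!bmulA [mu _ * (sgn _ * _)]bmulCA !bmulA; congr (_ * _ * _).
rewrite -!sgnD oddD size_cat oddD.
by congr sgn; xor_cases.
Qed.

Lemma usum_skew mu nu : skew mu -> skew nu -> skew (usum mu nu).
Proof.
move=> mu_skew nu_skew p a b q.
have pre y : usum mu nu (p ++ y) = sgn (shuffle_odd p (+) odd (size (rights p) * size (lefts y)))
  * (sgn (shuffle_odd y) * (mu (lefts p ++ lefts y) * nu (rights p ++ rights y))).
  rewrite /usum lefts_cat rights_cat [RHS]bmulA -sgnD shuffle_cat.
  by congr (sgn _ * _); xor_cases.
rewrite !pre; case: a b => [a|a] [b|b] /=; rewrite ?(shuffle_inl, shuffle_inr) /=.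
- by rewrite mu_skew -!bmulA [RHS]bmulCA; congr (_ * _); rewrite bmulCA.
- rewrite [RHS]bmulCA; congr (_ * _); rewrite [RHS]bmulA; congr (_ * _).
  by rewrite -[bopp 1]/(@sgn F true) -sgnD; congr sgn; xor_cases.
- rewrite [RHS]bmulCA; congr (_ * _); rewrite [RHS]bmulA; congr (_ * _).
  by rewrite -[bopp 1]/(@sgn F true) -sgnD; congr sgn; xor_cases.
by rewrite nu_skew [RHS]bmulCA; congr (_ * _); rewrite [RHS]bmulCA [mu _ * (_ * _)]bmulCA.
Qed.

(** Indexed by the disjoint union, a relation of the sum consists of a
    multiple of a relation of mu and a multiple of a relation of nu. *)
Lemma gp_usum r s mu nu : gp r mu -> gp s nu -> gp (r + s) (usum mu nu).
Proof.
move=> mu_gp nu_gp.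
have nz x : usum mu nu x != 0 -> mu (lefts x) != 0 /\ nu (rights x) != 0.
  by rewrite sgn_mul_neq0 bmul_neq0E => /andP[].
split.
- by move=> x /nz[/(gp_size mu_gp) <- /(gp_size nu_gp) <-]; apply: size_lefts_rights.
- have [x x0] := gp_nz mu_gp; have [y y0] := gp_nz nu_gp.
  exists (map inl x ++ map inr y).
  by rewrite /usum lefts_map rights_map sgn_mul_neq0 bmul_neq0E x0.
- split; first exact: usum_skew (gp_skew mu_gp) (gp_skew nu_gp).
  by move=> x /nz[/(gp_uniq mu_gp) lx /(gp_uniq nu_gp)]; rewrite uniq_lefts_rights lx.
move=> x y x_uniq; move: (x_uniq); rewrite uniq_lefts_rights => /andP[lx rx].
apply: null_sum.
  have := null_scale ((sgn (shuffle_odd x) * nu (rights x)) *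
                      (sgn (shuffle_odd y) * nu (rights y)))
    (gp_null mu_gp (lefts y) lx).
  apply: iffLR; apply: eq_null => e.
  by rewrite circuit_vec_usum_inl // usum_inl bmulACA.
have := null_scale ((sgn (odd (size (lefts x)) (+) shuffle_odd x) * mu (lefts x)) *
                    (sgn (odd (size (lefts y)) (+) shuffle_odd y) * mu (lefts y)))
    (gp_null nu_gp (rights y) rx).
apply: iffLR; apply: eq_null => e.
by rewrite circuit_vec_usum_inr // usum_inr bmulACA.
Qed.

(** For a basis y of one summand, the cocircuits of the sum given by z and y
    are those of the other summand given by z. *)
Lemma vec_usum r s mu nu (Z : S + T -> F) : gp r mu -> gp s nu ->
  vec (usum mu nu) Z <-> vec mu (Z \o inl) /\ vec nu (Z \o inr).
Proof.
move=> mu_gp nu_gp; split=> [Zv|[Zl Zr] z]; last first.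
  apply: null_sum.
    have := null_scale (sgn (shuffle_odd z) * nu (rights z)) (Zl (lefts z)).
    by apply: iffLR; apply: eq_null => e; rewrite usum_inl bmulCA.
  have := null_scale (sgn (odd (size (lefts z)) (+) shuffle_odd z) * mu (lefts z)) (Zr (rights z)).
  by apply: iffLR; apply: eq_null => e; rewrite usum_inr bmulCA.
split=> z.
  have [y y0] := gp_nz nu_gp; have [z_size|z_size] := eqVneq (size z).+1 r; last first.
    by apply: null0 => e; rewrite (gp_size0 mu_gp) ?bmulr0 //; apply/eqP.
  have c0 : sgn (shuffle_odd (map inl z ++ map inr y)) * nu y != 0.
    by rewrite sgn_mul_neq0.
  apply/(null_scaleE _ c0); have := Zv (map inl z ++ map inr y).
  move=> /(null_inj (@inl_inj S T)) H; apply: iffLR _ (H _).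
    by apply: eq_null => e; rewrite usum_inl lefts_map rights_map bmulCA.
  case=> e; first by exists e.
  rewrite usum_inr lefts_map (gp_size0 mu_gp (s := z)) ?bmulr0 ?bmul0 ?bmulr0 ?eqxx //.
  by rewrite -z_size => /n_Sn.
have [y y0] := gp_nz mu_gp; have [z_size|z_size] := eqVneq (size z).+1 s; last first.
  by apply: null0 => e; rewrite (gp_size0 nu_gp) ?bmulr0 //; apply/eqP.
pose yz := map inl y ++ map inr z.
have c0 : sgn (odd (size y) (+) shuffle_odd yz) * mu y != 0.
  by rewrite sgn_mul_neq0.
apply/(null_scaleE _ c0); have := Zv yz.
move=> /(null_inj (@inr_inj S T)) H; apply: iffLR _ (H _).
  by apply: eq_null => e; rewrite usum_inr lefts_map rights_map bmulCA.
case=> e; last by exists e.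
rewrite usum_inl rights_map (gp_size0 nu_gp (s := z)) ?bmulr0 ?bmul0 ?bmulr0 ?eqxx //.
by rewrite -z_size => /n_Sn.
Qed.

Lemma dsum_fun_loop mu nu :
  dsum_fun (loop_fun mu) (loop_fun nu) = loop_fun (usum mu nu).
Proof.
apply/funext => x; rewrite /dsum_fun; have [xN|/noneP xE] := boolP (None \in x).
  by rewrite /loop_fun xN.
rewrite xE loop_fun_map /usum; congr (_ * (_ * _)).
  rewrite -[RHS]loop_fun_map; congr loop_fun.
  by elim: (pmap id x) => [|[e|e] y IH] //=; rewrite IH.
rewrite -[RHS]loop_fun_map; congr loop_fun.
by elim: (pmap id x) => [|[e|e] y IH] //=; rewrite IH.
Qed.

Lemma dsum_fun_scale c d mu nu :
  dsum_fun (fun s => c * loop_fun mu s) (fun s => d * loop_fun nu s) =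
  fun o => (c * d) * loop_fun (usum mu nu) o.
Proof.
apply/funext => x; rewrite -dsum_fun_loop /dsum_fun.
by case: ifP => _; rewrite ?bmulr0 // [RHS]bmulCA bmulACA.
Qed.

Lemma dsum_rep (M : set (seq (option S) -> F)) (N : set (seq (option T) -> F))
  r s mu nu : rep M r mu -> rep N s nu -> rep (dsum M N) (r + s) (usum mu nu).
Proof.
move=> [mu_gp ->] [nu_gp ->]; split; first exact: gp_usum.
rewrite !add_loopE; apply/seteqP; split.
  move=> _ [_ [_ [[c c0 ->] [d d0 ->] ->]]]; exists (c * d).
    by rewrite bmul_neq0E c0.
  by rewrite dsum_fun_scale.
move=> _ [c c0 ->]; exists (fun s => c * loop_fun mu s), (loop_fun nu).
split; [by exists c| |].
  by exists 1; [exact: bone_neq0|apply/funext => x; rewrite bmul1].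
have := dsum_fun_scale c 1 mu nu; rewrite bmulr1 => <-.
by congr dsum_fun; apply/funext => x; rewrite bmul1.
Qed.

End DirectSum.

(** * Submonomial matrices *)

Section Matrices.
Variable F : idyll.
Implicit Types S T U : finType.

Lemma mx_actE S T (f : T -> S -> F) X j i : submonomial f -> f j i != 0 ->
  mx_act f X j = f j i * X i.
Proof.
move=> [f_row _] ji; apply: sum1_unique => i'.
by rewrite bmul_neq0E => /andP[ji' _]; apply: f_row ji' ji.
Qed.

Lemma mx_act_neq0 S T (f : T -> S -> F) X j : mx_act f X j != 0 ->
  exists2 i, f j i != 0 & X i != 0.
Proof. by move=> /sum1_neq0[i + _]; rewrite bmul_neq0E => /andP[]; exists i. Qed.

Lemma mx_act0 S T (f : T -> S -> F) X j : (forall i, f j i = 0) -> mx_act f X j = 0.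
Proof. by move=> f0; apply: sum1_0 => i; rewrite f0 bmul0. Qed.

Lemma submonomial_tr S T (f : T -> S -> F) : submonomial f -> submonomial (mx_tr f).
Proof. by case. Qed.

Lemma mx_tr_mul S T U (g : U -> T -> F) (f : T -> S -> F) :
  mx_tr (mx_mul g f) = mx_mul (mx_tr f) (mx_tr g).
Proof.
apply/funext => i; apply/funext => k; apply: eq_sum1 => j.
by rewrite /mx_tr bmulC.
Qed.

Lemma mx_tr_id T : mx_tr (@mx_fun F T T id) = mx_fun F id.
Proof. by apply/funext => i; apply/funext => j; rewrite /mx_tr /mx_fun eq_sym. Qed.

Lemma mx_mul_act S T U (g : U -> T -> F) (f : T -> S -> F) k i :
  mx_mul g f k i = mx_act g (fun j => f j i) k.
Proof. by []. Qed.

(** Both sums are over the non-zero entries of f. *)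
Lemma perp_adjoint S T (f : T -> S -> F) X Y : submonomial f ->
  perp (mx_act f X) Y <-> perp X (mx_act (mx_tr f) Y).
Proof.
move=> fs; have fts := submonomial_tr fs; rewrite !perp_null.
pose a (p : T * S) := f p.1 p.2 * X p.2 * Y p.1.
have nz p : a p != 0 -> f p.1 p.2 != 0 /\ X p.2 != 0 /\ Y p.1 != 0.
  by rewrite !bmul_neq0E => /andP[/andP[-> ->] ->].
apply: iff_trans (iff_sym _) (_ : null a <-> _).
  apply: (@null_reindex _ _ _ fst) => [[j i]|[j i] [j' i']|j].
  - by move=> /nz[/= ji _]; rewrite (mx_actE X fs ji).
  - move=> /nz[/= ji _] /nz[/= ji' _] jj'; subst j'.
    by have [f_row _] := fs; rewrite (f_row _ _ _ ji ji').
  - rewrite bmul_neq0E => /andP[/mx_act_neq0[i ji Xi] Yj].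
    by exists (j, i); rewrite // !bmul_neq0E ji Xi.
apply: (@null_reindex _ _ _ snd) => [[j i]|[j i] [j' i']|i].
- move=> /nz[/= ji _]; rewrite (mx_actE Y fts (ji : mx_tr f i j != 0)).
  by rewrite /a /mx_tr /= bmulCA bmulA.
- move=> /nz[/= ji _] /nz[/= ji' _] jj'; subst i'.
  by have [_ f_col] := fs; rewrite (f_col _ _ _ ji ji').
- rewrite bmul_neq0E => /andP[Xi /mx_act_neq0[j ji Yj]].
  by exists (j, i); rewrite // !bmul_neq0E ji Xi.
Qed.

Lemma perpC T (X Y : T -> F) : perp X Y <-> perp Y X.
Proof. by rewrite !perp_null; apply: eq_null => e; rewrite bmulC. Qed.

Lemma mx_fun_neq0 S T (h : S -> T) j i : mx_fun F h j i != 0 -> j = h i.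
Proof. by rewrite /mx_fun; have [->|_] := eqVneq j (h i); rewrite // eqxx. Qed.

Lemma mx_fun1 S T (h : S -> T) i : mx_fun F h (h i) i = 1.
Proof. by rewrite /mx_fun eqxx. Qed.

Lemma submonomial_fun S T (h : S -> T) : injective h -> submonomial (mx_fun F h).
Proof.
move=> h_inj; split=> [j i i' /mx_fun_neq0-> /mx_fun_neq0/h_inj//|].
by move=> i j j' /mx_fun_neq0-> /mx_fun_neq0->.
Qed.

Lemma mx_act_fun S T (h : S -> T) X i : injective h -> mx_act (mx_fun F h) X (h i) = X i.
Proof.
move=> h_inj; rewrite (mx_actE X (submonomial_fun h_inj) (i := i)) mx_fun1 ?bmul1 //.
exact: bone_neq0.
Qed.

Lemma mx_act_fun0 S T (h : S -> T) X j : (forall i, j <> h i) -> mx_act (mx_fun F h) X j = 0.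
Proof.
move=> jh; apply: mx_act0 => i; apply/eqP/negPn/negP => /mx_fun_neq0; exact: jh.
Qed.

Lemma mx_act_tr_fun S T (h : S -> T) Y i : mx_act (mx_tr (mx_fun F h)) Y i = Y (h i).
Proof.
rewrite /mx_act /mx_tr (@sum1_unique _ _ _ (h i)) ?mx_fun1 ?bmul1 // => j.
by rewrite bmul_neq0E => /andP[/mx_fun_neq0].
Qed.

Lemma mx_mul_fun S T U (g : T -> U) (h : S -> T) :
  mx_mul (mx_fun F g) (mx_fun F h) = mx_fun F (g \o h).
Proof.
apply/funext => k; apply/funext => i; rewrite /mx_mul (@sum1_unique _ _ _ (h i)).
  by rewrite mx_fun1 bmulr1.
by move=> j; rewrite bmul_neq0E => /andP[_ /mx_fun_neq0].
Qed.

Lemma mx_mul_funr S T U (g : U -> T -> F) (h : S -> T) k i :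
  mx_mul g (mx_fun F h) k i = g k (h i).
Proof.
rewrite /mx_mul (@sum1_unique _ _ _ (h i)) ?mx_fun1 ?bmulr1 //.
by move=> j; rewrite bmul_neq0E => /andP[_ /mx_fun_neq0].
Qed.

Lemma mx_mul_funl S T U (h : T -> U) (f : T -> S -> F) j i : injective h ->
  mx_mul (mx_fun F h) f (h j) i = f j i.
Proof. by move=> h_inj; rewrite mx_mul_act mx_act_fun. Qed.

Lemma perp_ext S T (h : S -> T) X Y : injective h ->
  perp (mx_act (mx_fun F h) X) Y <-> perp X (Y \o h).
Proof.
move=> h_inj; apply: iff_trans (perp_adjoint X Y (submonomial_fun h_inj)) _.
by apply: eq_null => i; rewrite mx_act_tr_fun.
Qed.

Lemma ext_res T (P : pred T) (Y : T -> F) :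
  mx_act (mx_fun F val) (Y \o (val : {x | P x} -> T)) = fun e => if P e then Y e else 0.
Proof.
apply/funext => e; case: ifPn => Pe.
  by rewrite -[e]/(val (exist P e Pe)) mx_act_fun //; apply: val_inj.
by rewrite mx_act_fun0 // => -[b Pb] /= eb; rewrite eb Pb in Pe.
Qed.

Definition binv (a : F) : F :=
  if pselect (exists b, a * b = 1) is left ab then projT1 (cid ab) else 0.

Lemma bmulV a : a != 0 -> a * binv a = 1.
Proof.
by move=> /idyll_inv a_inv; rewrite /binv; case: pselect => // ab; case: cid.
Qed.

Lemma binv_neq0 a : (binv a != 0) = (a != 0).
Proof.
have [->|a0] := eqVneq a 0.
  rewrite /binv; case: pselect => [ab|_]; last by rewrite eqxx.
  exfalso; case: ab => b /eqP.
  by rewrite bmul0 eq_sym (negPf (bone_neq0 F)).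
by apply: contraNneq (bone_neq0 F) => b0; rewrite -(bmulV a0) b0 bmulr0.
Qed.

(** For a submonomial f this inverts f between the coordinates that it links,
    see [mx_pinvK] and [mx_actVK]. *)
Definition mx_pinv S T (f : T -> S -> F) : S -> T -> F := fun i j => binv (f j i).

Lemma submonomial_pinv S T (f : T -> S -> F) : submonomial f -> submonomial (mx_pinv f).
Proof.
move=> [f_row f_col]; split=> [i j j'|j i i']; rewrite !binv_neq0.
  exact: f_col.
exact: f_row.
Qed.

Lemma mx_pinvK S T (f : T -> S -> F) X : submonomial f ->
  (forall i, exists j, f j i != 0) -> mx_act (mx_pinv f) (mx_act f X) = X.
Proof.
move=> fs f_col; apply/funext => i; have [j ji] := f_col i.
rewrite (mx_actE _ (submonomial_pinv fs) (i := j)) ?binv_neq0 //.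
by rewrite (mx_actE X fs ji) bmulA (bmulC (mx_pinv f i j)) bmulV ?bmul1.
Qed.

Lemma mx_actVK S T (f : T -> S -> F) Y : submonomial f ->
  (forall j, Y j != 0 -> exists i, f j i != 0) -> mx_act f (mx_act (mx_pinv f) Y) = Y.
Proof.
move=> fs f_Y; apply/funext => j; have [[i ji]|none] := pselect (exists i, f j i != 0).
  rewrite (mx_actE _ fs ji) (mx_actE _ (submonomial_pinv fs) (i := j)) ?binv_neq0 //.
  by rewrite bmulA bmulV ?bmul1.
rewrite mx_act0 => [|i]; last by apply/eqP/negPn/negP => ji; apply: none; exists i.
by apply/esym/eqP/negPn/negP => /f_Y.
Qed.

End Matrices.

(** * Vectors and covectors of minors *)

Section MinorVectors.
Variables (F : idyll) (E' E : finType) (r : nat) (mu : seq E -> F) (h : E' -> E).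
Hypotheses (mu_gp : gp r mu) (h_inj : injective h).
Implicit Types (c : seq E) (X Y : E -> F) (x z : seq E').
Local Notation ext := (mx_act (mx_fun F h)).

Lemma map_minor_uniq c x : (forall e, h e \notin c) -> uniq c -> uniq x ->
  uniq (map h x ++ c).
Proof.
move=> hc c_uniq x_uniq; rewrite cat_uniq map_inj_uniq // x_uniq c_uniq andbT.
by apply/hasPn => e ec; apply/mapP => -[e' _ ee']; have := hc e'; rewrite -ee' ec.
Qed.

(** Cocircuits of a minor are traces of cocircuits. *)
Lemma vec_minor_ext c (X : E' -> F) : vec mu (ext X) -> vec (minor_fun mu h c) X.
Proof.
move=> Xv z; have /(null_inj h_inj) H := Xv (map h z ++ c).
apply: iffLR _ (H _); first by apply: eq_null => e; rewrite mx_act_fun.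
move=> e; rewrite bmul_neq0E => /andP[/mx_act_neq0[i /mx_fun_neq0 -> _] _].
by exists i.
Qed.

(** Circuits of a minor are traces of circuits. *)
Lemma covec_minor_ext c (Y : E' -> F) : (forall e, h e \notin c) -> uniq c ->
  covec mu (ext Y) -> covec (minor_fun mu h c) Y.
Proof.
move=> hc c_uniq Yco x x_uniq.
have /(null_inj h_inj) H := Yco _ (map_minor_uniq hc c_uniq x_uniq).
apply: iffLR _ (H _).
  by apply: eq_null => e; rewrite mx_act_fun // circuit_vec_minor.
move=> e; rewrite bmul_neq0E => /andP[/mx_act_neq0[i /mx_fun_neq0 -> _] _].
by exists i.
Qed.

(** By assumption cocircuits of the minor extend by zero to cocircuits. *)
Lemma vec_minor_res a X :
  (forall e z, e \notin codom h -> mu (e :: map h z ++ a) = 0) ->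
  vec mu X -> vec (minor_fun mu h a) (X \o h).
Proof.
move=> ha Xv z; have /(null_inj h_inj) H := Xv (map h z ++ a).
apply: H => e; rewrite bmul_neq0E => /andP[_ ez].
have [/codomP[i ->]|he] := boolP (e \in codom h); first by exists i.
by rewrite ha ?eqxx in ez.
Qed.

(** By assumption circuits of the minor extend by zero to circuits. *)
Lemma covec_minor_res c Y : (forall e, h e \notin c) -> uniq c ->
  (forall e x, uniq x -> e \notin codom h -> circuit_vec mu (map h x ++ c) e = 0) ->
  covec mu Y -> covec (minor_fun mu h c) (Y \o h).
Proof.
move=> hc c_uniq cc Yco x x_uniq.
have /(null_inj h_inj) H := Yco _ (map_minor_uniq hc c_uniq x_uniq).
apply: iffLR _ (H _).
  by apply: eq_null => e /=; rewrite circuit_vec_minor.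
move=> e; rewrite bmul_neq0E => /andP[_ ex].
have [/codomP[i ->]|he] := boolP (e \in codom h); first by exists i.
by rewrite cc ?eqxx in ex.
Qed.

End MinorVectors.

Section Dependence.
Variables (F : idyll) (E : finType) (r : nat) (mu : seq E -> F).
Hypothesis mu_gp : gp r mu.
Implicit Types (A : pred E) (a c d s t x : seq E).
Let mu_skew : skew mu := gp_skew mu_gp.

Lemma cobasis_uniq A c : cobasis mu A c -> uniq c.
Proof. by move=> [j _ /(gp_uniq mu_gp)]; rewrite cat_uniq => /and3P[]. Qed.

Lemma basis_in_uniq A a : basis_in mu A a -> uniq a.
Proof. by move=> [_ /(indep_uniq mu_gp)]. Qed.

Lemma basis_in_loop0 A a e x : basis_in mu A a -> A e -> mu (e :: x ++ a) = 0.
Proof.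
move=> aA Ae; apply/eqP/negPn/negP => exa; apply: (basis_in_not aA Ae).
by exists x; rewrite (skew_neq0 mu_skew (t := e :: x ++ a)) //= perm_cons perm_catC.
Qed.

(** Otherwise deleting e from x ++ c would leave a basis, in which x is an
    independent family in A completed by fewer elements than c has. *)
Lemma cobasis_circuit0 A c x e : cobasis mu A c -> uniq x -> all A x -> ~~ A e ->
  circuit_vec mu (x ++ c) e = 0.
Proof.
move=> cA x_uniq Ax Ae; apply/eqP/negPn/negP => nz.
have xc_uniq : uniq (x ++ c).
  rewrite cat_uniq x_uniq (cobasis_uniq cA) andbT; apply/hasPn => b bc.
  by apply/negP => /(allP Ax); exact: (cobasis_out mu_gp cA bc).
have [p [q [pq pq0]]] := circuit_vec_neq0 xc_uniq nz.
have ex : e \notin x by apply: contra Ae => /(allP Ax).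
have [s xs] : indep mu x.
  apply: (indep_sub mu_gp x_uniq _ pq0) => b bx.
  have : b \in x ++ c by rewrite mem_cat bx.
  rewrite pq !mem_cat inE => /or3P[->//|/eqP be|->]; last by rewrite orbT.
  by rewrite -be bx in ex.
have := cobasis_size mu_gp cA Ax xs; rewrite -(gp_size mu_gp pq0) -size_cat pq.
by rewrite !size_cat addnS ltnn.
Qed.

(** If d ++ t is a basis, then for each e in d the cocircuit given by the
    other elements of d ++ t meets the support of Z in e at most. *)
Lemma vec_indep d t Z e : mu (d ++ t) != 0 -> vec mu Z ->
  (forall e, Z e != 0 -> e \in d) -> Z e = 0.
Proof.
move=> dt Zv Zd; apply/eqP/negPn/negP => Ze.
have ed := Zd e Ze; case/splitPr: ed dt Zd => p q dt Zd.
have dt_perm : perm_eq ((p ++ e :: q) ++ t) (e :: p ++ q ++ t).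
  by rewrite -catA perm_mid.
have epq := dt; rewrite (skew_neq0 mu_skew dt_perm) in epq.
have : Z e * mu (e :: p ++ q ++ t) != 0 by rewrite bmul_neq0E Ze epq.
case/eqP; apply: (null_unique (Zv (p ++ q ++ t))) => b.
rewrite bmul_neq0E => /andP[/Zd + /(gp_uniq mu_gp)/andP[+ _]].
rewrite !mem_cat inE !negb_or => /or3P[->//|/eqP//|->].
by rewrite andbF.
Qed.

(** Let j be a maximal independent part of d and e an element of d outside j.
    The fundamental circuit of e with respect to a basis containing j is
    supported in e :: j. *)
Lemma dependent_vec d : uniq d -> r < size d ->
  exists Z, [/\ vec mu Z, exists e, Z e != 0 & forall e, Z e != 0 -> e \in d].
Proof.
move=> d_uniq rd; have [j jd] := exists_basis_in mu_gp (mem d).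
have [/allP jd_sub ji _] := jd; have [k jk] := ji.
have [e ed ej] : exists2 e, e \in d & e \notin j.
  apply/hasP; rewrite -[has _ _]negbK -all_predC; apply: contraTN rd => /allP dj.
  rewrite -leqNgt (leq_trans _ (indep_size mu_gp ji)) // uniq_leq_size // => e ed.
  by have := dj e ed; rewrite /= negbK.
exists (circuit_vec mu (e :: j ++ k)); have jk_uniq := gp_uniq mu_gp jk.
have ek : e \notin k.
  apply/negP => ek; apply: (basis_in_not jd ed); case/splitPr: ek jk {jk_uniq} => k1 k2 jk.
  exists (k1 ++ k2); rewrite (skew_neq0 mu_skew (t := j ++ k1 ++ e :: k2)) //=.
  by rewrite perm_sym !catA perm_mid.
have y_uniq : uniq (e :: j ++ k) by rewrite /= mem_cat negb_or ej ek.
split.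
- exact: circuit_vec_vec mu_gp y_uniq.
- by exists e; rewrite (@circuit_vec_split _ _ mu [::]) // bmul1.
move=> b nz; have [p [q [pq pq0]]] := circuit_vec_neq0 y_uniq nz.
have := circuit_vec_supp nz; rewrite inE mem_cat => /or3P[/eqP->//|/jd_sub//|bk].
case: (basis_in_not jd ed); apply: (indep_sub mu_gp _ _ pq0) => [|b'].
  by rewrite /= ej (indep_uniq mu_gp ji).
move=> b'ej; have : b' \in e :: j ++ k.
  by move: b'ej; rewrite !inE mem_cat => /orP[->//|->]; rewrite orbT.
rewrite pq !mem_cat inE => /or3P[->//|/eqP b'b|->]; last by rewrite orbT.
subst b'; move: jk_uniq b'ej; rewrite cat_uniq inE => /and3P[_ /hasPn/(_ b bk)/= bj _].
by rewrite (negPf bj) orbF => /eqP be; rewrite -be bk in ek.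
Qed.

End Dependence.

(** * Pointed matroids over a perfect idyll *)

Section PointedVectors.
Variable F : idyll.
Hypothesis F_perfect : perfect F.

Section OneMatroid.
Variable T : finType.
Implicit Types (M : set (seq (option T) -> F)) (mu : seq T -> F) (X Y : T -> F).

Definition pcovectors M : set (T -> F) := covectors (delete_point M).

Lemma pvecP M r mu X : rep M r mu -> pvectors M X <-> vec mu X.
Proof.
by move=> Mmu; rewrite /pvectors (delete_point_rep Mmu); apply: vectorsP Mmu.1.
Qed.

Lemma pcovecP M r mu Y : rep M r mu -> pcovectors M Y <-> covec mu Y.
Proof.
by move=> Mmu; rewrite /pcovectors (delete_point_rep Mmu); apply: covectorsP Mmu.1.
Qed.

Lemma pvec_pcov M X Y : is_pmatroid M -> pvectors M X -> pcovectors M Y -> perp X Y.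
Proof.
move=> /pmatroid_rep[r [mu Mmu]]; apply: F_perfect.
exists r, mu; split; first by apply/gpP; case: Mmu.
exact: delete_point_rep Mmu.
Qed.

(** Covectors include the cocircuits; perfection gives the other implication. *)
Lemma pvec_orth M X : is_pmatroid M ->
  pvectors M X <-> forall Y, pcovectors M Y -> perp X Y.
Proof.
move=> Mm; split=> [XM Y YM|XP]; first exact: pvec_pcov XM YM.
have [r [mu Mmu]] := pmatroid_rep Mm; apply/(pvecP _ Mmu) => z.
by apply: XP; apply/(pcovecP _ Mmu)/cocircuit_covec/Mmu.1.
Qed.

(** Vectors include the circuits; perfection gives the other implication. *)
Lemma pcov_orth M Y : is_pmatroid M ->
  pcovectors M Y <-> forall X, pvectors M X -> perp X Y.
Proof.
move=> Mm; split=> [YM X XM|YP]; first exact: pvec_pcov XM YM.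
have [r [mu Mmu]] := pmatroid_rep Mm; apply/(pcovecP _ Mmu) => x x_uniq.
by apply/perpC/YP/(pvecP _ Mmu)/circuit_vec_vec/x_uniq/Mmu.1.
Qed.

Lemma pdual_pmatroid M : is_pmatroid M -> is_pmatroid (pdual M).
Proof. by move=> /pmatroid_rep[r [mu /pdual_rep/rep_pmatroid]]. Qed.

Lemma pvectors_dual M : is_pmatroid M -> pvectors (pdual M) = pcovectors M.
Proof.
move=> /pmatroid_rep[r [mu Mmu]]; rewrite /pvectors /pcovectors.
rewrite (delete_point_rep (pdual_rep Mmu)) (delete_point_rep Mmu).
by rewrite -dual_scaling_class (vectors_dual Mmu.1).
Qed.

Lemma pcovectors_dual M : is_pmatroid M -> pcovectors (pdual M) = pvectors M.
Proof.
move=> /pmatroid_rep[r [mu Mmu]]; rewrite /pvectors /pcovectors.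
rewrite (delete_point_rep (pdual_rep Mmu)) (delete_point_rep Mmu).
by rewrite -dual_scaling_class covectors_dual.
Qed.

End OneMatroid.

Section Minors.
Variable T : finType.
Implicit Types (M : set (seq (option T) -> F)) (mu : seq T -> F) (X Y : T -> F).

Lemma prestr_pmatroid M (A : {set T}) : is_pmatroid M -> is_pmatroid (@prestr F T M A).
Proof. by move=> /pmatroid_rep[r [mu /(prestr_rep A)[c _ /rep_pmatroid]]]. Qed.

Lemma pcontr_pmatroid M (A : {set T}) : is_pmatroid M -> is_pmatroid (@pcontr F T M A).
Proof. by move=> /pmatroid_rep[r [mu /(pcontr_rep A)[c _ /rep_pmatroid]]]. Qed.

Lemma codom_val (P : pred T) e : (e \in codom (val : {x | P x} -> T)) = P e.
Proof.
apply/codomP/idP => [[x ->]|Pe]; first exact: valP.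
by exists (exist _ e Pe).
Qed.

Lemma all_map_val (P : pred T) (s : seq {x | P x}) : all P (map val s).
Proof. by apply/allP => _ /mapP[e _ ->]; apply: valP. Qed.

Lemma pcov_restr M (A : {set T}) Y : is_pmatroid M ->
  pcovectors M Y -> pcovectors (@prestr F T M A) (Y \o val).
Proof.
move=> /pmatroid_rep[r [mu Mmu]] /(pcovecP _ Mmu) YM.
have [c cA rep_c] := prestr_rep A Mmu; apply/(pcovecP _ rep_c).
have mu_gp := Mmu.1; apply: (covec_minor_res val_inj _ _ _ YM) => [e||e x x_uniq].
- by apply/negP => /(cobasis_out mu_gp cA); apply; apply: valP.
- exact: (cobasis_uniq mu_gp cA).
rewrite (codom_val (mem A)) => eA.
apply: (cobasis_circuit0 mu_gp cA _ _ eA); first by rewrite (map_inj_uniq val_inj).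
exact: (@all_map_val (mem A)).
Qed.

(** Traces of covectors of M are covectors of the restriction, so perfection
    makes the extension of X orthogonal to all covectors of M. *)
Lemma pvec_restr M (A : {set T}) (X : {x | x \in A} -> F) : is_pmatroid M ->
  pvectors (@prestr F T M A) X <-> pvectors M (mx_act (mx_fun F val) X).
Proof.
move=> Mm; have Am := prestr_pmatroid A Mm; split=> [XA|].
  apply/(pvec_orth _ Mm) => Y /(@pcov_restr M A Y Mm) YA.
  exact/(perp_ext _ _ val_inj)/(iffLR (pvec_orth _ Am) XA).
have [r [mu Mmu]] := pmatroid_rep Mm; have [c cA rep_c] := prestr_rep A Mmu.
by move=> /(pvecP _ Mmu)/(vec_minor_ext val_inj) => Xv; apply/(pvecP _ rep_c).
Qed.

Lemma pvec_contr M (A : {set T}) X : is_pmatroid M ->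
  pvectors M X -> pvectors (@pcontr F T M A) (X \o val).
Proof.
move=> /pmatroid_rep[r [mu Mmu]] /(pvecP _ Mmu) XM.
have [a aA rep_a] := pcontr_rep A Mmu; apply/(pvecP _ rep_a).
apply: (vec_minor_res val_inj _ XM) => e z.
rewrite (codom_val (fun x => x \notin A)) negbK => eA.
exact: (basis_in_loop0 Mmu.1 _ aA eA).
Qed.

(** The dual of [pvec_restr]: traces of vectors of M are vectors of the
    contraction. *)
Lemma pcov_contr M (A : {set T}) (Y : {x | x \notin A} -> F) : is_pmatroid M ->
  pcovectors (@pcontr F T M A) Y <-> pcovectors M (mx_act (mx_fun F val) Y).
Proof.
move=> Mm; have Am := pcontr_pmatroid A Mm; split=> [YA|].
  apply/(pcov_orth _ Mm) => X /(@pvec_contr M A X Mm) XA.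
  by apply/perpC/(perp_ext _ _ val_inj)/perpC/(iffLR (pcov_orth _ Am) YA).
have [r [mu Mmu]] := pmatroid_rep Mm; have [a aA rep_a] := pcontr_rep A Mmu.
move=> /(pcovecP _ Mmu) YM; apply/(pcovecP _ rep_a).
apply: (covec_minor_ext val_inj _ _ YM) => [e|].
  by case: aA => /allP Aa _ _; apply/negP => /Aa; rewrite /= (negPf (valP e)).
exact: (basis_in_uniq Mmu.1 aA).
Qed.

(** A family outside U that is dependent in M/U supports a non-zero vector of
    M/U ([dependent_vec]), by assumption a vector of M, so it is dependent in
    M ([vec_indep]). Hence the complement of U has the same rank in M as in
    M/U. If c is a basis of M/U and e is outside U, then e :: c is dependent,
    which means that the cocircuits of M|U extend by zero to cocircuits of M. *)
Lemma pvec_split M (U : {set T}) : is_pmatroid M ->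
  (forall X : {x | x \notin U} -> F, pvectors (@pcontr F T M U) X ->
     pvectors M (mx_act (mx_fun F val) X)) ->
  forall X, pvectors M X -> pvectors M (fun e => if e \in U then X e else 0).
Proof.
move=> Mm lift X XM; have [r [mu Mmu]] := pmatroid_rep Mm.
have mu_gp := Mmu.1.
have [a aU rep_a] := pcontr_rep U Mmu; have [c cU rep_c] := prestr_rep U Mmu.
(* a is a basis of U, and c is a basis of M/U. *)
have ac : size a + size c = r.
  have [j jU jc] := cU; rewrite -(gp_size mu_gp jc) size_cat; congr (_ + _).
  have [Ua ai a_max] := aU; have [Uj ji j_max] := jU.
  by apply/eqP; rewrite eqn_leq a_max // j_max.
have rank_out d : all [predC U] d -> indep mu d -> size d <= size c.
  move=> dU di; rewrite leqNgt; apply/negP => cd.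
  pose d' : seq {x | x \notin U} := pmap insub d.
  have dE : map val d' = d.
    by elim: d dU {di cd} @d' => //= e d IH /andP[eU /IH]; rewrite insubT /= => ->.
  have d'_uniq : uniq d' by rewrite -(map_inj_uniq val_inj) dE (indep_uniq mu_gp di).
  have := dependent_vec rep_a.1 d'_uniq; rewrite -(size_map val d') dE.
  (* M/U has rank r - size a, which is the length of c. *)
  rewrite ltn_subLR ?ac; last by rewrite -ac leq_addr.
  rewrite -ac ltn_add2l => /(_ cd)[Z [Zv [e Ze] Zd']].
  have /lift/(pvecP _ Mmu) Zext := iffRL (pvecP _ rep_a) Zv.
  have [t dt] := di.
  case/eqP: Ze; rewrite -[LHS](mx_act_fun _ _ val_inj).
  apply: (vec_indep mu_gp (val e) dt Zext) => b /mx_act_neq0[b' /mx_fun_neq0-> /Zd'].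
  by rewrite -dE; apply: map_f.
rewrite -(ext_res (fun e => e \in U)).
apply/(@pvec_restr M U (X \o val) Mm)/(pvecP _ rep_c).
apply: (vec_minor_res val_inj _ (iffLR (pvecP _ Mmu) XM)) => e z.
rewrite (codom_val (mem U)) => eU; apply/eqP/negPn/negP => ezc.
have : size (e :: c) <= size c; last by rewrite /= ltnn.
apply: rank_out => /=.
  apply/andP; split=> //; by apply/allP => b /(cobasis_out mu_gp cU)/negP.
exists (map val z).
by rewrite (skew_neq0 (gp_skew mu_gp) (t := e :: map val z ++ c)) //= perm_cons perm_catC.
Qed.

End Minors.
End PointedVectors.

Section DoubleMinors.
Variable F : idyll.
Hypothesis F_perfect : perfect F.
Variable T : finType.
Implicit Types (N : set (seq (option T) -> F)).

(** Circuits of (N/C)|A are traces of circuits of N supported in the union of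
    C and A, whose traces on D are vectors of N|D. *)
Lemma pcov_restr_contr N (C : {set T}) (A : {set {x | x \notin C}}) (D : {set T})
    (Y : {a | a \in A} -> F) (Y' : {d | d \in D} -> F) :
  is_pmatroid N -> (forall e, e \in C -> e \in D) ->
  (forall a : {a | a \in A}, val (val a) \in D) ->
  (forall a d, val (val a) = val d -> Y' d = Y a) ->
  (forall d, (forall a : {a | a \in A}, val (val a) <> val d) -> Y' d = 0) ->
  pcovectors (@prestr F T N D) Y' ->
  pcovectors (@prestr F _ (@pcontr F T N C) A) Y.
Proof.
move=> Nm CD AD Y'Y Y'0 Y'cov; have [r [nu Nnu]] := pmatroid_rep Nm.
have [a aC rep_a] := pcontr_rep C Nnu; have [c cA rep_c] := prestr_rep A rep_a.
have nu_gp := Nnu.1; apply/(pcovecP _ rep_c) => x x_uniq.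
have ac (e : {x | x \notin C}) : val e \notin a.
  by case: aC => /allP aC _ _; apply/negP => /aC; rewrite /= (negPf (valP e)).
have cx (e : {x | x \in A}) : val e \notin c.
  by apply/negP => /(cobasis_out rep_a.1 cA); apply; apply: valP.
pose Z := circuit_vec nu (map val (map val x ++ c) ++ a).
have Z_uniq : uniq (map val (map val x ++ c) ++ a).
  apply: (map_minor_uniq val_inj ac (basis_in_uniq nu_gp aC)).
  exact: (map_minor_uniq val_inj cx (cobasis_uniq rep_a.1 cA) x_uniq).
have ZE e : Z (val (val e)) = circuit_vec (minor_fun (minor_fun nu val a) val c) x e.
  by rewrite [RHS](circuit_vec_minor _ val_inj) // (circuit_vec_minor _ val_inj).
have Z_supp e : Z e != 0 -> e \in D.
  have [eC _|eC] := boolP (e \in C); first exact: CD.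
  have [eA _|eA] := boolP (exist _ e eC \in A).
    by have := AD (exist (fun a => a \in A) _ eA).
  rewrite -[e]/(val (exist (fun x => x \notin C) e eC)) /Z.
  rewrite -(circuit_vec_minor _ val_inj) // (cobasis_circuit0 rep_a.1 cA) ?eqxx //.
    by rewrite map_inj_uniq //; apply: val_inj.
  exact: (@all_map_val _ (mem A)).
have ZD : pvectors (@prestr F T N D) (Z \o val).
  apply/(pvec_restr F_perfect) => //.
  rewrite (ext_res (fun e => e \in D)) (_ : (fun e => _) = Z).
    exact/(pvecP _ Nnu)/circuit_vec_vec/Z_uniq/nu_gp.
  apply/funext => e; case: ifPn => // eD.
  by apply/esym/eqP/negPn/negP => /Z_supp; apply/negP.
have := pvec_pcov F_perfect (prestr_pmatroid D Nm) ZD Y'cov.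
pose k (e : {a | a \in A}) : {d | d \in D} := exist _ (val (val e)) (AD e).
have k_inj : injective k.
  by move=> e e' /(congr1 val)/= /val_inj/val_inj.
move/perp_null/(null_inj k_inj) => H; apply: iffLR _ (H _) => [|d].
  by apply: eq_null => e /=; rewrite (Y'Y e) // -ZE bmulC.
rewrite bmul_neq0E => /andP[_ Y'd]; apply: contrapT => none.
case/eqP: Y'd; apply: Y'0 => e ed; apply: none; exists e.
exact: val_inj.
Qed.

(** Cocircuits of (N|A)/B are traces of cocircuits of N that vanish on B',
    whose traces are covectors of N/B'. *)
Lemma pvec_contr_restr N (A : {set T}) (B : {set {x | x \in A}}) (B' : {set T})
    (X : {b | b \notin B} -> F) (X' : {e | e \notin B'} -> F) :
  is_pmatroid N -> (forall e, e \in B' -> exists2 b, b \in B & val b = e) ->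
  (forall b : {b | b \notin B}, val (val b) \notin B') ->
  (forall b e, val (val b) = val e -> X' e = X b) ->
  (forall e, (forall b : {b | b \notin B}, val (val b) <> val e) -> X' e = 0) ->
  pvectors (@pcontr F T N B') X' ->
  pvectors (@pcontr F _ (@prestr F T N A) B) X.
Proof.
move=> Nm B'B BB' X'X X'0 X'vec; have [r [nu Nnu]] := pmatroid_rep Nm.
have [c cA rep_c] := prestr_rep A Nnu; have [b bB rep_b] := pcontr_rep B rep_c.
have nu_gp := Nnu.1; apply/(pvecP _ rep_b) => z.
pose Y e := nu (e :: map val (map val z ++ b) ++ c).
have YE e : Y (val (val e)) = minor_fun (minor_fun nu val c) val b (e :: z) by [].
have Y0 e : e \in B' -> Y e = 0.
  by move=> /B'B[e' e'B <-]; apply: (basis_in_loop0 rep_c.1 _ bB e'B).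
have YB : pcovectors (@pcontr F T N B') (Y \o val).
  apply/(pcov_contr F_perfect) => //.
  rewrite (ext_res (fun e => e \notin B')) (_ : (fun e => _) = Y).
    exact/(pcovecP _ Nnu)/cocircuit_covec/nu_gp.
  by apply/funext => e; case: ifPn => // /negPn/Y0.
have := pvec_pcov F_perfect (pcontr_pmatroid B' Nm) X'vec YB.
pose k (e : {b | b \notin B}) : {e | e \notin B'} := exist _ (val (val e)) (BB' e).
have k_inj : injective k.
  by move=> e e' /(congr1 val)/= /val_inj/val_inj.
move/perp_null/(null_inj k_inj) => H; apply: iffLR _ (H _) => [|d].
  by apply: eq_null => e /=; rewrite (X'X e) // -YE.
rewrite bmul_neq0E => /andP[X'd _]; apply: contrapT => none.
case/eqP: X'd; apply: X'0 => e ed; apply: none; exists e.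
exact: val_inj.
Qed.

End DoubleMinors.

Section PointedSums.
Variable F : idyll.
Hypothesis F_perfect : perfect F.
Variables S T : finType.
Variables (M : set (seq (option S) -> F)) (N : set (seq (option T) -> F)).
Hypotheses (Mm : is_pmatroid M) (Nm : is_pmatroid N).

Lemma dsum_pm : is_pmatroid (dsum M N).
Proof.
have [r [mu Mmu]] := pmatroid_rep Mm; have [s [nu Nnu]] := pmatroid_rep Nm.
exact: rep_pmatroid (dsum_rep Mmu Nnu).
Qed.

Lemma pvec_dsum Z : pvectors (dsum M N) Z <->
  pvectors M (Z \o inl) /\ pvectors N (Z \o inr).
Proof.
have [r [mu Mmu]] := pmatroid_rep Mm; have [s [nu Nnu]] := pmatroid_rep Nm.
rewrite (propext (pvecP Z (dsum_rep Mmu Nnu))) (propext (pvecP _ Mmu)).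
by rewrite (propext (pvecP _ Nnu)); apply: vec_usum Mmu.1 Nnu.1.
Qed.

Definition sum_vec (X : S -> F) (Y : T -> F) (e : S + T) : F :=
  match e with inl i => X i | inr j => Y j end.

(** Vectors with one zero component suffice to test each component of Z. *)
Lemma pcov_dsum Z : pcovectors (dsum M N) Z <->
  pcovectors M (Z \o inl) /\ pcovectors N (Z \o inr).
Proof.
rewrite (propext (pcov_orth F_perfect Z dsum_pm)).
rewrite (propext (pcov_orth F_perfect _ Mm)) (propext (pcov_orth F_perfect _ Nm)).
split=> [ZP|[Zl Zr] W /pvec_dsum[Wl Wr]].
  split=> X XP.
    have /ZP/perp_null/(null_inj (@inl_inj S T)) H : pvectors (dsum M N) (sum_vec X (fun=> 0)).
      by apply/pvec_dsum; split=> //; apply: vectors0.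
    apply: H => -[j|j]; first by exists j.
    by rewrite /= bmul0 eqxx.
  have /ZP/perp_null/(null_inj (@inr_inj S T)) H : pvectors (dsum M N) (sum_vec (fun=> 0) X).
    by apply/pvec_dsum; split=> //; apply: vectors0.
  apply: H => -[j|j]; last by exists j.
  by rewrite /= bmul0 eqxx.
by apply: null_sum; [apply: (Zl _ Wl)|apply: (Zr _ Wr)].
Qed.

End PointedSums.

(** * Structural morphisms *)

Section WellFormed.
Variable F : idyll.
Hypothesis F_perfect : perfect F.
Implicit Types M N L : pmatroid F.

Lemma hom_pcov M N (f : ground N -> ground M -> F) Y :
  is_hom (pvectors M) (pvectors N) f -> pcovectors N Y ->
  pcovectors M (mx_act (mx_tr f) Y).
Proof.
move=> [fs fV] YN; apply/(pcov_orth F_perfect _ (pclassP M)) => X XM.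
apply/(perp_adjoint _ _ fs); exact: (pvec_pcov F_perfect (pclassP N) (fV X XM) YN).
Qed.

(** With [hom_pcov]: the morphisms are the submonomial matrices whose
    transpose preserves covectors. *)
Lemma hom_of_pcov M N (f : ground N -> ground M -> F) : submonomial f ->
  (forall Y, pcovectors N Y -> pcovectors M (mx_act (mx_tr f) Y)) ->
  is_hom (pvectors M) (pvectors N) f.
Proof.
move=> fs fV; split=> // X XM; apply/(pvec_orth F_perfect _ (pclassP N)) => Y /fV YN.
apply/(perp_adjoint _ _ fs); exact: (pvec_pcov F_perfect (pclassP M) XM YN).
Qed.

Lemma submonomial_block (S S' T T' : finType) (f : S' -> S -> F) (g : T' -> T -> F) :
  submonomial f -> submonomial g -> submonomial (mx_block f g).
Proof.
move=> [f_row f_col] [g_row g_col]; split.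
  move=> [j|j] [i|i] [i'|i'] //=; rewrite ?eqxx //.
    by move=> ji ji'; rewrite (f_row _ _ _ ji ji').
  by move=> ji ji'; rewrite (g_row _ _ _ ji ji').
move=> [i|i] [j|j] [j'|j'] //=; rewrite ?eqxx //.
  by move=> ji ji'; rewrite (f_col _ _ _ ji ji').
by move=> ji ji'; rewrite (g_col _ _ _ ji ji').
Qed.

Lemma mx_tr_block (S S' T T' : finType) (f : S' -> S -> F) (g : T' -> T -> F) :
  mx_tr (mx_block f g) = mx_block (mx_tr f) (mx_tr g).
Proof. by apply/funext => -[i|i]; apply/funext => -[j|j]. Qed.

Lemma mx_act_block (S S' T T' : finType) (f : S' -> S -> F) (g : T' -> T -> F) X :
  submonomial f -> submonomial g ->
  mx_act (mx_block f g) X = sum_vec (mx_act f (X \o inl)) (mx_act g (X \o inr)).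
Proof.
move=> fs gs; have bs := submonomial_block fs gs.
apply/funext => -[j|j] /=.
  have [[i ji]|none] := pselect (exists i, f j i != 0).
    rewrite (mx_actE _ fs ji).
    by rewrite (mx_actE _ bs (ji : mx_block f g (inl j) (inl i) != 0)).
  have f0 i : f j i = 0 by apply/eqP/negPn/negP => ji; apply: none; exists i.
  by rewrite !mx_act0 // => -[i|i] /=.
have [[i ji]|none] := pselect (exists i, g j i != 0).
  rewrite (mx_actE _ gs ji).
  by rewrite (mx_actE _ bs (ji : mx_block f g (inr j) (inr i) != 0)).
have g0 i : g j i = 0 by apply/eqP/negPn/negP => ji; apply: none; exists i.
by rewrite !mx_act0 // => -[i|i] /=.
Qed.

Lemma mx_act_bij (S T : finType) (h : S -> T) (k : T -> S) X :
  cancel h k -> cancel k h -> mx_act (mx_fun F h) X = X \o k.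
Proof.
move=> hK kK; apply/funext => j; rewrite -{1}[j]kK mx_act_fun //.
exact: can_inj hK.
Qed.

Lemma hom_fun M N (h : ground M -> ground N) (k : ground N -> ground M) :
  cancel h k -> cancel k h ->
  (forall X, pvectors M X -> pvectors N (X \o k)) ->
  is_hom (pvectors M) (pvectors N) (mx_fun F h).
Proof.
move=> hK kK MN; split=> [|X XM]; first exact/submonomial_fun/(can_inj hK).
by rewrite (mx_act_bij X hK kK); apply: MN.
Qed.

Definition sum_assocV (S T U : Type) (x : S + (T + U)) : (S + T) + U :=
  match x with
  | inl e => inl (inl e)
  | inr (inl e) => inl (inr e)
  | inr (inr e) => inr e
  end.

Lemma sum_assocK S T U : cancel (@sum_assoc S T U) (@sum_assocV S T U).
Proof. by case=> [[]|]. Qed.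
Lemma sum_assocVK S T U : cancel (@sum_assocV S T U) (@sum_assoc S T U).
Proof. by case=> [|[]]. Qed.
Lemma sum_swapK S T : cancel (@sum_swap S T) (@sum_swap T S).
Proof. by case. Qed.
Lemma sum_lunitK T : cancel (@sum_lunit T) inr.
Proof. by case. Qed.
Lemma sum_runitK T : cancel (@sum_runit T) inl.
Proof. by case. Qed.

Lemma pvec0 (X : void -> F) : pvectors (@zero_class F) X.
Proof. by apply: vectors0; case. Qed.

Lemma FMat_wfP : FMat_wf F.
Proof.
have pm M := pclassP M.
have dsum_pm2 M N := dsum_pm (pm M) (pm N).
have dsumP M N Z := pvec_dsum (pm M) (pm N) Z.
split.
- by move=> M A; apply: prestr_pmatroid.
- by move=> M A; apply: pcontr_pmatroid.
- by move=> M N; apply: dsum_pm.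
- by move=> M; apply: pdual_pmatroid.
- move=> M A; split=> [|X]; first exact/submonomial_fun/val_inj.
  by move/(pvec_restr F_perfect X (pm M)).
- move=> M A; split=> [|X XM]; first exact/submonomial_tr/submonomial_fun/val_inj.
  have -> : mx_act (mx_tr (mx_fun F (val : {x | x \notin A} -> ground M))) X = X \o val.
    by apply/funext => e; rewrite mx_act_tr_fun.
  exact: pvec_contr.
- move=> M M' N N' f g; have [fs fV] := hom_mxP f; have [gs gV] := hom_mxP g.
  split=> [|X /dsumP[Xl Xr]]; first exact: submonomial_block.
  by rewrite mx_act_block //; apply/dsumP; split; [apply: fV|apply: gV].
- move=> M N L; apply: (@hom_fun (PMatroid (dsum_pm (dsum_pm2 M N) (pm L)))
    (PMatroid (dsum_pm (pm M) (dsum_pm2 N L))) _ _ (@sum_assocK _ _ _) (@sum_assocVK _ _ _)).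
  move=> X /(pvec_dsum (dsum_pm2 M N) (pm L))[/dsumP[XM XN] XL].
  by apply/(pvec_dsum (pm M) (dsum_pm2 N L)); split=> //; apply/dsumP.
- move=> M; apply: (@hom_fun (PMatroid (dsum_pm2 (pmatroid0 F) M)) M _ _ (@sum_lunitK _)) => //.
  by move=> X /dsumP[].
- move=> M; apply: (@hom_fun M (PMatroid (dsum_pm2 (pmatroid0 F) M)) _ _ _ (@sum_lunitK _)) => //.
  by move=> X XM; apply/dsumP; split=> //; apply: pvec0.
- move=> M; apply: (@hom_fun (PMatroid (dsum_pm2 M (pmatroid0 F))) M _ _ (@sum_runitK _)) => //.
  by move=> X /dsumP[].
- move=> M; apply: (@hom_fun M (PMatroid (dsum_pm2 M (pmatroid0 F))) _ _ _ (@sum_runitK _)) => //.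
  by move=> X XM; apply/dsumP; split=> //; apply: pvec0.
- move=> M N; apply: (@hom_fun (PMatroid (dsum_pm2 M N)) (PMatroid (dsum_pm2 N M))
    _ _ (@sum_swapK _ _) (@sum_swapK _ _)).
  by move=> X /dsumP[XM XN]; apply/dsumP.
- move=> M N f; have [fs fV] := hom_mxP f; split=> [|Y]; first exact: submonomial_tr.
  by rewrite !pvectors_dual //; apply: hom_pcov.
move=> M; split=> [|X XM]; first exact: submonomial_id.
by rewrite mx_act1 pvectors_dual ?pcovectors_dual //; apply: pdual_pmatroid.
Qed.

End WellFormed.

(** * Admissible monomorphisms and epimorphisms *)

Section MatrixInverse.
Variable F : idyll.
Implicit Types S T U : finType.

Definition colnz S T (f : T -> S -> F) := forall i, exists j, f j i != 0.
Definition rownz S T (f : T -> S -> F) := forall j, exists i, f j i != 0.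

Lemma mx_pinv_mul S T (f : T -> S -> F) : submonomial f -> colnz f ->
  mx_mul (mx_pinv f) f = mx_fun F id.
Proof.
move=> fs fc; apply/funext => k; apply/funext => i.
have <- := congr1 (fun X => X k) (mx_pinvK (fun j => mx_fun F id j i) fs fc).
rewrite mx_mul_act; congr (mx_act _ _ k); apply/funext => j.
by have <- := congr1 (fun m => m j i) (mx_mulm1 f).
Qed.

Lemma mx_mul_pinv S T (f : T -> S -> F) : submonomial f -> rownz f ->
  mx_mul f (mx_pinv f) = mx_fun F id.
Proof.
move=> fs fr; have := mx_pinv_mul (submonomial_tr fs) fr.
move=> /(congr1 (@mx_tr F _ _)); rewrite mx_tr_mul mx_tr_id => <-.
by [].
Qed.

Lemma mx_mul_neq0 S T U (g : U -> T -> F) (f : T -> S -> F) k i :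
  mx_mul g f k i != 0 -> exists2 j, g k j != 0 & f j i != 0.
Proof. by rewrite mx_mul_act => /mx_act_neq0. Qed.

Lemma mx_mulE S T U (g : U -> T -> F) (f : T -> S -> F) k j i :
  submonomial g -> g k j != 0 -> mx_mul g f k i = g k j * f j i.
Proof. by move=> gs kj; rewrite mx_mul_act (mx_actE _ gs kj). Qed.

Lemma colnz_mul S T U (g : U -> T -> F) (f : T -> S -> F) : submonomial g ->
  colnz g -> colnz f -> colnz (mx_mul g f).
Proof.
move=> gs gc fc i; have [j ji] := fc i; have [k kj] := gc j.
by exists k; rewrite (mx_mulE _ _ gs kj) bmul_neq0E kj.
Qed.

Lemma rownz_mul S T U (g : U -> T -> F) (f : T -> S -> F) : submonomial g ->
  rownz g -> rownz f -> rownz (mx_mul g f).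
Proof.
move=> gs gr fr k; have [j kj] := gr k; have [i ji] := fr j.
by exists i; rewrite (mx_mulE _ _ gs kj) bmul_neq0E kj.
Qed.

(** [mx_pinv] inverts i on its image, which contains the values of h. *)
Lemma mx_factor S T U (i : T -> S -> F) (h : T -> U -> F) : submonomial i ->
  (forall e u, h e u != 0 -> exists a, i e a != 0) ->
  mx_mul i (mx_mul (mx_pinv i) h) = h.
Proof.
move=> is_ hi; apply/funext => e; apply/funext => u.
rewrite mx_mul_act; have := mx_actVK (Y := fun e => h e u) is_.
by move=> /(_ (fun j => hi j u))/(congr1 (fun X => X e)).
Qed.

Lemma mx_cancel S T U (i : T -> S -> F) (u v : S -> U -> F) :
  submonomial i -> colnz i -> mx_mul i u = mx_mul i v -> u = v.
Proof.
move=> is_ ic uv; apply/funext => a; apply/funext => x.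
have [e ea] := ic a; have := congr1 (fun m => m e x) uv.
by rewrite !(mx_mulE _ _ is_ ea) => /(bmulI ea).
Qed.

End MatrixInverse.

Section Morphisms.
Variable F : idyll.
Hypothesis F_perfect : perfect F.
Variable w : FMat_wf F.
Implicit Types M N L : pmatroid F.

Lemma phom_sub M N (f : phom M N) : submonomial f.
Proof. by case: (hom_mxP f). Qed.

Lemma phom_vec M N (f : phom M N) X : pvectors M X -> pvectors N (mx_act f X).
Proof. by case: (hom_mxP f) => _; apply. Qed.

Lemma phom_cov M N (f : phom M N) Y : pcovectors N Y -> pcovectors M (mx_act (mx_tr f) Y).
Proof. exact: (hom_pcov F_perfect (hom_mxP f)). Qed.

(** By [monoP] these are the admissible monomorphisms. *)
Definition mono_mx M N (f : phom M N) : Prop :=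
  colnz f /\ forall X, pvectors N (mx_act f X) -> pvectors M X.

(** By [epiP] these are the admissible epimorphisms. The condition is the one
    of [mono_mx] for the transpose and for covectors. *)
Definition epi_mx M N (f : phom M N) : Prop :=
  rownz f /\ forall Y, pcovectors M (mx_act (mx_tr f) Y) -> pcovectors N Y.

Lemma isoP M N (f : phom M N) : @is_iso (FMat_cat F) M N f <->
  [/\ colnz f, rownz f & forall X, pvectors N (mx_act f X) -> pvectors M X].
Proof.
have fs := phom_sub f; split.
  move=> [g [/(congr1 (@hom_mx F _ _))/= gf /(congr1 (@hom_mx F _ _))/= fg]].
  split=> [i|j|X /(phom_vec g)].
  - have : mx_mul g f i i != 0 by rewrite gf mx_fun1 bone_neq0.
    by move=> /mx_mul_neq0[j _ ji]; exists j.
  - have : mx_mul f g j j != 0 by rewrite fg mx_fun1 bone_neq0.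
    by move=> /mx_mul_neq0[i ji _]; exists i.
  by rewrite -(mx_act_mul _ (phom_sub g) fs) gf mx_act1.
move=> [fc fr fV]; have gs := submonomial_pinv fs.
have gP : is_hom (pvectors N) (pvectors M) (mx_pinv f).
  split=> // Y YN; apply: fV; rewrite -(mx_act_mul _ fs gs).
  by rewrite (mx_mul_pinv fs fr) mx_act1.
exists (PHom gP); split; apply: phom_ext; first exact: mx_pinv_mul.
exact: mx_mul_pinv.
Qed.

(** Since f has no zero column, every covector Y of M is the image of some Y'
    under the transpose of f. By assumption Y' is a covector of N, and
    orthogonality of f X to all such Y' means orthogonality of X to all Y. *)
Lemma iso_covP M N (f : phom M N) : colnz f -> rownz f ->
  (forall Y, pcovectors M (mx_act (mx_tr f) Y) -> pcovectors N Y) ->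
  @is_iso (FMat_cat F) M N f.
Proof.
have fs := phom_sub f; have fts := submonomial_tr fs.
move=> fc fr fV; apply/isoP; split=> // X XN.
apply/(pvec_orth F_perfect _ (pclassP M)) => Y YM.
pose Y' := mx_act (mx_pinv (mx_tr f)) Y.
have YE : mx_act (mx_tr f) Y' = Y by apply: mx_actVK => // j _; apply: fc.
rewrite -YE; apply/(perp_adjoint _ _ fs)/(pvec_pcov F_perfect (pclassP N) XN).
by apply: fV; rewrite YE.
Qed.

Lemma iso_mono M N (f : phom M N) : @is_iso (FMat_cat F) M N f -> mono_mx f.
Proof. by move=> /isoP[fc _ fV]. Qed.

Lemma iso_epi M N (f : phom M N) : @is_iso (FMat_cat F) M N f -> epi_mx f.
Proof.
move=> fi; have /isoP[_ fr _] := fi; split=> // Y YM.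
case: fi => g [_ /(congr1 (@hom_mx F _ _))/= fg].
have := phom_cov g YM; rewrite -mx_act_mul; [|exact/submonomial_tr/phom_sub..].
by rewrite -mx_tr_mul fg mx_tr_id mx_act1.
Qed.

Lemma mono_comp M N L (g : phom N L) (f : phom M N) :
  mono_mx g -> mono_mx f -> mono_mx (phom_comp g f).
Proof.
move=> [gc gV] [fc fV]; split=> [|X]; first exact: colnz_mul (phom_sub g) gc fc.
by rewrite /= mx_act_mul; [move=> /gV/fV|apply: phom_sub..].
Qed.

Lemma epi_comp M N L (g : phom N L) (f : phom M N) :
  epi_mx g -> epi_mx f -> epi_mx (phom_comp g f).
Proof.
move=> [gr gV] [fr fV]; split=> [|Y]; first exact: rownz_mul (phom_sub g) gr fr.
by rewrite /= mx_tr_mul mx_act_mul; [move=> /fV/gV|apply/submonomial_tr/phom_sub..].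
Qed.

Lemma restr_mor_mono M (A : {set ground M}) : mono_mx (restr_mor w A).
Proof.
split=> [i|X]; last by move/(pvec_restr F_perfect _ (pclassP M)).
by exists (val i); rewrite /= mx_fun1 bone_neq0.
Qed.

Lemma contr_mor_epi M (A : {set ground M}) : epi_mx (contr_mor w A).
Proof.
split=> [i|Y]; last by move/(pcov_contr F_perfect _ (pclassP M)).
by exists (val i); rewrite /= /mx_tr mx_fun1 bone_neq0.
Qed.

(** By [pvec_restr] a restriction is characterized by reflecting vectors, so
    f identifies M with the restriction of N to the non-zero rows of f. *)
Lemma monoP M N (f : phom M N) : FMat_mono w (f : @hom (FMat_cat F) M N) <-> mono_mx f.
Proof.
split=> [[A [al [al_iso ->]]]|[fc fV]].
  exact: mono_comp (restr_mor_mono A) (iso_mono al_iso).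
have fs := phom_sub f.
pose A : {set ground N} := [set j | `[< exists i, f j i != 0 >]]%SET.
pose al (j : {j | j \in A}) i := f (val j) i.
have al_s : submonomial al.
  case: fs => f_row f_col; split=> [j i i'|i j j' ji j'i]; first exact: f_row.
  by apply: val_inj; apply: f_col ji j'i.
have alE : mx_mul (mx_fun F (val : {j | j \in A} -> _)) al = f.
  apply/funext => j; apply/funext => i; have [jA|jA] := boolP (j \in A).
    rewrite -[j]/(val (exist (fun j => j \in A) j jA)) mx_mul_funl //; exact: val_inj.
  rewrite mx_mul_act mx_act_fun0 => [|[b bA] /= jb]; last by rewrite jb bA in jA.
  apply/esym/eqP/negPn/negP => ji; move/negP: jA; apply; rewrite inE.
  by apply/asboolP; exists i.
have alP : is_hom (pvectors M) (pvectors (restr_ob w A)) al.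
  split=> // X XM; apply/(pvec_restr F_perfect _ (pclassP N)).
  rewrite -mx_act_mul ?alE //; first exact: phom_vec.
  exact/submonomial_fun/val_inj.
exists A, (PHom alP); split; last by apply: phom_ext; rewrite /= alE.
apply/isoP; split=> /= [i|[j jA]|X].
- have [j ji] := fc i; have jA : j \in A by rewrite inE; apply/asboolP; exists i.
  by exists (exist _ j jA).
- by have /asboolP : `[< exists i, f j i != 0 >] by have := jA; rewrite inE.
move/(pvec_restr F_perfect _ (pclassP N)); rewrite -mx_act_mul ?alE //; first exact: fV.
exact/submonomial_fun/val_inj.
Qed.

(** By [pcov_contr] a contraction is characterized by reflecting covectors,
    so f identifies N with the contraction of M by the zero columns of f. *)
Lemma epiP M N (f : phom M N) : FMat_epi w (f : @hom (FMat_cat F) M N) <-> epi_mx f.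
Proof.
split=> [[A [be [be_iso ->]]]|[fr fV]].
  exact: epi_comp (iso_epi be_iso) (contr_mor_epi A).
have fs := phom_sub f.
pose B : {set ground M} := [set i | ~~ `[< exists j, f j i != 0 >]]%SET.
pose be j (i : {i | i \notin B}) := f j (val i).
have be_s : submonomial be.
  case: fs => f_row f_col; split=> [j i i' ji ji'|i j j' ji j'i].
    apply: val_inj; exact: (f_row _ _ _ ji ji').
  exact: (f_col _ _ _ ji j'i).
have beE : mx_mul be (mx_tr (mx_fun F (val : {i | i \notin B} -> _))) = f.
  apply/funext => j; apply/funext => i; rewrite /mx_mul.
  have [iB|iB] := boolP (i \notin B).
    rewrite (@sum1_unique _ _ _ (exist _ i iB)) => [|k].
      by rewrite /mx_tr /mx_fun eqxx bmulr1.
    by rewrite bmul_neq0E => /andP[_ /mx_fun_neq0 ik]; apply: val_inj.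
  rewrite sum1_0 => [|k].
    apply/esym/eqP/negPn/negP => ji; move/negP: iB; apply; rewrite inE negbK.
    by apply/asboolP; exists j.
  apply/eqP/negPn/negP; rewrite bmul_neq0E => /andP[_ /mx_fun_neq0 ik].
  by move/negP: iB; apply; rewrite ik; exact: (valP k).
have tv_s : submonomial (mx_tr (mx_fun F (val : {i | i \notin B} -> ground M))).
  exact/submonomial_tr/submonomial_fun/val_inj.
have ext_be Y : mx_act (mx_fun F val) (mx_act (mx_tr be) Y) = mx_act (mx_tr f) Y.
  rewrite -[in RHS]beE mx_tr_mul mx_act_mul //; exact: submonomial_tr.
have beP : is_hom (pvectors (contr_ob w B)) (pvectors N) be.
  apply: hom_of_pcov => // Y YN; apply/(pcov_contr F_perfect _ (pclassP M)).
  by rewrite ext_be; apply: phom_cov.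
exists B, (PHom beP); split; last by apply: phom_ext; rewrite /= beE.
apply: iso_covP => /= [[i iB]|j|Y].
- by have /asboolP : `[< exists j, f j i != 0 >] by have := iB; rewrite inE negbK.
- have [i ji] := fr j; have iB : i \notin B by rewrite inE negbK; apply/asboolP; exists j.
  by exists (exist _ i iB).
by move/(pcov_contr F_perfect _ (pclassP M)); rewrite ext_be; apply: fV.
Qed.

End Morphisms.

(** * Bicartesian squares *)

Section Squares.
Variable F : idyll.
Hypothesis F_perfect : perfect F.
Variable w : FMat_wf F.
Local Notation C := (FMat_cat F).
Local Notation pm M := (pclassP M).

Lemma phom_eq (M N : pmatroid F) (f g : phom M N) :
  f = g -> hom_mx f = hom_mx g.
Proof. by move=> ->. Qed.

Lemma zero_hom (M N : pmatroid F) :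
  is_hom (pvectors M) (pvectors N) (fun _ _ => 0).
Proof.
split=> [|X _]; first by split=> ? ? ?; rewrite eqxx.
by apply: vectors0 => e; apply: mx_act0.
Qed.

Definition zero_mor (M N : pmatroid F) : phom M N := PHom (zero_hom M N).

Lemma mx_mul0 (S T U : finType) (g : U -> T -> F) :
  mx_mul g (fun (_ : T) (_ : S) => 0) = fun _ _ => 0.
Proof. by apply/funext => k; apply/funext => i; apply: sum1_0 => j; rewrite bmulr0. Qed.

Lemma mul0mx (S T U : finType) (f : T -> S -> F) :
  mx_mul (fun (_ : U) (_ : T) => 0) f = fun _ _ => 0.
Proof. by apply/funext => k; apply/funext => i; apply: sum1_0 => j; rewrite bmul0. Qed.

Section OneSquare.
Variables (M N M' N' : pmatroid F).
Variables (i : phom M N) (q : phom M M') (p : phom N N') (j : phom M' N').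

(** For squares of admissible morphisms this turns out to be equivalent to
    being Cartesian as well as to being co-Cartesian. *)
Definition kernel_covered : Prop :=
  forall e, (forall e', p e' e = 0) -> exists a, i e a != 0.

Hypotheses (i_mono : mono_mx i) (q_epi : epi_mx q) (p_epi : epi_mx p)
  (j_mono : mono_mx j).

(** A value of h that is killed by p is in the image of i by assumption. Any
    other one is sent by p into the image of j, on which q is onto, so it is
    in the image of i too. Hence h factors through i as a matrix, and the
    factor is a morphism since i reflects vectors. *)
Lemma kernel_covered_cartesian : phom_comp p i = phom_comp j q ->
  kernel_covered -> @cartesian C M N M' N' i q p j.
Proof.
move=> sq crit; split=> // W h k /phom_eq /= hk.
have [ic iV] := i_mono; have [jc _] := j_mono.
have is_ := phom_sub i; have js := phom_sub j; have ps := phom_sub p.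
have hs := phom_sub h.
have fac : mx_mul i (mx_mul (mx_pinv i) h) = h.
  apply: mx_factor => // e u eu; apply: contrapT => none; apply: (none).
  apply: crit => e'; apply/eqP/negPn/negP => e'e.
  have : mx_mul p h e' u != 0 by rewrite (mx_mulE _ _ ps e'e) bmul_neq0E e'e.
  rewrite hk => /mx_mul_neq0[b e'b _]; have [a ba] : exists a, q b a != 0.
    by case: q_epi.
  have : mx_mul p i e' a != 0.
    have /phom_eq/= -> := sq; by rewrite (mx_mulE _ _ js e'b) bmul_neq0E e'b.
  rewrite (mx_mulE _ _ ps e'e) bmul_neq0E e'e /= => ea.
  by apply: none; exists a.
have us : submonomial (mx_mul (mx_pinv i) h).
  exact: submonomial_mul (submonomial_pinv is_) hs.
have uP : is_hom (pvectors W) (pvectors M) (mx_mul (mx_pinv i) h).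
  by split=> // X XW; apply: iV; rewrite -mx_act_mul // fac; apply: phom_vec.
exists (PHom uP); split; first split.
- by apply: phom_ext.
- apply: phom_ext; apply: (mx_cancel js jc) => /=.
  have /phom_eq/= sq' := sq.
  rewrite (mx_mulA js (phom_sub q) us) -sq' -(mx_mulA ps is_ us) fac.
  exact: hk.
move=> v [/phom_eq/= iv _]; apply: phom_ext; apply: (mx_cancel is_ ic).
by rewrite /= fac iv.
Qed.

(** If p kills e, then p is zero on N|{e}, whose inclusion into N therefore
    factors through i. *)
Lemma cartesian_kernel_covered : @cartesian C M N M' N' i q p j -> kernel_covered.
Proof.
(* The cone consists of the inclusion of N|{e} and of the zero morphism. *)
move=> [_ cart] e pe; pose h := restr_mor w (M := N) [set e]%SET.
have hk : (p : @hom C N N') \oc h = (j : @hom C M' N') \oc zero_mor _ M'.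
  apply: phom_ext; rewrite /= mx_mul0.
  apply/funext => e'; apply/funext => -[x xe]; rewrite mx_mul_funr /=.
  by move: xe (xe); rewrite {1}inE => /eqP->.
have [u [[/phom_eq/= iu _] _]] := cart _ h _ hk.
have e1 : e \in [set e]%SET by rewrite inE.
have : mx_mul i u e (exist _ e e1) != 0 by rewrite iu /mx_fun /= eqxx bone_neq0.
by move=> /mx_mul_neq0[a ea _]; exists a.
Qed.

(** The transposed argument: h vanishes where p does, so h factors through p
    as a matrix, and the factor is a morphism since the transpose of p
    reflects covectors. *)
Lemma kernel_covered_cocartesian : phom_comp p i = phom_comp j q ->
  kernel_covered -> @cocartesian C M N M' N' i q p j.
Proof.
move=> sq crit; split=> // W h k /phom_eq /= hk.
have [jc _] := j_mono; have [qr _] := q_epi; have [pr pV] := p_epi.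
have is_ := phom_sub i; have js := phom_sub j; have ps := phom_sub p.
have hs := phom_sub h; have qs := phom_sub q; have ks := phom_sub k.
have pts := submonomial_tr ps; have hts := submonomial_tr hs.
have ker e : (forall e', p e' e = 0) -> forall x, h x e = 0.
  move=> pe x; apply/eqP/negPn/negP => xe.
  have [a ea] := crit e pe.
  have : mx_mul h i x a != 0 by rewrite (mx_mulE _ _ hs xe) bmul_neq0E xe.
  rewrite hk => /mx_mul_neq0[b _ ba]; have [e' e'b] := jc b.
  have /phom_eq/= sq' := sq; have : mx_mul j q e' a != 0.
    by rewrite (mx_mulE _ _ js e'b) bmul_neq0E e'b.
  rewrite -sq' => /mx_mul_neq0[e2 e'e2 e2a].
  have [_ i_col] := is_; rewrite (i_col _ _ _ e2a ea) in e'e2.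
  by rewrite pe eqxx in e'e2.
pose u := mx_mul h (mx_pinv p).
have us : submonomial u by exact: submonomial_mul hs (submonomial_pinv ps).
have fac : mx_mul u p = h.
  have := mx_factor (h := mx_tr h) pts; move=> H.
  have {}H : mx_mul (mx_tr p) (mx_mul (mx_pinv (mx_tr p)) (mx_tr h)) = mx_tr h.
    apply: H => e x ex; apply: contrapT => none.
    have /ker/(_ x) : forall e', p e' e = 0.
      by move=> e'; apply/eqP/negPn/negP => e'e; apply: none; exists e'.
    by move=> xe; rewrite /mx_tr xe eqxx in ex.
  by move/(congr1 (@mx_tr F _ _)): H; rewrite !mx_tr_mul.
have uP : is_hom (pvectors N') (pvectors W) u.
  apply: hom_of_pcov => // Y YW; apply: pV.
  rewrite -mx_act_mul //; last exact: submonomial_tr.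
  by rewrite -mx_tr_mul fac; apply: phom_cov.
have cancel_epi (S T U : finType) (f : T -> S -> F) (a b : U -> T -> F) :
    submonomial f -> rownz f -> mx_mul a f = mx_mul b f -> a = b.
  move=> fs fr /(congr1 (@mx_tr F _ _)); rewrite !mx_tr_mul.
  move=> /(mx_cancel (submonomial_tr fs) fr).
  by move=> /(congr1 (@mx_tr F _ _)).
exists (PHom uP); split; first split.
- by apply: phom_ext.
- apply: phom_ext; apply: (cancel_epi _ _ _ _ _ _ qs qr) => /=.
  have /phom_eq/= sq' := sq.
  by rewrite -(mx_mulA us js qs) -sq' (mx_mulA us ps is_) fac.
move=> v [/phom_eq/= vp _]; apply: phom_ext; apply: (cancel_epi _ _ _ _ _ _ ps pr).
by rewrite /= fac vp.
Qed.

(** If i misses e, then the contraction of N onto {e} is zero on M, so it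
    factors through p, which cannot kill e. *)
Lemma cocartesian_kernel_covered : @cocartesian C M N M' N' i q p j -> kernel_covered.
Proof.
move=> [_ cocart] e pe; apply: contrapT => none.
(* The cocone consists of the contraction onto {e} and of the zero morphism. *)
pose h := contr_mor w (M := N) (~: [set e])%SET.
have hk : h \oc (i : @hom C M N) = (zero_mor M' _ : @hom C _ _) \oc (q : @hom C M M').
  apply: phom_ext; rewrite /= mul0mx.
  apply/funext => x; apply/funext => a; apply/eqP/negPn/negP.
  move=> /mx_mul_neq0[e' /mx_fun_neq0 -> e'a]; apply: none; exists a.
  by move: (valP x) e'a; rewrite !inE negbK => /eqP->.
have [u [[/phom_eq/= up _] _]] := cocart _ h _ hk.
have e1 : e \notin (~: [set e])%SET by rewrite !inE negbK.
have : mx_mul u p (exist _ e e1) e != 0 by rewrite up /mx_tr /mx_fun /= eqxx bone_neq0.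
by move=> /mx_mul_neq0[e' _]; rewrite pe eqxx.
Qed.

End OneSquare.

End Squares.

(** * The proto-exact structure *)

Section ProtoExact.
Variable F : idyll.
Hypothesis F_perfect : perfect F.
Variable w : FMat_wf F.
Local Notation C := (FMat_cat F).
Local Notation pm M := (pclassP M).
Implicit Types M N L : pmatroid F.

Lemma pcov0 (Y : void -> F) : pcovectors (@zero_class F) Y.
Proof.
apply/(pcov_orth F_perfect _ (zero_classP F)) => X _.
by apply: null0; case.
Qed.

Lemma void_phoml M (f g : phom (pmatroid0 F) M) : f = g.
Proof. by apply: phom_ext; apply/funext => j; apply/funext => -[]. Qed.

Lemma void_phomr M (f g : phom M (pmatroid0 F)) : f = g.
Proof. by apply: phom_ext; apply/funext => -[]. Qed.

Lemma FMat_zero_object : zero_object (FMat w).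
Proof. by move=> M; split=> f; [apply: void_phoml|apply: void_phomr]. Qed.

Lemma FMat_PE1 : PE1 (FMat w).
Proof.
move=> M; split.
  by apply/(monoP F_perfect); split=> [[]//|X _]; apply: pvec0.
by apply/(epiP F_perfect); split=> [[]//|Y _]; apply: pcov0.
Qed.

Lemma FMat_PE2 : PE2 (FMat w).
Proof.
split=> [M N L g f|M N f f_iso]; split.
- move=> /(monoP F_perfect) gm /(monoP F_perfect) fm; apply/(monoP F_perfect).
  exact: mono_comp.
- move=> /(epiP F_perfect) gm /(epiP F_perfect) fm; apply/(epiP F_perfect).
  exact: epi_comp.
- exact/(monoP F_perfect)/iso_mono.
exact/(epiP F_perfect)/iso_epi.
Qed.

Lemma pe_squareP M N M' N' (i : phom M N) (q : phom M M') (p : phom N N') (j : phom M' N') :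
  @pe_square (FMat w) M N M' N' i q p j <->
  [/\ mono_mx i, epi_mx q, epi_mx p & mono_mx j].
Proof.
have [mi mj] := (monoP F_perfect w i, monoP F_perfect w j).
have [eq ep] := (epiP F_perfect w q, epiP F_perfect w p).
by split=> -[/mi ? /eq ? /ep ? /mj ?].
Qed.

Lemma bicartesianP M N M' N' (i : phom M N) (q : phom M M') (p : phom N N') (j : phom M' N') :
  @pe_square (FMat w) M N M' N' i q p j ->
  @bicartesian C M N M' N' i q p j <->
  phom_comp p i = phom_comp j q /\ kernel_covered i p.
Proof.
move=> /pe_squareP[im qe pe jm]; split=> [[cart _]|[sq crit]].
  split; first by case: cart.
  exact: (cartesian_kernel_covered w cart).
split; first exact: (kernel_covered_cartesian im qe jm sq crit).
exact: (kernel_covered_cocartesian F_perfect qe pe jm sq crit).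
Qed.

Lemma FMat_PE3 : PE3 (FMat w).
Proof.
move=> M N M' N' i q p j /pe_squareP[im qe pe jm] sq; split=> [cart|cocart].
  apply: (kernel_covered_cocartesian F_perfect qe pe jm sq).
  exact: (cartesian_kernel_covered w cart).
apply: (kernel_covered_cartesian im qe jm sq).
exact: (cocartesian_kernel_covered w cocart).
Qed.

Lemma iso_inv M N (f : @hom C M N) : is_iso f -> exists2 g : @hom C N M,
  is_iso g & inverse_pair f g.
Proof. by move=> [g [gf fg]]; exists g => //; exists f. Qed.

Section Matching.
Variables (S T : finType) (R : T -> S -> bool).

(** Used for relations that are partial bijections between ground sets of
    iterated minors, which are subtypes of subtypes. *)
Definition mx_rel : T -> S -> F := fun j i => if R j i then 1 else 0.

Lemma mx_rel_neq0 j i : (mx_rel j i != 0) = R j i.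
Proof. by rewrite /mx_rel; case: (R j i); rewrite ?bone_neq0 ?eqxx. Qed.

Hypothesis mx_rel_sub : submonomial mx_rel.

Lemma mx_act_rel X j i : R j i -> mx_act mx_rel X j = X i.
Proof.
move=> ji; have ji0 : mx_rel j i != 0 by rewrite mx_rel_neq0.
by rewrite (mx_actE X mx_rel_sub ji0) /mx_rel ji bmul1.
Qed.

Lemma mx_act_rel0 X j : (forall i, ~~ R j i) -> mx_act mx_rel X j = 0.
Proof. by move=> Rj; apply: mx_act0 => i; rewrite /mx_rel (negPf (Rj i)). Qed.

Lemma mx_act_tr_rel Y j i : R j i -> mx_act (mx_tr mx_rel) Y i = Y j.
Proof.
move=> ji; have ji0 : mx_tr mx_rel i j != 0 by rewrite /mx_tr mx_rel_neq0.
by rewrite (mx_actE Y (submonomial_tr mx_rel_sub) ji0) /mx_tr /mx_rel ji bmul1.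
Qed.

Lemma mx_act_tr_rel0 Y i : (forall j, ~~ R j i) -> mx_act (mx_tr mx_rel) Y i = 0.
Proof. by move=> Ri; apply: mx_act0 => j; rewrite /mx_tr /mx_rel (negPf (Ri j)). Qed.

End Matching.

(** With D the union of Cs and A, (N|D)/Cs and (N/Cs)|A coincide; that the
    covectors agree is [pcov_restr_contr]. *)
Lemma contr_restr_square N (Cs : {set ground N}) (A : {set ground (contr_ob w Cs)}) :
  exists (D : {set ground N}) (q : phom (restr_ob w D) (restr_ob w A)),
  [/\ epi_mx q, Cs \subset D &
   phom_comp (contr_mor w Cs) (restr_mor w D) = phom_comp (restr_mor w A) q].
Proof.
pose D : {set ground N} := [set e | (e \in Cs) || (e \in [set val a | a in A])]%SET.
pose R (a : {a | a \in A}) (d : {d | d \in D}) := val (val a) == val d.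
have q_sub : submonomial (mx_rel R).
  split=> [a d d'|d a a']; rewrite !mx_rel_neq0 => /eqP aE /eqP a'E.
    by apply: val_inj; rewrite -aE.
  by do 2!apply: val_inj; rewrite aE.
have AD (a : {a | a \in A}) : val (val a) \in D.
  by rewrite inE; apply/orP; right; apply/imset_f/valP.
have sq : mx_mul (mx_tr (mx_fun F val)) (mx_fun F val) =
          mx_mul (mx_fun F val) (mx_rel R)
        :> ({x | x \notin Cs} -> {d | d \in D} -> F).
  apply/funext => x; apply/funext => d.
  have -> : mx_mul (mx_tr (mx_fun F val)) (mx_fun F val) x d = mx_fun F val (val x) d.
    by rewrite mx_mul_funr /mx_tr /mx_fun eq_sym.
  have [xA|xA] := boolP (x \in A).
    rewrite -[x in RHS]/(val (exist (fun x => x \in A) x xA)) mx_mul_funl //; last exact: val_inj.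
  rewrite mx_mul_act mx_act_fun0 => [|[a aA] /= xa]; last by rewrite xa aA in xA.
  apply/eqP/negPn/negP => /mx_fun_neq0 xd; move/negP: xA; apply.
  have := valP d; rewrite inE -xd (negPf (valP x)) => /imsetP[a aA].
  by move=> /val_inj->.
have q_hom : is_hom (pvectors (restr_ob w D)) (pvectors (restr_ob w A)) (mx_rel R).
  split=> // X XD; apply/(pvec_restr F_perfect _ (pm (contr_ob w Cs))).
  rewrite -mx_act_mul //; last exact/submonomial_fun/val_inj.
  rewrite -sq mx_act_mul; first last.
  - exact/submonomial_fun/val_inj.
  - exact/submonomial_tr/submonomial_fun/val_inj.
  exact: (phom_vec (contr_mor w Cs) (phom_vec (restr_mor w D) XD)).
exists D, (PHom q_hom); split; last exact: phom_ext.
  split=> /= [a|Y].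
    by exists (exist (fun d => d \in D) _ (AD a)); rewrite mx_rel_neq0 /R.
  apply: (pcov_restr_contr F_perfect (pm N)) => // [e eC|a d ad|d none].
  - by rewrite inE eC.
  - by apply: mx_act_tr_rel => //; apply/eqP.
  by apply: mx_act_tr_rel0 => a; apply/eqP/none.
by apply/fintype.subsetP => e eC; rewrite inE eC.
Qed.

(** (N|A)/B and (N/B)|(A - B) coincide; that the vectors agree is
    [pvec_contr_restr]. *)
Lemma restr_contr_square N (A : {set ground N}) (B : {set ground (restr_ob w A)}) :
  exists (B' : {set ground N}) (j : phom (contr_ob w B) (contr_ob w B')),
  [/\ mono_mx j, B' \subset A &
   phom_comp (contr_mor w B') (restr_mor w A) = phom_comp j (contr_mor w B)].
Proof.
pose B' : {set ground N} := [set val b | b in B]%SET.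
pose R (e : {e | e \notin B'}) (b : {b | b \notin B}) := val (val b) == val e.
have j_sub : submonomial (mx_rel R).
  split=> [e b b'|b e e']; rewrite !mx_rel_neq0 => /eqP eE /eqP e'E.
    by do 2!apply: val_inj; rewrite eE.
  by apply: val_inj; rewrite -eE.
have BB' (b : {b | b \notin B}) : val (val b) \notin B'.
  by apply/imsetP => -[b' b'B /val_inj bb']; have := valP b; rewrite bb' b'B.
have sq : mx_mul (mx_tr (mx_fun F val)) (mx_fun F val) =
          mx_mul (mx_rel R) (mx_tr (mx_fun F val))
        :> ({e | e \notin B'} -> {x | x \in A} -> F).
  apply/funext => e; apply/funext => x.
  have -> : mx_mul (mx_tr (mx_fun F val)) (mx_fun F val) e x = mx_fun F val (val e) x.
    by rewrite mx_mul_funr /mx_tr /mx_fun eq_sym.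
  have [xB|xB] := boolP (x \notin B).
    rewrite /mx_mul (@sum1_unique _ _ _ (exist _ x xB)) => [|b].
      by rewrite /mx_tr /mx_rel /mx_fun /R /= eqxx bmulr1 eq_sym.
    by rewrite bmul_neq0E => /andP[_ /mx_fun_neq0 xb]; apply: val_inj.
  rewrite /mx_mul sum1_0 => [|b].
    apply/eqP/negPn/negP => /mx_fun_neq0 ex; move: (valP e); rewrite ex.
    by rewrite imset_f // -[_ \in B]negbK.
  apply/eqP/negPn/negP; rewrite bmul_neq0E => /andP[_ /mx_fun_neq0 xb].
  by move/negP: xB; apply; rewrite xb; exact: (valP b).
have trB : submonomial (mx_tr (mx_fun F (val : {b | b \notin B} -> {x | x \in A}))).
  exact/submonomial_tr/submonomial_fun/val_inj.
have j_hom : is_hom (pvectors (contr_ob w B)) (pvectors (contr_ob w B')) (mx_rel R).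
  apply: (hom_of_pcov F_perfect) => // Y YB.
  apply/(pcov_contr F_perfect _ (pm (restr_ob w A))).
  rewrite -[mx_fun F val]/(mx_tr (mx_tr (mx_fun F val))) -mx_act_mul; first last.
  - exact: submonomial_tr.
  - exact: submonomial_tr trB.
  rewrite -mx_tr_mul -sq.
  exact: (phom_cov F_perfect (phom_comp (contr_mor w B') (restr_mor w A)) YB).
exists B', (PHom j_hom); split; last exact: phom_ext.
  split=> /= [b|X].
    by exists (exist (fun e => e \notin B') _ (BB' b)); rewrite mx_rel_neq0 /R.
  apply: (pvec_contr_restr F_perfect (pm N)) => // [e /imsetP[b bB ->]|b e be|e none].
  - by exists b.
  - by apply: mx_act_rel => //; apply/eqP.
  by apply: mx_act_rel0 => b; apply/eqP/none.
by apply/fintype.subsetP => _ /imsetP[b _ ->]; apply: valP.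
Qed.

(** Up to isomorphism N' = N/Cs and M' = (N/Cs)|A. *)
Lemma FMat_PE4 : PE4 (FMat w).
Proof.
move=> N M' N' p j [Cs [be [be_iso pE]]] /(monoP F_perfect) jm.
have [be' be'_iso [bK Kb]] := iso_inv be_iso.
have /(monoP F_perfect w)[A [al [al_iso alE]]] :
  mono_mx (phom_comp be' j) by apply: mono_comp jm; apply: iso_mono.
have [al' al'_iso [aK Ka]] := iso_inv al_iso.
have [D [q0 [q0e CD sq]]] := contr_restr_square A.
pose q : @hom C (restr_ob w D) M' := al' \oc (q0 : @hom C _ _).
have comm : (p : @hom C _ _) \oc restr_mor w D = (j : @hom C _ _) \oc q.
  have jE : (j : @hom C _ _) = be \oc restr_mor w A \oc al.
    by rewrite -compA -alE -/(@comp C _ _ _ be' j) compA Kb comp1c.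
  have jal : (j : @hom C _ _) \oc al' = be \oc restr_mor w A.
    by rewrite jE -!compA Ka compc1.
  have sq' : contr_mor w Cs \oc restr_mor w D = restr_mor w A \oc (q0 : @hom C _ _) := sq.
  by rewrite /q compA jal pE -compA sq' compA.
have sqr : @pe_square (FMat w) _ _ _ _ (restr_mor w D) q p j.
  apply/pe_squareP; split=> //.
  - exact: restr_mor_mono.
  - by apply: epi_comp q0e; apply: iso_epi.
  - by apply/(epiP F_perfect w); exists Cs, be.
exists (restr_ob w D), (restr_mor w D), q; split=> //.
apply/(bicartesianP sqr); split=> // e pe.
have [eC|eC] := boolP (e \in Cs).
  have eD := fintype.subsetP CD _ eC.
  by exists (exist _ e eD); rewrite /= /mx_fun eqxx bone_neq0.
have /isoP[bec _ _] := be_iso; have [e' e'e] := bec (exist _ e eC).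
have := pe e'; rewrite pE /= => /eqP; rewrite -[_ == _]negbK.
by rewrite (mx_mulE _ _ (phom_sub be) e'e) bmul_neq0E e'e /mx_tr /mx_fun eqxx bone_neq0.
Qed.

(** Up to isomorphism M = N|A and M' = (N|A)/B. *)
Lemma FMat_PE5 : PE5 (FMat w).
Proof.
move=> M N M' i q [A [al [al_iso iE]]] /(epiP F_perfect) qe.
have [al' al'_iso [aK Ka]] := iso_inv al_iso.
have /(epiP F_perfect w)[B [be [be_iso beE]]] : epi_mx (phom_comp q al').
  by apply: epi_comp qe _; apply: iso_epi.
have [be' be'_iso [bK Kb]] := iso_inv be_iso.
have [B' [j0 [j0m B'A sq]]] := restr_contr_square B.
pose j : @hom C M' (contr_ob w B') := (j0 : @hom C _ _) \oc be'.
have comm : contr_mor w B' \oc (i : @hom C _ _) = j \oc (q : @hom C _ _).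
  have qE : (q : @hom C _ _) = be \oc contr_mor w B \oc al.
    by rewrite -beE -/(@comp C _ _ _ q al') -compA aK compc1.
  have jq : be' \oc (q : @hom C _ _) = contr_mor w B \oc al.
    by rewrite qE !compA bK comp1c.
  have sq' : contr_mor w B' \oc restr_mor w A = (j0 : @hom C _ _) \oc contr_mor w B := sq.
  by rewrite /j -compA jq iE compA sq' compA.
have sqr : @pe_square (FMat w) _ _ _ _ i q (contr_mor w B') j.
  apply/pe_squareP; split=> //.
  - by apply/(monoP F_perfect w); exists A, al.
  - exact: contr_mor_epi.
  - by apply: mono_comp j0m _; apply: iso_mono.
exists (contr_ob w B'), (contr_mor w B'), j; split=> //.
apply/(bicartesianP sqr); split=> // e pe.
have eB : e \in B'.
  rewrite -[_ \in _]negbK; apply/negP => eB; have /eqP := pe (exist _ e eB).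
  by rewrite /= /mx_tr /mx_fun eqxx (negPf (bone_neq0 F)).
have eA := fintype.subsetP B'A _ eB.
have /isoP[_ alr _] := al_iso; have [a ea] := alr (exist _ e eA).
exists a; rewrite iE -[hom_mx _]/(mx_mul (restr_mor w A) al).
have e1 : hom_mx (restr_mor w A) e (exist (fun x => x \in A) e eA) != 0.
  by rewrite /= /mx_fun eqxx bone_neq0.
by rewrite (mx_mulE _ _ (phom_sub (restr_mor w A)) e1) bmul_neq0E e1.
Qed.

Lemma FMat_proto_exact : proto_exact (FMat w).
Proof.
split; first exact: FMat_zero_object.
split; [exact: FMat_PE1|exact: FMat_PE2|exact: FMat_PE3|exact: FMat_PE4|exact: FMat_PE5].
Qed.

End ProtoExact.

(** * The exact symmetric monoidal product *)

Section MonoidalStructure.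
Variable F : idyll.
Hypothesis F_perfect : perfect F.
Variable w : FMat_wf F.
Local Notation C := (FMat_cat F).
Local Notation DS := (FMat_dsum w).
Local Notation pm M := (pclassP M).
Implicit Types M N L U V W : pmatroid F.

Lemma mx_block_mul (S S' S'' T T' T'' : finType)
    (g : S'' -> S' -> F) (f : S' -> S -> F) (g' : T'' -> T' -> F) (f' : T' -> T -> F) :
  submonomial g -> submonomial g' ->
  mx_mul (mx_block g g') (mx_block f f') = mx_block (mx_mul g f) (mx_mul g' f').
Proof.
move=> gs gs'; apply/funext => k; apply/funext => i.
rewrite mx_mul_act mx_act_block //; case: k i => k [i|i] //=.
  by apply: sum1_0 => j; rewrite bmulr0.
by apply: sum1_0 => j; rewrite bmulr0.
Qed.

Definition sum_map (S S' T T' : Type) (g : S -> S') (h : T -> T') (x : S + T) : S' + T' :=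
  match x with inl a => inl (g a) | inr b => inr (h b) end.

Lemma mx_block_fun (S S' T T' : finType) (g : S -> S') (h : T -> T') :
  mx_block (mx_fun F g) (mx_fun F h) = mx_fun F (sum_map g h).
Proof. by apply/funext => -[k|k]; apply/funext => -[i|i]. Qed.

Lemma mx_fun_natural (S S' T T' : finType) (h : S' -> T') (k : T' -> S') (h' : S -> T)
    (f : S' -> S -> F) (g : T' -> T -> F) :
  cancel h k -> cancel k h -> (forall j i, f (k j) i = g j (h' i)) ->
  mx_mul (mx_fun F h) f = mx_mul g (mx_fun F h').
Proof.
move=> hK kK fg; apply/funext => j; apply/funext => i.
by rewrite mx_mul_funr -fg -{1}[j]kK mx_mul_funl //; apply: can_inj hK.
Qed.

Lemma iso_fun M N (f : phom M N) h k : hom_mx f = mx_fun F h ->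
  cancel h k -> cancel k h -> (forall X, pvectors N (X \o k) -> pvectors M X) ->
  @is_iso C M N f.
Proof.
move=> fE hK kK fV; apply/isoP; rewrite fE; split=> [i|j|X].
- by exists (h i); rewrite mx_fun1 bone_neq0.
- by exists (k j); rewrite -{1}[j]kK mx_fun1 bone_neq0.
by rewrite (mx_act_bij X hK kK); apply: fV.
Qed.

Lemma pvec_ds M N Z : pvectors (dsum_ob w M N) Z <->
  pvectors M (Z \o inl) /\ pvectors N (Z \o inr).
Proof. exact: (pvec_dsum (pm M) (pm N) Z). Qed.

Lemma pcov_ds M N Z : pcovectors (dsum_ob w M N) Z <->
  pcovectors M (Z \o inl) /\ pcovectors N (Z \o inr).
Proof. exact: (pcov_dsum F_perfect (pm M) (pm N) Z). Qed.

Lemma FMat_dsum_functorial : functorial (FMat_dsum_fun w).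
Proof.
split=> [[M N]|[M N] [M' N'] [M'' N''] [g g'] [f f']]; apply: phom_ext => /=.
  rewrite mx_block_fun; congr mx_fun; by apply/funext => -[].
by rewrite mx_block_mul //; apply: phom_sub.
Qed.

Lemma FMat_symmetric_monoidal : symmetric_monoidal DS.
Proof.
split; first exact: FMat_dsum_functorial.
- split=> [U V W|U|U|U V].
apply: (@iso_fun _ _ (ds_assoc DS U V W : phom (dsum_ob w (dsum_ob w U V) W)
      (dsum_ob w U (dsum_ob w V W))) (@sum_assoc _ _ _) (@sum_assocV _ _ _) erefl).
    * exact: sum_assocK.
    * exact: sum_assocVK.
    move=> X /pvec_ds[XU /pvec_ds[XV XW]].
    by apply/pvec_ds; split=> //; apply/pvec_ds.
  + split; apply: phom_ext; rewrite /= mx_mul_fun; congr mx_fun.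
    by apply/funext => -[].
  + split; apply: phom_ext; rewrite /= mx_mul_fun; congr mx_fun.
    by apply/funext => -[].
  by apply: phom_ext; rewrite /= mx_mul_fun; congr mx_fun; apply/funext => -[].
- split=> [U U' V V' W W' f g h|U U' f|U U' f|U U' V V' f g]; apply: phom_ext => /=.
  + apply: mx_fun_natural (@sum_assocK _ _ _) (@sum_assocVK _ _ _) _.
    by case=> [j|[j|j]] [[i|i]|i].
  + by apply: mx_fun_natural (@sum_lunitK _) _ _ => // j [[]|i].
  + by apply: mx_fun_natural (@sum_runitK _) _ _ => // j [i|[]].
  + apply: mx_fun_natural (@sum_swapK _ _) (@sum_swapK _ _) _.
    by case=> [j|j] [i|i].
split=> [U V W X|U V|U V W]; apply: phom_ext => /=.
- by rewrite !mx_block_fun !mx_mul_fun; congr mx_fun; apply/funext => -[[[|]|]|].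
- by rewrite !mx_block_fun !mx_mul_fun; congr mx_fun; apply/funext => -[[|[]]|].
by rewrite !mx_block_fun !mx_mul_fun; congr mx_fun; apply/funext => -[[|]|].
Qed.

Lemma ds_in1E U V : hom_mx (ds_in1 DS U V) = mx_fun F inl.
Proof.
apply/funext => k; apply/funext => i /=; rewrite mx_mul_funr.
by case: k.
Qed.

Lemma ds_in2E U V : hom_mx (ds_in2 DS U V) = mx_fun F inr.
Proof.
apply/funext => k; apply/funext => i /=; rewrite mx_mul_funr.
by case: k.
Qed.

Lemma ds_pr1E U V : hom_mx (ds_pr1 DS U V) = mx_tr (mx_fun F inl).
Proof.
apply/funext => k; apply/funext => i /=.
rewrite -[k]/(sum_runit (inl k)) mx_mul_funl; last exact/can_inj/sum_runitK.
by rewrite /mx_tr /mx_fun eq_sym; case: i.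
Qed.

Lemma ds_pr2E U V : hom_mx (ds_pr2 DS U V) = mx_tr (mx_fun F inr).
Proof.
apply/funext => k; apply/funext => i /=.
rewrite -[k]/(sum_lunit (inr k)) mx_mul_funl; last exact/can_inj/sum_lunitK.
by rewrite /mx_tr /mx_fun eq_sym; case: i.
Qed.

Lemma mx_mul_trfunl (S T U : finType) (h : T -> U) (f : U -> S -> F) j i :
  mx_mul (mx_tr (mx_fun F h)) f j i = f (h j) i.
Proof. by rewrite mx_mul_act mx_act_tr_fun. Qed.

Lemma comp_in1E U V W (f : @hom C (dsum_ob w U V) W) k i :
  hom_mx (f \oc ds_in1 DS U V) k i = hom_mx f k (inl i).
Proof.
rewrite -[LHS]/(mx_mul (hom_mx f) (hom_mx (ds_in1 DS U V)) k i).
by rewrite ds_in1E mx_mul_funr.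
Qed.

Lemma comp_in2E U V W (f : @hom C (dsum_ob w U V) W) k i :
  hom_mx (f \oc ds_in2 DS U V) k i = hom_mx f k (inr i).
Proof.
rewrite -[LHS]/(mx_mul (hom_mx f) (hom_mx (ds_in2 DS U V)) k i).
by rewrite ds_in2E mx_mul_funr.
Qed.

Lemma pr1_compE U V W (f : @hom C W (dsum_ob w U V)) k i :
  hom_mx (ds_pr1 DS U V \oc f) k i = hom_mx f (inl k) i.
Proof.
rewrite -[LHS]/(mx_mul (hom_mx (ds_pr1 DS U V)) (hom_mx f) k i).
by rewrite ds_pr1E mx_mul_trfunl.
Qed.

Lemma pr2_compE U V W (f : @hom C W (dsum_ob w U V)) k i :
  hom_mx (ds_pr2 DS U V \oc f) k i = hom_mx f (inr k) i.
Proof.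
rewrite -[LHS]/(mx_mul (hom_mx (ds_pr2 DS U V)) (hom_mx f) k i).
by rewrite ds_pr2E mx_mul_trfunl.
Qed.

Lemma FMat_DS3 : DS3 DS.
Proof.
split=> U V W f g fg1 fg2; apply: phom_ext.
  apply/funext => k; apply/funext => -[i|i].
    by rewrite -!comp_in1E fg1.
  by rewrite -!comp_in2E fg2.
apply/funext => -[k|k]; apply/funext => i.
  by rewrite -!pr1_compE fg1.
by rewrite -!pr2_compE fg2.
Qed.

Lemma mono_block M N M' N' (f : phom M M') (g : phom N N')
    (fg : phom (dsum_ob w M N) (dsum_ob w M' N')) :
  hom_mx fg = mx_block f g -> mono_mx f -> mono_mx g -> mono_mx fg.
Proof.
move=> fgE [fc fV] [gc gV]; split=> [|Z].
  rewrite fgE => -[i|i]; first by have [j ji] := fc i; exists (inl j).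
  by have [j ji] := gc i; exists (inr j).
rewrite fgE (mx_act_block _ (phom_sub f) (phom_sub g)).
by move=> /pvec_ds[Zl Zr]; apply/pvec_ds; split; [apply: fV|apply: gV].
Qed.

Lemma epi_block M N M' N' (f : phom M M') (g : phom N N')
    (fg : phom (dsum_ob w M N) (dsum_ob w M' N')) :
  hom_mx fg = mx_block f g -> epi_mx f -> epi_mx g -> epi_mx fg.
Proof.
move=> fgE [fr fV] [gr gV]; split=> [|Z].
  rewrite fgE => -[j|j]; first by have [i ji] := fr j; exists (inl i).
  by have [i ji] := gr j; exists (inr i).
have fts := submonomial_tr (phom_sub f); have gts := submonomial_tr (phom_sub g).
rewrite fgE mx_tr_block (mx_act_block _ fts gts).
by move=> /pcov_ds[Zl Zr]; apply/pcov_ds; split; [apply: fV|apply: gV].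
Qed.

(** A cone over one component is completed by the zero object in the other. *)
Lemma prod_cartesian (M N M' N' L K L' K' : pmatroid F)
    (i : @hom C M N) (q : @hom C M M') (p : @hom C N N') (j : @hom C M' N')
    (i2 : @hom C L K) (q2 : @hom C L L') (p2 : @hom C K K') (j2 : @hom C L' K') :
  @cartesian (prod_cat C C) (M, L) (N, K) (M', L') (N', K') (i, i2) (q, q2) (p, p2) (j, j2) ->
  cartesian i q p j /\ cartesian i2 q2 p2 j2.
Proof.
move=> [sq cart]; have sq1 := congr1 fst sq; have sq2 := congr1 snd sq.
split; split=> // W h k hk.
  have hk0 : @comp (prod_cat C C) (W, pmatroid0 F) (N, K) (N', K') (p, p2) (h, phom_from0 K)
           = @comp (prod_cat C C) (W, pmatroid0 F) (M', L') (N', K') (j, j2) (k, phom_from0 L').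
    by congr pair; [exact: hk|exact: void_phoml].
  have [u [[iu qu] uu]] := cart (W, pmatroid0 F) (h, phom_from0 K) (k, phom_from0 L') hk0.
  exists u.1; split=> [|v [iv qv]].
    by split; [exact: (congr1 fst iu)|exact: (congr1 fst qu)].
  apply: (congr1 fst (uu (v, u.2) _)).
  by split; congr pair => //; exact: void_phoml.
have hk0 : @comp (prod_cat C C) (pmatroid0 F, W) (N, K) (N', K') (p, p2) (phom_from0 N, h)
         = @comp (prod_cat C C) (pmatroid0 F, W) (M', L') (N', K') (j, j2) (phom_from0 M', k).
  by congr pair; [exact: void_phoml|exact: hk].
have [u [[iu qu] uu]] := cart (pmatroid0 F, W) (phom_from0 N, h) (phom_from0 M', k) hk0.
exists u.2; split=> [|v [iv qv]].
  by split; [exact: (congr1 snd iu)|exact: (congr1 snd qu)].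
apply: (congr1 snd (uu (u.1, v) _)).
by split; congr pair => //; exact: void_phoml.
Qed.

Lemma FMat_DS2 : DS2 DS.
Proof.
split.
- exact: FMat_dsum_functorial.
- exists (ds_lunit DS (pmatroid0 F)); case: FMat_symmetric_monoidal => _ [_ H _ _] _ _.
  by exists (ds_lunitV DS (pmatroid0 F)); apply: H.
- move=> [M N] [M' N'] [f g] [/(monoP F_perfect) fm /(monoP F_perfect) gm].
  by apply/(monoP F_perfect); apply: mono_block fm gm.
- move=> [M N] [M' N'] [f g] [/(epiP F_perfect) fm /(epiP F_perfect) gm].
  by apply/(epiP F_perfect); apply: epi_block fm gm.
move=> [M1 M2] [N1 N2] [M'1 M'2] [N'1 N'2] [i1 i2] [q1 q2] [p1 p2] [j1 j2].
move=> [[/= i1m i2m] [q1e q2e] [p1e p2e] [j1m j2m]] [/prod_cartesian[cart1 cart2] _].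
have sqr : @pe_square (FMat w) _ _ _ _
    (fhom (FMat_dsum_fun w) (X := (M1, M2)) (Y := (N1, N2)) (i1, i2))
    (fhom (FMat_dsum_fun w) (X := (M1, M2)) (Y := (M'1, M'2)) (q1, q2))
    (fhom (FMat_dsum_fun w) (X := (N1, N2)) (Y := (N'1, N'2)) (p1, p2))
    (fhom (FMat_dsum_fun w) (X := (M'1, M'2)) (Y := (N'1, N'2)) (j1, j2)).
  move: i1m i2m q1e q2e p1e p2e j1m j2m.
  move=> /(monoP F_perfect) ? /(monoP F_perfect) ? /(epiP F_perfect) ? /(epiP F_perfect) ?.
  move=> /(epiP F_perfect) ? /(epiP F_perfect) ? /(monoP F_perfect) ? /(monoP F_perfect) ?.
  apply/(pe_squareP F_perfect); split; by [apply: mono_block|apply: epi_block].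
apply/(bicartesianP F_perfect sqr); split.
  have [sq1 _] := cart1; have [sq2 _] := cart2; have [_ fc] := FMat_dsum_functorial.
  have pi := fc (M1, M2) (N1, N2) (N'1, N'2) (p1, p2) (i1, i2).
  have jq := fc (M1, M2) (M'1, M'2) (N'1, N'2) (j1, j2) (q1, q2).
  apply: etrans (esym pi) (etrans _ jq); congr fhom.
  by congr pair; [exact: sq1|exact: sq2].
move=> -[e|e] /= pe.
  have [a ea] := cartesian_kernel_covered w cart1 (fun e' => pe (inl e')).
  by exists (inl a).
have [a ea] := cartesian_kernel_covered w cart2 (fun e' => pe (inr e')).
by exists (inr a).
Qed.

End MonoidalStructure.

(** * Splittings of short exact sequences *)

Section ExactSequences.
Variable F : idyll.
Hypothesis F_perfect : perfect F.
Variable w : FMat_wf F.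
Local Notation C := (FMat_cat F).
Local Notation DS := (FMat_dsum w).
Local Notation pm M := (pclassP M).
Implicit Types M N L U V : pmatroid F.

Definition proj (T : finType) (A : {set T}) (X : T -> F) : T -> F :=
  fun e => if e \in A then X e else 0.

(** Under this condition M is the direct sum of its restrictions to A and to
    the complement of A. *)
Definition proj_stable M (A : {set ground M}) : Prop :=
  forall X, pvectors M X -> pvectors M (proj A X).

Lemma proj_adjoint (T : finType) (A : {set T}) X Y :
  perp (proj A X) Y <-> perp X (proj A Y).
Proof.
by apply: eq_null => e; rewrite /proj; case: ifP => _; rewrite ?bmul0 ?bmulr0.
Qed.

Lemma proj_stable_cov M (A : {set ground M}) Y : proj_stable A ->
  pcovectors M Y -> pcovectors M (proj A Y).
Proof.
move=> A_st YM; apply/(pcov_orth F_perfect _ (pm M)) => X XM.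
apply/proj_adjoint; exact: (pvec_pcov F_perfect (pm M) (A_st X XM) YM).
Qed.

Lemma lift_proj_stable M (A : {set ground M}) :
  (forall X : {x | x \notin A} -> F, pvectors (contr_ob w A) X ->
     pvectors M (mx_act (mx_fun F val) X)) -> proj_stable A.
Proof. exact: (pvec_split F_perfect (pm M)). Qed.

(** The projection is self-adjoint, so it preserves covectors too. Hence
    vectors of the contraction by the complement of A extend by zero to
    vectors of M, which is the hypothesis of [lift_proj_stable] for the
    complement. *)
Lemma proj_stableC M (A : {set ground M}) : proj_stable A -> proj_stable (~: A)%SET.
Proof.
move=> A_st; apply: lift_proj_stable => X XA.
apply/(pvec_orth F_perfect _ (pm M)) => Y /(proj_stable_cov A_st) YA.
apply/(perp_ext _ _ val_inj)/(pvec_pcov F_perfect (pm (contr_ob w (~: A)%SET)) XA).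
apply/(pcov_contr F_perfect _ (pm M)); rewrite (ext_res (fun e => e \notin (~: A)%SET)).
congr (pcovectors M _): YA; apply/funext => e.
by rewrite /proj finset.in_setC negbK.
Qed.

Section ShortExact.
Variables (U X V : pmatroid F) (i : phom U X) (p : phom X V).
Hypothesis ex : @short_exact (FMat w) U X V i p.

Let im : mono_mx i.
Proof. by case: ex => /(pe_squareP F_perfect)[]. Qed.
Let pe : epi_mx p.
Proof. by case: ex => /(pe_squareP F_perfect)[]. Qed.
Let is_ := phom_sub i.
Let ps := phom_sub p.

Let pi0 : mx_mul p i = fun _ _ => 0.
Proof.
have [sqr /(bicartesianP F_perfect sqr)[/phom_eq /= -> _]] := ex.
exact: mul0mx.
Qed.

Let image : {set ground X} := [set e | `[< exists u, i e u != 0 >]]%SET.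

Let in_image e : (e \in image) <-> exists u, i e u != 0.
Proof. by rewrite inE; split=> /asboolP. Qed.

Let covered e : (e \in image) \/ exists v, p v e != 0.
Proof.
have [sqr /(bicartesianP F_perfect sqr)[_ cov]] := ex.
have [?|none] := pselect (exists v, p v e != 0); first by right.
left; apply/in_image/cov => v; apply/eqP/negPn/negP => ve.
by apply: none; exists v.
Qed.

Let disjoint e v : e \in image -> p v e = 0.
Proof.
move=> /in_image[u eu]; apply/eqP/negPn/negP => ve.
have : mx_mul p i v u != 0 by rewrite (mx_mulE _ _ ps ve) bmul_neq0E ve.
by rewrite pi0 eqxx.
Qed.

Section Splitting.
Variable s : phom V X.
Hypothesis sec : mx_mul p s = mx_fun F id.
Let ss := phom_sub s.

Let sec_entry e v : p v e != 0 -> p v e * s e v = 1.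
Proof. by move=> ve; rewrite -(mx_mulE s v ps ve) sec mx_fun1. Qed.

Let sec_neq0 e v : (s e v != 0) <-> (p v e != 0).
Proof.
split=> [ev|ve].
  have : mx_mul p s v v != 0 by rewrite sec mx_fun1 bone_neq0.
  move=> /mx_mul_neq0[e' ve' e'v]; have [_ s_col] := ss.
  by rewrite (s_col _ _ _ ev e'v).
by apply: contraNneq (bone_neq0 F) => ev; rewrite -(sec_entry ve) ev bmulr0.
Qed.

(** A vector of the contraction X/U, extended by zero, is the image under s
    of its image under p. *)
Lemma section_proj_stable : proj_stable image.
Proof.
apply: lift_proj_stable => W WA.
set W' := mx_act _ W.
have W'0 e : e \in image -> W' e = 0.
  by move=> eA; rewrite /W' mx_act_fun0 // => -[b bA] /= eb; rewrite eb (negPf bA) in eA.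
have pW : pvectors V (mx_act p W').
  apply/(pvec_orth F_perfect _ (pm V)) => Y YV; apply/(perp_adjoint _ _ ps).
  apply/(perp_ext _ _ val_inj)/(pvec_pcov F_perfect (pm (contr_ob w image)) WA).
  apply/(pcov_contr F_perfect _ (pm X)); rewrite (ext_res (fun e => e \notin image)).
  congr (pcovectors X _): (phom_cov F_perfect p YV); apply/funext => e.
  by case: ifPn => // /negPn/disjoint p0; rewrite mx_act0.
congr (pvectors X _): (phom_vec s pW); apply/funext => e.
have [eA|[v ve]] := covered e.
  rewrite W'0 // mx_act0 // => v; apply/eqP/negPn/negP => /sec_neq0.
  by rewrite disjoint ?eqxx.
have ev : s e v != 0 by apply/sec_neq0.
rewrite (mx_actE _ ss ev) (mx_actE _ ps ve) bmulA (bmulC (s e v)).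
by rewrite sec_entry ?bmul1.
Qed.

Definition sec_mx : ground X -> ground U + ground V -> F :=
  fun e x => match x with inl u => i e u | inr v => s e v end.

Lemma sec_mx_sub : submonomial sec_mx.
Proof.
have [i_row i_col] := is_; have [s_row s_col] := ss.
have no e u v : i e u != 0 -> s e v != 0 -> False.
  move=> eu /sec_neq0; rewrite disjoint ?eqxx //.
  by apply/in_image; exists u.
split=> [e [u|v] [u'|v'] //= a b|[u|v] e e' //=].
- by rewrite (i_row _ _ _ a b).
- by case: (no _ _ _ a b).
- by case: (no _ _ _ b a).
- by rewrite (s_row _ _ _ a b).
- exact: i_col.
exact: s_col.
Qed.

(** Its inverse is a morphism: i reflects vectors and i composed with the
    first component of the inverse is the projection onto the image of i,
    while the second component is p. *)
Lemma section_iso : exists phi : phom (dsum_ob w U V) X,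
  @is_iso C (dsum_ob w U V) X phi /\ hom_mx phi = sec_mx.
Proof.
have hs := sec_mx_sub.
have hP : is_hom (pvectors (dsum_ob w U V)) (pvectors X) sec_mx.
  apply: (hom_of_pcov F_perfect) => // Y YX; apply/(pcov_ds F_perfect).
  by split; [apply: (phom_cov F_perfect i)|apply: (phom_cov F_perfect s)].
exists (PHom hP); split=> //; apply/isoP; split=> /= [[u|v]|e|Z ZX].
- by case: im => ic _; apply: ic.
- have [_ _] := pe; have [e ve] := (pe).1 v; exists e; exact/sec_neq0.
- have [/in_image[u eu]|[v ve]] := covered e; first by exists (inl u).
  by exists (inr v); apply/sec_neq0.
apply/pvec_ds; split.
  apply: (im).2; have := section_proj_stable ZX; congr (pvectors X _).
  apply/funext => e; rewrite /proj; case: ifPn => [/in_image[u eu]|eA].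
    by rewrite (mx_actE _ is_ eu) (mx_actE _ hs (i := inl u)).
  rewrite mx_act0 // => u; apply/eqP/negPn/negP => eu; move/negP: eA; apply.
  by apply/in_image; exists u.
have := phom_vec p ZX; congr (pvectors V _).
apply/funext => v; have [e ve] := (pe).1 v.
have ev : s e v != 0 by apply/sec_neq0.
rewrite (mx_actE _ ps ve) (mx_actE _ hs (i := inr v)) //=.
by rewrite bmulA sec_entry ?bmul1.
Qed.

End Splitting.

Section Retraction.
Variable r : phom X U.
Hypothesis ret : mx_mul r i = mx_fun F id.
Let rs := phom_sub r.

Let ret_entry e u : r u e != 0 -> r u e * i e u = 1.
Proof. by move=> ue; rewrite -(mx_mulE i u rs ue) ret mx_fun1. Qed.

Let ret_neq0 e u : (r u e != 0) <-> (i e u != 0).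
Proof.
split=> [ue|eu].
  by apply: contraNneq (bone_neq0 F) => eu; rewrite -(ret_entry ue) eu bmulr0.
have : mx_mul r i u u != 0 by rewrite ret mx_fun1 bone_neq0.
move=> /mx_mul_neq0[e' ue' e'u]; have [_ i_col] := is_.
by rewrite (i_col _ _ _ eu e'u).
Qed.

(** The projection onto the image of i is i r. *)
Lemma retraction_proj_stable : proj_stable image.
Proof.
move=> Z ZX; have := phom_vec i (phom_vec r ZX); congr (pvectors X _).
apply/funext => e; rewrite /proj; case: ifPn => [/in_image[u eu]|eA].
  have ue : r u e != 0 by apply/ret_neq0.
  rewrite (mx_actE _ is_ eu) (mx_actE _ rs ue) bmulA (bmulC (i e u)).
  by rewrite ret_entry ?bmul1.
rewrite mx_act0 // => u; apply/eqP/negPn/negP => eu; move/negP: eA; apply.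
by apply/in_image; exists u.
Qed.

Definition ret_mx : ground U + ground V -> ground X -> F :=
  fun x e => match x with inl u => r u e | inr v => p v e end.

Lemma ret_mx_sub : submonomial ret_mx.
Proof.
have [r_row r_col] := rs; have [p_row p_col] := ps.
have no e u v : r u e != 0 -> p v e != 0 -> False.
  move=> /ret_neq0 eu; rewrite disjoint ?eqxx //.
  by apply/in_image; exists u.
split=> [[u|v] e e' //=|e [u|v] [u'|v'] //= a b].
- exact: r_row.
- exact: p_row.
- by rewrite (r_col _ _ _ a b).
- by case: (no _ _ _ a b).
- by case: (no _ _ _ b a).
by rewrite (p_col _ _ _ a b).
Qed.

(** The criterion [iso_covP] applies: if Y is mapped to a covector of X, its
    first component is the image of that covector under the transpose of i,
    and the second component is mapped by the transpose of p to the
    projection of that covector away from the image of i. *)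
Lemma retraction_iso : exists theta : phom X (dsum_ob w U V),
  @is_iso C X (dsum_ob w U V) theta /\ hom_mx theta = ret_mx.
Proof.
have hs := ret_mx_sub.
have hP : is_hom (pvectors X) (pvectors (dsum_ob w U V)) ret_mx.
  split=> // Z ZX; apply/pvec_ds.
  by split; [apply: (phom_vec r)|apply: (phom_vec p)].
exists (PHom hP); split=> //; apply: (iso_covP F_perfect) => /= [e|[u|v]|Y YX].
- have [/in_image[u eu]|[v ve]] := covered e; last by exists (inr v).
  by exists (inl u); apply/ret_neq0.
- by have [e eu] := (im).1 u; exists e; apply/ret_neq0.
- by have [e ve] := (pe).1 v; exists e.
apply/(pcov_ds F_perfect); split.
  have := phom_cov F_perfect i YX; congr (pcovectors U _); apply/funext => u.
  have [e eu] := (im).1 u; have ue : r u e != 0 by apply/ret_neq0.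
  rewrite (mx_actE _ (submonomial_tr is_) (eu : mx_tr i u e != 0)).
  rewrite (mx_actE _ (submonomial_tr hs) (ue : mx_tr ret_mx e (inl u) != 0)).
  by rewrite bmulA [mx_tr i u e * _]bmulC ret_entry ?bmul1.
apply: (pe).2; have := proj_stable_cov (proj_stableC retraction_proj_stable) YX.
congr (pcovectors X _); apply/funext => e; rewrite /proj finset.in_setC.
case: ifPn => [eA|/negPn eA]; last first.
  by rewrite mx_act0 // => v; apply: disjoint.
have [eA'|[v ve]] := covered e; first by rewrite eA' in eA.
rewrite (mx_actE _ (submonomial_tr ps) (ve : mx_tr p e v != 0)).
by rewrite (mx_actE _ (submonomial_tr hs) (ve : mx_tr ret_mx e (inr v) != 0)).
Qed.

End Retraction.

End ShortExact.

(** Uniqueness is [FMat_DS3]. The isomorphism attached to a retraction is the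
    inverse of the one given by [retraction_iso]. *)
Lemma FMat_DS4 : DS4 DS.
Proof.
move=> U X V i p ex; split=> [s /phom_eq sec|r /phom_eq ret].
  have [phi [phi_iso phiE]] := section_iso ex sec; exists phi; split.
    split=> //; apply: phom_ext; apply/funext => e; apply/funext => u.
      by rewrite comp_in1E phiE.
    by rewrite comp_in2E phiE.
  move=> phi' [_ phi'1 phi'2]; apply: (FMat_DS3 w).1.
    rewrite phi'1; apply: phom_ext; apply/funext => e; apply/funext => u.
    by rewrite comp_in1E phiE.
  rewrite phi'2; apply: phom_ext; apply/funext => e; apply/funext => u.
  by rewrite comp_in2E phiE.
have [th [th_iso thE]] := retraction_iso ex ret.
have [psi psi_iso [psith thpsi]] := iso_inv th_iso.
have rE : (r : @hom C _ _) = ds_pr1 DS U V \oc th.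
  by apply: phom_ext; apply/funext => u; apply/funext => e; rewrite pr1_compE thE.
have pE : (p : @hom C _ _) = ds_pr2 DS U V \oc th.
  by apply: phom_ext; apply/funext => u; apply/funext => e; rewrite pr2_compE thE.
exists psi; split.
  split=> //.
    by rewrite rE -compA thpsi compc1.
  by rewrite pE -compA thpsi compc1.
move=> psi' [_ rpsi' ppsi'].
have thpsi' : (th : @hom C X (dsum_ob w U V)) \oc (psi' : @hom C (dsum_ob w U V) X)
    = idc (dsum_ob w U V : C).
  apply: (FMat_DS3 w).2; rewrite compA compc1.
    by rewrite -rE.
  by rewrite -pE.
by rewrite -[psi']comp1c -psith -compA thpsi' compc1.
Qed.

Lemma FMat_exact_direct_sum : exact_direct_sum DS.
Proof.
split; [exact: FMat_symmetric_monoidal|exact: FMat_DS2|exact: FMat_DS3|].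
exact: FMat_DS4.
Qed.

(** * Admissible subobjects of direct sums *)

(** The image of g is the disjoint union of its traces A1 and A2 on the two
    ground sets, and vectors of a direct sum are pairs of vectors, so the
    restriction to the image of g is the direct sum of the restrictions to A1
    and A2. *)
Lemma FMat_combinatorial : combinatorial DS.
Proof.
move=> X U1 U2 g /(monoP F_perfect) [gc gV]; have gs := phom_sub g.
pose A1 : {set ground U1} := [set u | `[< exists x, hom_mx g (inl u) x != 0 >]]%SET.
pose A2 : {set ground U2} := [set u | `[< exists x, hom_mx g (inr u) x != 0 >]]%SET.
pose v (a : {a | a \in A1} + {a | a \in A2}) : ground U1 + ground U2 :=
  sum_map val val a.
have v_inj : injective v by case=> [a|a] [b|b] // [] /val_inj->.
pose f a x := hom_mx g (v a) x.
have fs : submonomial f.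
  have [g_row g_col] := gs; split=> [a x x'|x a a' ax a'x]; first exact: g_row.
  by apply: v_inj; apply: (g_col _ _ _ ax a'x).
have vE : mx_block (mx_fun F val) (mx_fun F val) = mx_fun F v by rewrite mx_block_fun.
have gE : mx_mul (mx_fun F v) f = g.
  apply/funext => e; apply/funext => x.
  have [[a <-]|none] := pselect (exists a, v a = e); first by rewrite mx_mul_funl.
  rewrite mx_mul_act mx_act_fun0 => [|a ea]; last by apply: none; exists a.
  apply/esym/eqP/negPn/negP => ex; apply: none.
  case: e ex => [u|u] ux.
    have uA : u \in A1 by rewrite inE; apply/asboolP; exists x.
    by exists (inl (exist _ u uA)).
  have uA : u \in A2 by rewrite inE; apply/asboolP; exists x.
  by exists (inr (exist _ u uA)).
have vs1 : submonomial (mx_fun F (val : {a | a \in A1} -> ground U1)).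
  exact/submonomial_fun/val_inj.
have vs2 : submonomial (mx_fun F (val : {a | a \in A2} -> ground U2)).
  exact/submonomial_fun/val_inj.
have vecE Z : pvectors (dsum_ob w U1 U2) (mx_act g Z) <->
              pvectors (dsum_ob w (restr_ob w A1) (restr_ob w A2)) (mx_act f Z).
  rewrite -gE mx_act_mul //; last exact: submonomial_fun.
  rewrite -vE mx_act_block //.
  split=> /pvec_ds[Z1 Z2]; apply/pvec_ds; split.
  - exact/(pvec_restr F_perfect _ (pm U1)).
  - exact/(pvec_restr F_perfect _ (pm U2)).
  - exact/(pvec_restr F_perfect _ (pm U1)).
  - exact/(pvec_restr F_perfect _ (pm U2)).
have fP : is_hom (pvectors X) (pvectors (dsum_ob w (restr_ob w A1) (restr_ob w A2))) f.
  by split=> // Z ZX; apply/vecE/phom_vec.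
exists (restr_ob w A1), (restr_ob w A2), (restr_mor w A1), (restr_mor w A2), (PHom fP).
split.
- exact/(monoP F_perfect)/restr_mor_mono.
- exact/(monoP F_perfect)/restr_mor_mono.
- apply/isoP; split=> /= [x|[[u uA]|[u uA]]|Z /vecE/gV //].
  + have [e ex] := gc x; have : mx_mul (mx_fun F v) f e x != 0 by rewrite gE.
    by move=> /mx_mul_neq0[a _ ax]; exists a.
  + by have /asboolP : `[< exists x, hom_mx g (inl u) x != 0 >] by have := uA; rewrite inE.
  by have /asboolP : `[< exists x, hom_mx g (inr u) x != 0 >] by have := uA; rewrite inE.
by apply: phom_ext; rewrite /= vE gE.
Qed.

End ExactSequences.

(** * Duality *)

Section DualityOfMatroids.
Variable F : idyll.
Hypothesis F_perfect : perfect F.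
Variable w : FMat_wf F.
Local Notation C := (FMat_cat F).
Local Notation P := (FMat_dual w).
Local Notation pm M := (pclassP M).

Lemma pvec_dual (M : pmatroid F) : pvectors (dual_ob w M) = pcovectors M.
Proof. exact: pvectors_dual (pm M). Qed.

Lemma pcov_dual (M : pmatroid F) : pcovectors (dual_ob w M) = pvectors M.
Proof. exact: pcovectors_dual (pm M). Qed.

Lemma mono_dual (M N : pmatroid F) (f : phom M N) (g : phom (dual_ob w N) (dual_ob w M)) :
  hom_mx g = mx_tr f -> mono_mx f <-> epi_mx g.
Proof. by move=> gE; rewrite /mono_mx /epi_mx gE !pcov_dual. Qed.

Lemma epi_dual (M N : pmatroid F) (f : phom M N) (g : phom (dual_ob w N) (dual_ob w M)) :
  hom_mx g = mx_tr f -> epi_mx f <-> mono_mx g.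
Proof. by move=> gE; rewrite /mono_mx /epi_mx gE !pvec_dual. Qed.

Lemma FMat_dual_functorial : functorial (du_fun P).
Proof.
split=> [M|M N L g f]; apply: phom_ext; first exact: mx_tr_id.
exact: mx_tr_mul.
Qed.

(** Transposition exchanges [mono_mx] and [epi_mx], since dualizing exchanges
    vectors and covectors. The criterion of [bicartesianP] for the transposed
    square is the contrapositive of the one for the square itself. *)
Lemma FMat_duality : duality P.
Proof.
split.
- exact: FMat_dual_functorial.
- split=> [U|U V f].
    apply: (@iso_fun _ U (dual_ob w (dual_ob w U)) (theta P U) id id erefl) => // X.
    by rewrite pvec_dual pcov_dual.
  by apply: phom_ext; rewrite /= mx_mul1m mx_mulm1.
- by move=> U; apply: phom_ext; rewrite /= mx_mulm1 mx_tr_id.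
split.
- exists (zero_mor (dual_ob w (pmatroid0 F)) (pmatroid0 F)).
  exists (zero_mor (pmatroid0 F) (dual_ob w (pmatroid0 F))).
  by split; apply: phom_ext; apply/funext => -[].
- move=> U V f; have fmono := monoP F_perfect w f.
  have fdual := mono_dual (f := f) (erefl : hom_mx (dum P f) = mx_tr f).
  have fepi := epiP F_perfect w (dum P f).
  by split=> [/fmono/fdual/fepi|/fepi/fdual/fmono].
move=> U X W V i q p j sqr.
have [im qe pe jm] := iffLR (pe_squareP F_perfect w _ _ _ _) sqr.
have sqr' : @pe_square (FMat w) _ _ _ _ (dum P p) (dum P j) (dum P i) (dum P q).
  apply/(pe_squareP F_perfect); split.
  - by apply/(epi_dual (f := p) (g := dum P p) erefl).
  - by apply/(mono_dual (f := j) (g := dum P j) erefl).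
  - by apply/(mono_dual (f := i) (g := dum P i) erefl).
  - by apply/(epi_dual (f := q) (g := dum P q) erefl).
apply: iff_trans (bicartesianP F_perfect sqr) _.
apply: iff_trans (iff_sym (bicartesianP F_perfect sqr')).
split=> -[sq cov]; split.
- apply: phom_ext; have pi := congr1 (@mx_tr F _ _) (phom_eq sq).
  exact: (etrans (esym (mx_tr_mul p i)) (etrans pi (mx_tr_mul j q))).
- move=> e ie; apply: contrapT => none.
  have [|a ea] := cov e; last by have := ie a; rewrite /= /mx_tr => /eqP; rewrite (negPf ea).
  by move=> e'; apply/eqP/negPn/negP => pe'; apply: none; exists e'.
- apply: phom_ext; have pi := congr1 (@mx_tr F _ _) (phom_eq sq).
  have ptr := mx_tr_mul (mx_tr i) (mx_tr p).
  exact: (etrans (esym ptr) (etrans pi (mx_tr_mul (mx_tr q) (mx_tr j)))).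
move=> e pe'; apply: contrapT => none.
have [|a ea] := cov e; last by have := pe' a => /eqP; rewrite (negPf ea).
by move=> a; apply/eqP/negPn/negP => ea; apply: none; exists a.
Qed.

End DualityOfMatroids.

Theorem theoremA (F : idyll) :
  perfect F ->
  exists w : FMat_wf F,
    proto_exact (FMat w) /\
    exact_direct_sum (FMat_dsum w) /\
    combinatorial (FMat_dsum w) /\
    duality (FMat_dual w).
Proof.
move=> F_perfect; exists (FMat_wfP F_perfect).
split; first exact: FMat_proto_exact.
split; first exact: FMat_exact_direct_sum.
split; first exact: FMat_combinatorial.
exact: FMat_duality.
Qed.
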